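(* Let $P$ be a non-elliptic linear differential operator of order $d\ge1$ with analytic coefficients in some open set $\Omega\subseteq\mathbb{R}^n$. If $\mathbf{M}$ is a strongly non-quasianalytic weight sequence, then there is a smooth function $u\in\mathcal{E}(\Omega)$ such that $$u\in\mathcal{E}^{(\mathbf{M})}(\Omega;P)\setminus\mathcal{E}^{\{\mathbf{M}\}}(\Omega).$$
   Context: A weight sequence is a sequence $\mathbf{M}=(M_k)_{k\in\mathbb{N}_0}$ of positive numbers with $M_0=1\le M_1$ such that $\mu_k=M_k/M_{k-1}$ ($k\ge1$) is increasing and $\mu_k\to\infty$. It is strongly non-quasianalytic if there is a constant $A$ such that $\sum_{k=j+1}^\infty \frac{M_{k-1}}{M_k}\le A(j+1)\frac{M_j}{M_{j+1}}$ for all $j\in\mathbb{N}_0$. $\mathcal{E}(\Omega)$ denotes the smooth functions on $\Omega$. $\mathcal{E}^{\{\mathbf{M}\}}(\Omega)$ is the set of $f\in\mathcal{E}(\Omega)$ such that for every compact $K\subset\Omega$ there are $C,h>0$ with $\sup_{x\in K}|D^\alpha f(x)|\le Ch^{|\alpha|}M_{|\alpha|}$ for all $\alpha\in\mathbb{N}_0^n$. For a differential operator $P$ of order $d$, $\mathcal{E}^{(\mathbf{M})}(\Omega;P)$ is the set of distributions $u\in\mathcal{D}'(\Omega)$ such that $P^ku\in L^2_{loc}(\Omega)$ for all $k\in\mathbb{N}_0$ ($P^0=\mathrm{Id}$) and for all compact $K\subset\Omega$ and all $h>0$ there is $C>0$ with $\|P^ku\|_{L^2(K)}\le Ch^kM_{dk}$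 for all $k\in\mathbb{N}_0$. $P=\sum_{|\alpha|\le d}p_\alpha(x)D^\alpha$ is elliptic in $\Omega$ if $p_d(x,\xi)=\sum_{|\alpha|=d}p_\alpha(x)\xi^\alpha\ne0$ for all $x\in\Omega$, $\xi\in\mathbb{R}^n\setminus\{0\}$; otherwise it is non-elliptic. *)

(* Defs.v *)
From HB Require Import structures.
From mathcomp Require Import all_boot all_order all_algebra.
From mathcomp Require Import all_classical all_reals all_analysis.
From mathcomp Require Import complex.

Set Implicit Arguments.
Unset Strict Implicit.
Unset Printing Implicit Defensive.
Import Order.TTheory GRing.Theory Num.Theory.
Import numFieldNormedType.Exports.

Local Open Scope classical_set_scope.
Local Open Scope complex_scope.
Local Open Scope ring_scope.

(* The Borel sigma-algebra of R^n, generated by the coordinate functions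
   'rV[R]_n -> measurableTypeR R. *)
Section row_measurable.
Context {R : realType} (n : nat).

Definition row_coord (i : 'I_n) (v : 'rV[R]_n) : measurableTypeR R := v 0 i.

Let row_set0 : g_sigma_preimage row_coord set0.
Proof. exact: sigma_algebra0. Qed.

Let row_setC A : g_sigma_preimage row_coord A ->
  g_sigma_preimage row_coord (~` A).
Proof. exact: sigma_algebraC. Qed.

Let row_bigcup (F : (set 'rV[R]_n)^nat) :
  (forall i, g_sigma_preimage row_coord (F i)) ->
  g_sigma_preimage row_coord (\bigcup_i (F i)).
Proof. exact: sigma_algebra_bigcup. Qed.

HB.instance Definition _ := @isMeasurable.Build default_measure_display
  'rV[R]_n (g_sigma_preimage row_coord) row_set0 row_setC row_bigcup.

Lemma measurable_row_coord (i : 'I_n) : measurable_fun setT (row_coord i).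
Proof.
move=> _ Y mY; rewrite setTI; apply: sub_sigma_algebra => /=.
rewrite -bigcup_seq/=; exists i => /=; first by rewrite mem_index_enum.
by exists Y => //; rewrite setTI.
Qed.

End row_measurable.

Lemma measurable_fun_row (R : realType) n d (T : measurableType d)
    (f : T -> 'rV[R]_n) :
  (forall i, measurable_fun setT (row_coord i \o f)) -> measurable_fun setT f.
Proof.
move=> mf _ A mA; rewrite setTI.
suff: g_sigma_preimage (fun i => row_coord i \o f) `<=` measurable.
  by apply; rewrite g_sigma_preimage_comp; exists A => //; rewrite setTI.
apply: smallest_sub; first exact: sigma_algebra_measurable.
case: n f mf A mA => [|m] f mf _ _; first by rewrite big_ord0.
rewrite -bigcup_mkord_ord; apply: bigcup_sub => i Ii.
by move=> B [C mC <-]; exact: mf.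
Qed.

Section lebesgue_row.
Context {R : realType}.

Definition row_cons n (p : measurableTypeR R * 'rV[R]_n) : 'rV[R]_n.+1 :=
  \row_i (if unlift ord0 i is Some j then p.2 0 j else p.1).

Definition row_uncons n (v : 'rV[R]_n.+1) : measurableTypeR R * 'rV[R]_n :=
  (v 0 ord0, \row_j v 0 (lift ord0 j)).

Lemma row_consK n : cancel (@row_cons n) (@row_uncons n).
Proof.
move=> [x v]; rewrite /row_uncons mxE unlift_none; congr pair.
by apply/rowP => j; rewrite !mxE liftK.
Qed.

Lemma row_unconsK n : cancel (@row_uncons n) (@row_cons n).
Proof.
move=> v; apply/rowP => i; rewrite mxE.
by case: unliftP => [j|] -> /=; rewrite ?mxE.
Qed.

Lemma measurable_row_cons n : measurable_fun setT (@row_cons n).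
Proof.
apply: measurable_fun_row => i.
rewrite (_ : _ \o _ = if unlift ord0 i is Some j then row_coord j \o snd
                       else fst); last first.
  by apply/funext => p /=; rewrite /row_coord mxE; case: unlift.
case: unlift => [j|]; last exact: measurable_fst.
apply: measurableT_comp; first exact: measurable_row_coord.
exact: measurable_snd.
Qed.

Lemma measurable_row_uncons n : measurable_fun setT (@row_uncons n).
Proof.
apply/measurable_fun_pairP; split => /=.
  exact: (@measurable_row_coord R n.+1 ord0).
apply: measurable_fun_row => i.
rewrite (_ : _ \o _ = @row_coord R n.+1 (lift ord0 i)).
  exact: measurable_row_coord.
by apply/funext => v /=; rewrite /row_coord mxE.
Qed.

Section step.
Context n (mu : {sigma_finite_measure set 'rV[R]_n -> \bar R}).

Definition lebesgue_row_step : set 'rV[R]_n.+1 -> \bar R :=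
  pushforward (lebesgue_measure \x mu)%E (@row_cons n).

Let mpre A : measurable A -> measurable (@row_cons n @^-1` A).
Proof.
by move=> mA; rewrite -[X in measurable X]setTI; exact: measurable_row_cons.
Qed.

Let step0 : lebesgue_row_step set0 = 0%E.
Proof. by rewrite /lebesgue_row_step /pushforward preimage_set0 measure0. Qed.

Let step_ge0 A : (0 <= lebesgue_row_step A)%E.
Proof. exact: (measure_ge0 (lebesgue_measure \x mu)%E). Qed.

Let step_sigma_additive : semi_sigma_additive lebesgue_row_step.
Proof.
move=> F mF tF mUF; rewrite /lebesgue_row_step /pushforward preimage_bigcup.
apply: measure_semi_sigma_additive => [i||]; first exact: mpre.
  apply/trivIsetP => /= i j _ _ ij; rewrite -preimage_setI.
  by move/trivIsetP : tF => /(_ _ _ _ _ ij) ->//; rewrite preimage_set0.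
by rewrite -preimage_bigcup; exact: mpre.
Qed.

HB.instance Definition _ := isMeasure.Build _ _ _ lebesgue_row_step
  step0 step_ge0 step_sigma_additive.

Let step_sigma_finite : sigma_finite setT lebesgue_row_step.
Proof.
have /sigma_finiteP[F [TF ndF Foo]] := sigma_finiteT (@lebesgue_measure R).
have /sigma_finiteP[G [TG ndG Goo]] := sigma_finiteT mu.
exists (fun k => @row_uncons n @^-1` (F k `*` G k)).
  rewrite -preimage_bigcup -(preimage_setT (@row_uncons n)); congr (_ @^-1` _).
  rewrite -setXTT TF TG predeqE => -[x y]; split.
    move=> [/= [k _ Fkx] [l _ Gly]]; exists (maxn k l) => //; split.
    - by move: x Fkx; exact/subsetPset/ndF/leq_maxl.
    - by move: y Gly; exact/subsetPset/ndG/leq_maxr.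
  by move=> [k _ []/= ? ?]; split; exists k.
move=> k; have [? ?] := Foo k; have [? ?] := Goo k; split.
  rewrite -[X in measurable X]setTI; apply: measurable_row_uncons => //.
  exact: measurableX.
rewrite /lebesgue_row_step /pushforward -comp_preimage.
rewrite (_ : _ \o _ = id); last by apply/funext => p /=; exact: row_consK.
by rewrite preimage_id product_measure1E// lte_mul_pinfty// ge0_fin_numE.
Qed.

HB.instance Definition _ := Measure_isSigmaFinite.Build _ _ _ lebesgue_row_step
  step_sigma_finite.

End step.

(* Lebesgue measure on R^n: the n-fold product of lebesgue_measure; see
   lebesgue_row_box. *)
Fixpoint lebesgue_row n : {sigma_finite_measure set 'rV[R]_n -> \bar R} :=
  if n is m.+1 then lebesgue_row_step (lebesgue_row m) else \d_(0 : 'rV[R]_0).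

Lemma lebesgue_row_box n (A : 'I_n -> set (measurableTypeR R)) :
  (forall i, measurable (A i)) ->
  lebesgue_row n [set v | forall i, A i (v 0 i)] =
  (\prod_(i < n) lebesgue_measure (A i))%E.
Proof.
elim: n A => [|n IH] A mA /=.
  rewrite big_ord0 diracE mem_set//= => -[]//.
rewrite /lebesgue_row_step /pushforward /=.
pose B := [set v : 'rV[R]_n | forall i, A (lift ord0 i) (v 0 i)].
have mB : measurable B.
  rewrite (_ : B = \bigcap_(i in setT) (row_coord i @^-1` A (lift ord0 i))).
    apply: fin_bigcap_measurable => [|i _]; first exact: finite_finset.
    by rewrite -[X in measurable X]setTI; exact: measurable_row_coord.
  by apply/seteqP; split=> v /= Bv i => [_|]; exact: Bv.
rewrite (_ : _ @^-1` _ = A ord0 `*` B).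
  rewrite product_measure1E; [|exact: mA|exact: mB].
  rewrite big_ord_recl; congr (_ * _)%E.
  by apply: (IH (fun i => A (lift ord0 i))) => i; exact: mA.
apply/seteqP; split=> -[x v] /= H.
  split=> [|i]; first by have := H ord0; rewrite mxE unlift_none.
  by have := H (lift ord0 i); rewrite mxE liftK.
by move=> i; rewrite mxE; case: unliftP => [j ->|->]; [exact: H.2|exact: H.1].
Qed.

End lebesgue_row.

Section operators.
Context {R : realType} (n : nat).
Local Notation E := 'rV[R]_n.
Local Notation C := R[i].
Local Notation reC := (@complex.Re R).
Local Notation imC := (@complex.Im R).
Local Notation normc := (@Normc.normc R).
Implicit Types (U K : set E) (u f phi : E -> C) (M : nat -> R).

Definition multi := {ffun 'I_n -> nat}.

Definition mdeg (a : multi) : nat := (\sum_(i < n) a i)%N.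

Definition mpow (x : E) (a : multi) : R := \prod_(i < n) x 0 i ^+ a i.

Definition mval d (a : {ffun 'I_n -> 'I_d.+1}) : multi :=
  [ffun i => nat_of_ord (a i)].

(* The sum of F a over all multi-indices a with |a| <= d: such an a has
   components at most d, so it is enumerated by {ffun 'I_n -> 'I_d.+1}. *)
Definition multi_sum d (F : multi -> C) : C :=
  \sum_(a : {ffun 'I_n -> 'I_d.+1} | (mdeg (mval a) <= d)%N) F (mval a).

(* D_j = -i * (j-th partial derivative), so that D^a acts on exp(i<x,xi>) as
   multiplication by xi^a.  Functions on an open set U are represented by total
   functions whose values outside U are irrelevant. *)
Definition Dj (j : 'I_n) u : E -> C := fun x =>
  - ('i)%C * ('D_(delta_mx 0 j) (reC \o u) x +i* 'D_(delta_mx 0 j) (imC \o u) x).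

Definition Dalpha (a : multi) u : E -> C :=
  foldr (fun j v => iter (a j) (Dj j) v) u (enum 'I_n).

(* C^oo on the open set U: the iterated partial derivatives, in any order, exist
   and are continuous. *)
Definition smooth U u := forall (s : seq 'I_n) x, U x ->
  let v := foldr Dj u s in
  [/\ {for x, continuous (reC \o v)}, {for x, continuous (imC \o v)} &
      forall j, derivable (reC \o v) x (delta_mx 0 j) /\
                derivable (imC \o v) x (delta_mx 0 j)].

Definition analytic U f := forall a, U a ->
  exists r, 0 < r /\ exists c : multi -> C, forall x, `|x - a| < r ->
    (\esum_(b in [set: multi]) (normc (c b) * `|mpow (x - a) b|)%:E < +oo)%E /\
    (fun N => normc (multi_sum N (fun b => c b * (mpow (x - a) b)%:C) - f x))
      @ \oo --> (0 : R).

(* A differential operator P = \sum_(|a| <= d) p_a D^a is given by d and the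
   family p of its coefficients; p a is not used when |a| > d. *)
Definition symbol d (p : multi -> E -> C) (x xi : E) : C :=
  \sum_(a : {ffun 'I_n -> 'I_d.+1} | mdeg (mval a) == d)
    p (mval a) x * (mpow xi (mval a))%:C.

Definition elliptic U d (p : multi -> E -> C) :=
  forall x, U x -> forall xi : E, xi != 0 -> symbol d p x xi != 0.

(* The transpose of P for the bilinear pairing (u, phi) |-> \int u phi. *)
Definition transpose_op d (p : multi -> E -> C) phi : E -> C := fun x =>
  multi_sum d (fun a => (-1) ^+ mdeg a * Dalpha a (fun y => p a y * phi y) x).

Definition test_fun U phi := smooth setT phi /\
  exists K, [/\ compact K, K `<=` U & forall x, ~ K x -> phi x = 0].

(* A distribution on U is represented by a functional on all functions, of which
   only the values on test functions matter: it is linear there, and for every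
   compact K of U it is bounded, on test functions supported in K, by a constant
   times the maximum of the sup norms of the derivatives up to some order N. *)
Definition is_distribution U (T : (E -> C) -> C) :=
  (forall (c : C) phi psi, test_fun U phi -> test_fun U psi ->
     T (fun x => c * phi x + psi x) = c * T phi + T psi) /\
  (forall K, compact K -> K `<=` U -> exists (A : R) (N : nat),
     forall phi, smooth setT phi -> (forall x, ~ K x -> phi x = 0) ->
     forall B : R, (forall a x, (mdeg a <= N)%N -> normc (Dalpha a phi x) <= B) ->
       normc (T phi) <= A * B).

Definition regular_dist U f (phi : E -> C) : C :=
  Rintegral (lebesgue_row n) U (fun x => reC (f x * phi x)) +i*
  Rintegral (lebesgue_row n) U (fun x => imC (f x * phi x)).

(* The action of P on distributions: (P T) phi = T (P^t phi). *)
Definition apply_op d p (T : (E -> C) -> C) : (E -> C) -> C :=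
  fun phi => T (transpose_op d p phi).

Definition L2norm K f : \bar R :=
  ('N[lebesgue_row n]_(2%:E)[((fun x => (normc (f x))%:E) \_ K)])%E.

Definition L2loc U f := forall K, compact K -> K `<=` U ->
  [/\ measurable_fun K (reC \o f), measurable_fun K (imC \o f) &
      (L2norm K f < +oo)%E].

Definition weight_sequence M :=
  [/\ forall k, 0 < M k, M 0%N = 1, 1 <= M 1%N,
      forall k, M k.+1 / M k <= M k.+2 / M k.+1 &
      (fun k => M k.+1 / M k) @ \oo --> +oo].

Definition strongly_nonquasianalytic M := exists A : R, forall j : nat,
  (\sum_(j.+1 <= k <oo) (M k.-1 / M k)%:E <= (A * j.+1%:R * (M j / M j.+1))%:E)%E.

Definition roumieu M U u := smooth U u /\
  forall K, compact K -> K `<=` U -> exists A h : R, [/\ 0 < A, 0 < h &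
    forall a x, K x -> normc (Dalpha a u x) <= A * h ^+ mdeg a * M (mdeg a)].

(* f k is the L2loc function representing the distribution P^k T. *)
Definition beurling_vectors M U d p (T : (E -> C) -> C) := is_distribution U T /\
  exists f : nat -> E -> C,
    (forall k, L2loc U (f k) /\
       forall phi, test_fun U phi ->
         iter k (apply_op d p) T phi = regular_dist U (f k) phi) /\
    (forall K (h : R), compact K -> K `<=` U -> 0 < h -> exists2 A : R, 0 < A &
       forall k, (L2norm K (f k) <= (A * h ^+ k * M (d * k)%N)%:E)%E).

End operators.

(* Main.v *)
(* Let x0 and xi != 0 be a zero of the principal symbol. The gaussian packet
   w_t = exp (t (i <x - x0, xi> - |x - x0|^2)) satisfies P^k w_t = w_t P_t^k 1 with
   P_t = \sum_a p_a (D + t phi)^a, phi = xi + 2i (x - x0). In a submultiplicative jet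
   norm of radius eta at x one gets |P^k w_t| <= (C eta t^d)^k for k <= eta^3 t: near
   x0 because the symbol vanishes at (x0, xi), away from x0 because of the decay of
   w_t. For larger k the crude bound (C (k + t))^(dk) is absorbed by M_(dk), since
   strong non-quasianalyticity forces M_q >= (W q)^q eventually, for every W.
   The function u = \sum_j a_j w_(t_j), with t_j = (j+1) mu_(m_j), m_j growing fast and
   a_j = exp (-2 (j+1)) M_(m_j) / mu_(m_j)^(m_j), is then smooth and satisfies the
   Beurling estimates for P. All derivatives (D_l)^k w_t (x0) in a direction with
   xi_l = 1 are real and at least t^k, so there is no cancellation at x0, and the
   term j at k = m_j alone contradicts the Roumieu estimate on the compact {x0}. *)
From HB Require Import structures.
From mathcomp Require Import all_boot all_order all_algebra.
From mathcomp Require Import all_classical all_reals all_analysis.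
From mathcomp Require Import complex measurable_realfun.
From mathcomp Require Import ring lra zify.
Require Import Defs.
Set Implicit Arguments.
Unset Strict Implicit.
Unset Printing Implicit Defensive.
Import Order.TTheory GRing.Theory Num.Theory.
Import numFieldNormedType.Exports.
Local Open Scope classical_set_scope.
Local Open Scope complex_scope.
Local Open Scope ring_scope.

(** * Calculus of D_j and smooth functions *)

(** The exponent 3 in [k <= eta^3 t] comes from the region at distance eta or more from x0, where
    exp (- t eta^2) <= exp (- k / eta) <= eta^k is wanted. The same condition serves near x0: P^k
    involves jets of order dk, so one differentiation in a jet norm of radius eta costs about dk /
    eta, and this stays within O(eta t). Analyticity bounds the coefficients in jet norms uniformly
    in the order of the jet, so that order may grow with k.

    The factor j+1 in t_j is what breaks the Roumieu bound, but it costs (j+1)^d at each application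
    of P. The choice eta_j = (j+1)^-(d+1) pays for this and leaves (c / (j+1))^k, which is at most
    h^k for all large j, whatever h is; each of the finitely many other packets satisfies the
    Beurling estimates with its own constant. The factor exp (-2 (j+1)) absorbs fixed powers of j+1
    and still leaves exp (-(j+1)) for the summation over j.

    The packets are defined on all of R^n and their decay does the localisation, so no cutoff
    functions occur. *)

Section complex_facts.
Context {R : realType}.
Local Notation C := R[i].
Local Notation reC := (@complex.Re R).
Local Notation imC := (@complex.Im R).
Local Notation normc := (@Normc.normc R).
Implicit Types z w : C.

Lemma ReD z w : reC (z + w) = reC z + reC w. Proof. by case: z; case: w. Qed.
Lemma ImD z w : imC (z + w) = imC z + imC w. Proof. by case: z; case: w. Qed.
Lemma ReN z : reC (- z) = - reC z. Proof. by case: z. Qed.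
Lemma ImN z : imC (- z) = - imC z. Proof. by case: z. Qed.
Lemma ReM z w : reC (z * w) = reC z * reC w - imC z * imC w.
Proof. by case: z; case: w. Qed.
Lemma ImM z w : imC (z * w) = reC z * imC w + imC z * reC w.
Proof. by case: z; case: w. Qed.

Lemma Re_sum I (r : seq I) (P : pred I) (F : I -> C) :
  reC (\sum_(i <- r | P i) F i) = \sum_(i <- r | P i) reC (F i).
Proof. by elim/big_rec2: _ => // i x y _ <-; rewrite ReD. Qed.
Lemma Im_sum I (r : seq I) (P : pred I) (F : I -> C) :
  imC (\sum_(i <- r | P i) F i) = \sum_(i <- r | P i) imC (F i).
Proof. by elim/big_rec2: _ => // i x y _ <-; rewrite ImD. Qed.

Lemma normc_ge0 z : 0 <= normc z.
Proof. by case: z => a b; exact: sqrtr_ge0. Qed.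

Lemma normcD z w : normc (z + w) <= normc z + normc w.
Proof. exact: le_normcD. Qed.

Lemma normcBC z w : normc (z - w) = normc (w - z).
Proof. by rewrite -normcN opprB. Qed.

Lemma normc_sum I (r : seq I) (P : pred I) (F : I -> C) :
  normc (\sum_(i <- r | P i) F i) <= \sum_(i <- r | P i) normc (F i).
Proof.
elim/big_rec2: _ => [|i x y _ h]; first by rewrite Normc.normc0.
by apply: le_trans (normcD _ _) _; rewrite lerD2l.
Qed.

Lemma normc_real (a : R) : normc a%:C = `|a|.
Proof. by rewrite /= expr0n addr0 sqrtr_sqr. Qed.

Lemma normc_i : normc 'i = 1.
Proof. by rewrite /= expr0n expr1n add0r sqrtr1. Qed.

Lemma normRe z : `|reC z| <= normc z.
Proof.
case: z => a b /=; rewrite -sqrtr_sqr ler_sqrt ?lerDl ?sqr_ge0//.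
by rewrite addr_ge0// sqr_ge0.
Qed.
Lemma normIm z : `|imC z| <= normc z.
Proof.
case: z => a b /=; rewrite -sqrtr_sqr ler_sqrt ?lerDr ?sqr_ge0//.
by rewrite addr_ge0// sqr_ge0.
Qed.
Lemma normc_le_ReIm z : normc z <= `|reC z| + `|imC z|.
Proof.
rewrite [in leLHS](_ : z = (reC z)%:C + 'i * (imC z)%:C); last first.
  by case: z => a b; simpc.
by apply: le_trans (normcD _ _) _; rewrite Normc.normcM normc_i mul1r !normc_real.
Qed.

End complex_facts.

Section calculus.
Context {R : realType} {n : nat}.
Local Notation E := 'rV[R]_n.
Local Notation C := R[i].
Local Notation reC := (@complex.Re R).
Local Notation imC := (@complex.Im R).
Implicit Types (U : set E) (u v f g : E -> C) (j : 'I_n) (x : E).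

Definition C1_at u x := [/\ {for x, continuous (reC \o u)},
  {for x, continuous (imC \o u)} &
  forall j, derivable (reC \o u) x (delta_mx 0 j) /\
            derivable (imC \o u) x (delta_mx 0 j)].

Lemma near_eqRe u v x : (\near x, u x = v x) -> \near x, (reC \o u) x = (reC \o v) x.
Proof. by apply: filterS => y /= ->. Qed.
Lemma near_eqIm u v x : (\near x, u x = v x) -> \near x, (imC \o u) x = (imC \o v) x.
Proof. by apply: filterS => y /= ->. Qed.

Lemma near_eq_continuous_at (T : topologicalType) (f g : E -> T) x :
  (\near x, f x = g x) -> {for x, continuous f} -> {for x, continuous g}.
Proof.
move=> fg cf; have e := nbhs_singleton fg; rewrite /prop_for /continuous_at -e.
apply: cvg_trans cf; apply: (@near_eq_cvg _ _ (nbhs x)).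
exact: fg.
Qed.

Lemma near_eq_C1_at u v x : (\near x, u x = v x) -> C1_at u x -> C1_at v x.
Proof.
move=> uv [h1 h2 h3]; have r := near_eqRe uv; have i := near_eqIm uv.
split; [exact: near_eq_continuous_at h1|exact: near_eq_continuous_at h2|].
by move=> j; have [h4 h5] := h3 j; split; [exact: near_eq_derivable r h4|exact: near_eq_derivable i h5].
Qed.

Lemma near_eq_Dj u v x j : (\near x, u x = v x) -> Dj j u x = Dj j v x.
Proof.
move=> uv; rewrite /Dj (near_eq_derive _ (near_eqRe uv)).
by rewrite (near_eq_derive _ (near_eqIm uv)).
Qed.

Lemma open_near_eq U u v x : open U -> U x -> (forall y, U y -> u y = v y) ->
  \near x, u x = v x.
Proof. by move=> oU Ux uv; near do apply: uv; exact: open_nbhs_nbhs. Unshelve. all: by end_near. Qed.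

Lemma eq_Dj U u v x j : open U -> U x -> (forall y, U y -> u y = v y) ->
  Dj j u x = Dj j v x.
Proof. by move=> oU Ux uv; apply: near_eq_Dj; exact: open_near_eq Ux uv. Qed.

Lemma eq_foldr_Dj U u v (s : seq 'I_n) : open U -> (forall y, U y -> u y = v y) ->
  forall x, U x -> foldr (@Dj R n) u s x = foldr (@Dj R n) v s x.
Proof. by move=> oU uv; elim: s => //= j s IH x Ux; exact: eq_Dj oU Ux IH. Qed.

Lemma DjE u x j : Dj j u x =
  'D_(delta_mx 0 j) (imC \o u) x +i* - 'D_(delta_mx 0 j) (reC \o u) x.
Proof. by rewrite /Dj; simpc. Qed.

Lemma derive_Re u x j : 'D_(delta_mx 0 j) (reC \o u) x = - imC (Dj j u x).
Proof. by rewrite DjE /= opprK. Qed.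
Lemma derive_Im u x j : 'D_(delta_mx 0 j) (imC \o u) x = reC (Dj j u x).
Proof. by rewrite DjE. Qed.

Local Opaque derive derivable.

Lemma C1_atD u v x : C1_at u x -> C1_at v x -> C1_at (fun y => u y + v y) x.
Proof.
move=> [u1 u2 u3] [v1 v2 v3].
have e1 : reC \o (fun y => u y + v y) = (reC \o u) + (reC \o v).
  by apply/funext => y /=; rewrite ReD.
have e2 : imC \o (fun y => u y + v y) = (imC \o u) + (imC \o v).
  by apply/funext => y /=; rewrite ImD.
split; rewrite ?e1 ?e2; [exact: (continuousD u1 v1)|exact: (continuousD u2 v2)|].
move=> j; have [d1 d2] := u3 j; have [d3 d4] := v3 j.
by split; [exact: (derivableD d1 d3)|exact: (derivableD d2 d4)].
Qed.

Lemma C1_atM u v x : C1_at u x -> C1_at v x -> C1_at (fun y => u y * v y) x.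
Proof.
move=> [u1 u2 u3] [v1 v2 v3].
have e1 : reC \o (fun y => u y * v y) = (reC \o u) * (reC \o v) - (imC \o u) * (imC \o v).
  by apply/funext => y /=; rewrite ReM.
have e2 : imC \o (fun y => u y * v y) = (reC \o u) * (imC \o v) + (imC \o u) * (reC \o v).
  by apply/funext => y /=; rewrite ImM.
split; rewrite ?e1 ?e2.
- exact: (continuousB (continuousM u1 v1) (continuousM u2 v2)).
- exact: (continuousD (continuousM u1 v2) (continuousM u2 v1)).
move=> j; have [d1 d2] := u3 j; have [d3 d4] := v3 j; split.
- exact: (derivableB (derivableM d1 d3) (derivableM d2 d4)).
- exact: (derivableD (derivableM d1 d4) (derivableM d2 d3)).
Qed.

Lemma C1_at_cst (c : C) x : C1_at (fun=> c) x.
Proof.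
split=> [||j].
- exact: (@cst_continuous E R (reC c) x).
- exact: (@cst_continuous E R (imC c) x).
by split; [exact: (derivable_cst (reC c))|exact: (derivable_cst (imC c))].
Qed.

Lemma DjD u v x j : C1_at u x -> C1_at v x ->
  Dj j (fun y => u y + v y) x = Dj j u x + Dj j v x.
Proof.
move=> [_ _ /(_ j)[u1 u2]] [_ _ /(_ j)[v1 v2]]; rewrite !DjE.
have -> : reC \o (fun y => u y + v y) = (reC \o u) + (reC \o v).
  by apply/funext => y /=; rewrite ReD.
have -> : imC \o (fun y => u y + v y) = (imC \o u) + (imC \o v).
  by apply/funext => y /=; rewrite ImD.
have e1 := deriveD u1 v1; have e2 := deriveD u2 v2.
by rewrite e1 e2 opprD.
Qed.

Lemma DjM u v x j : C1_at u x -> C1_at v x ->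
  Dj j (fun y => u y * v y) x = Dj j u x * v x + u x * Dj j v x.
Proof.
move=> [_ _ /(_ j)[u1 u2]] [_ _ /(_ j)[v1 v2]]; rewrite !DjE.
have -> : reC \o (fun y => u y * v y) = (reC \o u) * (reC \o v) - (imC \o u) * (imC \o v).
  by apply/funext => y /=; rewrite ReM.
have -> : imC \o (fun y => u y * v y) = (reC \o u) * (imC \o v) + (imC \o u) * (reC \o v).
  by apply/funext => y /=; rewrite ImM.
have e1 := deriveB (derivableM u1 v1) (derivableM u2 v2).
have e2 := deriveD (derivableM u1 v2) (derivableM u2 v1).
rewrite e1 e2 (deriveM u1 v1) (deriveM u2 v2) (deriveM u1 v2) (deriveM u2 v1).
rewrite /GRing.scale/=; case: (u x) (v x) => [a b] [c e] /=; simpc.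
move: ('D__ (reC \o u) x) ('D__ (imC \o u) x) ('D__ (reC \o v) x) ('D__ (imC \o v) x) => p q r s.
by congr (_ +i* _); ring.
Qed.

Lemma Dj_cst (c : C) x j : Dj j (fun=> c) x = 0.
Proof.
rewrite DjE (_ : reC \o _ = cst (reC c))// (_ : imC \o _ = cst (imC c))//.
by rewrite !derive_cst oppr0.
Qed.

Lemma DjZ (c : C) u x j : C1_at u x -> Dj j (fun y => c * u y) x = c * Dj j u x.
Proof.
by move=> cu; rewrite (DjM _ (C1_at_cst c x) cu) Dj_cst mul0r add0r.
Qed.

Local Opaque Dj C1_at.

(** Smoothness in a form suited to induction: the recursion is on the order and leaves the function
    free, as the product rule requires, where the derivative of a product is a sum of products of
    other functions. [smoothP] links it to [smooth]. *)
Fixpoint Ck U (m : nat) u : Prop := (forall x, U x -> C1_at u x) /\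
  if m is m'.+1 then forall j, Ck U m' (Dj j u) else True.

Lemma Ck_C1 U m u : Ck U m u -> forall x, U x -> C1_at u x.
Proof. by case: m => [|m] []. Qed.

Lemma smooth_C1 U u : smooth U u -> forall x, U x -> C1_at u x.
Proof. by move=> su x Ux; exact: (su [::] x Ux). Qed.

Lemma smooth_Dj U u j : smooth U u -> smooth U (Dj j u).
Proof. by move=> su s x Ux /=; have := su (rcons s j) x Ux; rewrite /= foldr_rcons. Qed.

Lemma smooth_foldr U u s : smooth U u -> smooth U (foldr (@Dj R n) u s).
Proof. by move=> su; elim: s => [|j s IH]; [exact: su|exact: (smooth_Dj (u := foldr (@Dj R n) u s))]. Qed.

Lemma smoothP U u : smooth U u <-> forall m, Ck U m u.
Proof.
split=> [su m|cu s x Ux /=].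
  elim: m u su => [|m IH] u su; split; [exact: smooth_C1|by []|exact: smooth_C1|].
  by move=> j; apply: IH; exact: smooth_Dj.
suff : forall m v, size s = m -> Ck U m v -> forall x, U x -> C1_at (foldr (@Dj R n) v s) x.
  by move=> /(_ (size s) u); apply.
(* [foldr] applies the last letter of the word first, whereas [Ck] peels off the first derivative
   taken; hence the induction from the right end. *)
elim/last_ind: s {x Ux cu u} => [|s j IH] m u.
  by move=> _; exact: Ck_C1.
rewrite size_rcons => <- [_ cu] x Ux; rewrite foldr_rcons.
exact: IH (size s) _ _ (cu j) _ Ux.
Qed.

Lemma CkW U m u : Ck U m.+1 u -> Ck U m u.
Proof.
elim: m u => [|m IH] u; first by move=> [].
by move=> [h1 h2]; split=> // j; apply: IH; exact: h2.
Qed.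

Local Opaque smooth.

Section open.
Variable (U : set E).
Hypothesis oU : open U.

Lemma Ck_eq m u v : (forall x, U x -> u x = v x) -> Ck U m u -> Ck U m v.
Proof.
elim: m u v => [|m IH] u v uv [h1 h2].
  split; [move=> x Ux; apply: near_eq_C1_at (h1 x Ux)|by []].
  exact: open_near_eq oU Ux uv.
split=> [x Ux|j].
  by apply: near_eq_C1_at (h1 x Ux); exact: open_near_eq Ux uv.
by apply: IH (h2 j) => x Ux; exact: eq_Dj Ux uv.
Qed.

Lemma CkD m u v : Ck U m u -> Ck U m v -> Ck U m (fun y => u y + v y).
Proof.
elim: m u v => [|m IH] u v [u1 u2] [v1 v2].
  by split; [move=> x Ux; exact: C1_atD (u1 x Ux) (v1 x Ux)|].
split=> [x Ux|j]; first exact: C1_atD (u1 x Ux) (v1 x Ux).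
apply: Ck_eq (IH _ _ (u2 j) (v2 j)) => x Ux.
by rewrite (DjD _ (u1 x Ux) (v1 x Ux)).
Qed.

Lemma CkM m u v : Ck U m u -> Ck U m v -> Ck U m (fun y => u y * v y).
Proof.
elim: m u v => [|m IH] u v.
  by move=> [u1 u2] [v1 v2]; split; [move=> x Ux; exact: C1_atM (u1 x Ux) (v1 x Ux)|].
move=> Cu Cv; have [u1 u2] := Cu; have [v1 v2] := Cv.
split=> [x Ux|j]; first exact: C1_atM (u1 x Ux) (v1 x Ux).
have := CkD (IH _ _ (u2 j) (CkW Cv)) (IH _ _ (CkW Cu) (v2 j)).
by apply: Ck_eq => x Ux; rewrite (DjM _ (u1 x Ux) (v1 x Ux)).
Qed.

Lemma eq_smooth u v : (forall x, U x -> u x = v x) -> smooth U u -> smooth U v.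
Proof. by move=> uv /smoothP su; apply/smoothP => m; exact: Ck_eq uv _. Qed.

Lemma smoothD u v : smooth U u -> smooth U v -> smooth U (fun y => u y + v y).
Proof. by move=> /smoothP su /smoothP sv; apply/smoothP => m; exact: CkD. Qed.

Lemma smoothM u v : smooth U u -> smooth U v -> smooth U (fun y => u y * v y).
Proof. by move=> /smoothP su /smoothP sv; apply/smoothP => m; exact: CkM. Qed.

Lemma smooth_cst (c : C) : smooth U (fun=> c).
Proof.
apply/smoothP => m; elim: m c => [|m IH] c; split; [|by []| |].
- by move=> x _; exact: C1_at_cst.
- by move=> x _; exact: C1_at_cst.
- by move=> j; apply: Ck_eq (IH 0) => x Ux; rewrite Dj_cst.
Qed.

Lemma smoothZ c u : smooth U u -> smooth U (fun y => c * u y).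
Proof. by apply: smoothM; exact: smooth_cst. Qed.

Lemma smooth_sum I (r : seq I) (P : pred I) (F : I -> E -> C) :
  (forall i, P i -> smooth U (F i)) -> smooth U (fun y => \sum_(i <- r | P i) F i y).
Proof.
move=> sF; elim: r => [|i r IH].
  by apply: eq_smooth (smooth_cst 0) => x _; rewrite big_nil.
have [Pi|nPi] := boolP (P i); last first.
  by apply: eq_smooth IH => x _; rewrite big_cons (negPf nPi).
apply: eq_smooth (smoothD (sF i Pi) IH) => x _.
by rewrite big_cons Pi.
Qed.

Lemma smooth_prod I (r : seq I) (P : pred I) (F : I -> E -> C) :
  (forall i, P i -> smooth U (F i)) -> smooth U (fun y => \prod_(i <- r | P i) F i y).
Proof.
move=> sF; elim: r => [|i r IH].
  by apply: eq_smooth (smooth_cst 1) => x _; rewrite big_nil.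
have [Pi|nPi] := boolP (P i); last first.
  by apply: eq_smooth IH => x _; rewrite big_cons (negPf nPi).
apply: eq_smooth (smoothM (sF i Pi) IH) => x _.
by rewrite big_cons Pi.
Qed.

Lemma smoothX u k : smooth U u -> smooth U (fun y => u y ^+ k).
Proof.
move=> su; elim: k => [|k IH]; first exact: smooth_cst.
by apply: eq_smooth (smoothM su IH) => x _; rewrite exprS.
Qed.

Lemma foldr_DjD u v s x : smooth U u -> smooth U v -> U x ->
  foldr (@Dj R n) (fun y => u y + v y) s x = foldr (@Dj R n) u s x + foldr (@Dj R n) v s x.
Proof.
move=> su sv; elim: s x => //= j s IH x Ux.
by rewrite (eq_Dj _ oU Ux IH) (DjD _ (su s x Ux) (sv s x Ux)).
Qed.

Lemma foldr_DjZ c u s x : smooth U u -> U x ->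
  foldr (@Dj R n) (fun y => c * u y) s x = c * foldr (@Dj R n) u s x.
Proof.
move=> su; elim: s x => //= j s IH x Ux.
by rewrite (eq_Dj _ oU Ux IH) (DjZ _ _ (su s x Ux)).
Qed.

End open.

Lemma smooth_sub U V u : V `<=` U -> smooth U u -> smooth V u.
Proof. by move=> VU su s x /VU Ux; exact: su. Qed.

Lemma smooth_local U u : (forall x, U x -> exists2 V, V x & smooth V u) -> smooth U u.
Proof. by move=> h s x /h[V Vx sV]; exact: sV. Qed.

End calculus.

(** * Jet norms *)

(** The left-hand side collects the products [F i * G k] with i + k <= N, a part of the nonnegative
    terms of the expanded right-hand side. *)
Lemma cauchy_product_le (R : realDomainType) (F G : nat -> R) (N : nat) :
  (forall i, 0 <= F i) -> (forall i, 0 <= G i) ->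
  \sum_(m < N.+1) \sum_(i < m.+1) F i * G (m - i)%N <=
  (\sum_(i < N.+1) F i) * (\sum_(i < N.+1) G i).
Proof.
move=> F0 G0.
under eq_bigr => m _.
  rewrite (big_ord_widen N.+1 (fun i => F i * G (m - i)%N))//.
  over.
rewrite (exchange_big_dep xpredT)//= mulr_suml; apply: ler_sum => i _.
rewrite -mulr_sumr ler_wpM2l//.
rewrite -(big_geq_mkord i N.+1 xpredT (fun m => G (m - i)%N)) -{1}[i : nat]add0n big_addn.
rewrite -(big_mkord xpredT G) (@big_cat_nat _ _ _ (N.+1 - i)%N 0 N.+1) ?leq_subr//=.
under eq_big_nat => k _ do rewrite addnK.
by rewrite lerDl; apply: sumr_ge0.
Qed.

Section norms.
Context {R : realType} {n : nat}.
Local Notation E := 'rV[R]_n.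
Local Notation C := R[i].
Local Notation normc := (@Normc.normc R).
Local Notation D := (@Dj R n).
Implicit Types (u v f g : E -> C) (j : 'I_n) (x : E).
Local Opaque smooth Dj C1_at.

(** The l^1 norm of the derivatives of order m, indexed by words of length m instead of
    multi-indices: no symmetry of mixed derivatives is involved, and the Leibniz rule has plain
    binomial coefficients. *)
Fixpoint order_norm m f x : R :=
  if m is m'.+1 then \sum_(j < n) order_norm m' (D j f) x else normc (f x).

(* The l^1 norm, with radius rho, of the Taylor polynomial of f at x of degree N
   (up to constants depending on n): it is submultiplicative, and a derivative
   costs a factor N / rho and one degree. *)
Definition jet_norm (rho : R) N f x : R :=
  \sum_(m < N.+1) order_norm m f x * (rho ^+ m / m`!%:R).

Lemma order_norm_ge0 m f x : 0 <= order_norm m f x.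
Proof. by elim: m f => [|m IH] f /=; [exact: normc_ge0|apply: sumr_ge0]. Qed.

Lemma order_norm_Dj m f j x : order_norm m (D j f) x <= order_norm m.+1 f x.
Proof.
rewrite /= (bigD1 j)//= lerDl; apply: sumr_ge0 => i _; exact: order_norm_ge0.
Qed.

Lemma order_norm_foldr m f s x :
  order_norm m (foldr D f s) x <= order_norm (m + size s) f x.
Proof.
elim: s m => [|j s IH] m /=; first by rewrite addn0.
by apply: le_trans (order_norm_Dj _ _ _ _) _; rewrite addnS -addSn; exact: IH.
Qed.

Section onU.
Variable U : set E.
Hypothesis oU : open U.

Lemma eq_order_norm m f g x : U x -> (forall y, U y -> f y = g y) ->
  order_norm m f x = order_norm m g x.
Proof.
move=> Ux; elim: m f g => [|m IH] f g fg /=; first by rewrite fg.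
by apply: eq_bigr => j _; apply: IH => y Uy; exact: (eq_Dj _ oU Uy fg).
Qed.

Lemma order_normD m f g x : smooth U f -> smooth U g -> U x ->
  order_norm m (fun y => f y + g y) x <= order_norm m f x + order_norm m g x.
Proof.
move=> sf sg Ux; elim: m f g sf sg => [|m IH] f g sf sg /=; first exact: normcD.
rewrite -big_split/=; apply: ler_sum => j _.
rewrite (@eq_order_norm _ _ (fun y => D j f y + D j g y) _ Ux); last first.
  by move=> y Uy; exact: (DjD _ (smooth_C1 sf Uy) (smooth_C1 sg Uy)).
by apply: IH; exact: smooth_Dj.
Qed.

Lemma order_normZ m (c : C) f x : smooth U f -> U x ->
  order_norm m (fun y => c * f y) x = normc c * order_norm m f x.
Proof.
move=> sf Ux; elim: m f sf => [|m IH] f sf /=; first exact: Normc.normcM.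
rewrite mulr_sumr; apply: eq_bigr => j _.
rewrite (@eq_order_norm _ _ (fun y => c * D j f y) _ Ux); last first.
  by move=> y Uy; exact: (DjZ _ _ (smooth_C1 sf Uy)).
by apply: IH; exact: smooth_Dj.
Qed.

Lemma order_norm0 m x : U x -> order_norm m (fun=> 0) x = 0.
Proof.
move=> Ux.
elim: m => [|m IH] /=; first exact: Normc.normc0.
rewrite big1// => j _; rewrite (@eq_order_norm _ _ (fun=> 0) _ Ux)// => y Uy.
exact: Dj_cst.
Qed.

Lemma order_norm_cst m c x : U x -> order_norm m (fun=> c) x = if m is 0%N then normc c else 0.
Proof.
case: m => // m Ux /=.
rewrite big1// => j _; rewrite (@eq_order_norm _ _ (fun=> 0) _ Ux) ?order_norm0// => y Uy.
exact: Dj_cst.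
Qed.

(** Leibniz rule summed over all words. In the inductive step the new letter falls on f or on g, and
    Pascal's rule recombines the two sums. *)
Lemma order_normM m f g x : smooth U f -> smooth U g -> U x ->
  order_norm m (fun y => f y * g y) x <=
  \sum_(i < m.+1) 'C(m, i)%:R * (order_norm i f x * order_norm (m - i) g x).
Proof.
move=> sf sg Ux; elim: m f g sf sg => [|m IH] f g sf sg.
  by rewrite big_ord1 bin0 mul1r subn0 /= Normc.normcM.
have step j : order_norm m (D j (fun y => f y * g y)) x <=
    \sum_(i < m.+1) 'C(m, i)%:R * (order_norm i (D j f) x * order_norm (m - i) g x) +
    \sum_(i < m.+1) 'C(m, i)%:R * (order_norm i f x * order_norm (m - i) (D j g) x).
  rewrite (@eq_order_norm _ _ (fun y => D j f y * g y + f y * D j g y) _ Ux).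
    apply: le_trans (order_normD _ _ _ Ux) _.
    - exact: (smoothM oU (smooth_Dj j sf) sg).
    - exact: (smoothM oU sf (smooth_Dj j sg)).
    exact: lerD (IH _ _ (smooth_Dj j sf) sg) (IH _ _ sf (smooth_Dj j sg)).
  by move=> y Uy; exact: (DjM _ (smooth_C1 sf Uy) (smooth_C1 sg Uy)).
have -> : \sum_(i < m.+2) 'C(m.+1, i)%:R * (order_norm i f x * order_norm (m.+1 - i) g x) =
   \sum_(i < m.+1) 'C(m, i)%:R * (order_norm i.+1 f x * order_norm (m - i) g x) +
   \sum_(i < m.+1) 'C(m, i)%:R * (order_norm i f x * order_norm (m - i).+1 g x).
  rewrite big_ord_recl bin0 subn0.
  under eq_bigr => i _ do rewrite lift0 binS subSS natrD mulrDl.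
  rewrite big_split/= addrCA [in RHS]addrC addrA; congr (_ + _).
  rewrite [RHS]big_ord_recl/= bin0 subn0 addrC; congr (_ + _).
  rewrite big_ord_recr/= bin_small// mul0r addr0.
  by apply: eq_bigr => i _; rewrite /bump/= add1n -(subnSK (ltn_ord i)).
rewrite [leLHS]/=; apply: le_trans (ler_sum _ (fun j _ => step j)) _.
rewrite big_split/= lerD// exchange_big/=; apply: ler_sum => i _.
- by rewrite -mulr_sumr -mulr_suml.
- by rewrite -mulr_sumr -mulr_sumr.
Qed.

Section rho.
Variables (rho : R) (x : E).
Hypotheses (rho0 : 0 < rho) (Ux : U x).

Let w_ge0 m : 0 <= rho ^+ m / m`!%:R.
Proof. by rewrite divr_ge0// exprn_ge0// ltW. Qed.

Lemma jet_norm_ge0 N f : 0 <= jet_norm rho N f x.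
Proof. by apply: sumr_ge0 => m _; rewrite mulr_ge0// order_norm_ge0. Qed.

Lemma jet_norm0 f : jet_norm rho 0 f x = normc (f x).
Proof. by rewrite /jet_norm big_ord1 expr0 fact0 divr1 mulr1. Qed.

Lemma jet_norm_mono N N' f : (N <= N')%N -> jet_norm rho N f x <= jet_norm rho N' f x.
Proof.
move=> NN'; rewrite /jet_norm (big_ord_widen N'.+1 (fun m => order_norm m f x * (rho ^+ m / m`!%:R)))//.
rewrite [leRHS](bigID (fun i : 'I__ => (i < N.+1)%N))/= lerDl.
by apply: sumr_ge0 => m _; rewrite mulr_ge0// order_norm_ge0.
Qed.

Lemma eq_jet_norm N f g : (forall y, U y -> f y = g y) -> jet_norm rho N f x = jet_norm rho N g x.
Proof. by move=> fg; apply: eq_bigr => m _; rewrite (eq_order_norm _ Ux fg). Qed.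

Lemma jet_normD N f g : smooth U f -> smooth U g ->
  jet_norm rho N (fun y => f y + g y) x <= jet_norm rho N f x + jet_norm rho N g x.
Proof.
move=> sf sg; rewrite -big_split/=; apply: ler_sum => m _.
by rewrite -mulrDl ler_wpM2r// order_normD.
Qed.

Lemma jet_normZ N (c : C) f : smooth U f ->
  jet_norm rho N (fun y => c * f y) x = normc c * jet_norm rho N f x.
Proof.
move=> sf; rewrite mulr_sumr; apply: eq_bigr => m _.
by rewrite (order_normZ m c sf Ux) -mulrA.
Qed.

Lemma jet_norm_cst N c : jet_norm rho N (fun=> c) x = normc c.
Proof.
rewrite /jet_norm big_ord_recl big1 ?addr0 => [|m _]; last by rewrite order_norm_cst// mul0r.
by rewrite order_norm_cst// expr0 fact0 divr1 mulr1.
Qed.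

(** The weights rho^m / m! cancel the binomial coefficients of [order_normM], leaving a truncated
    Cauchy product. *)
Lemma jet_normM N f g : smooth U f -> smooth U g ->
  jet_norm rho N (fun y => f y * g y) x <= jet_norm rho N f x * jet_norm rho N g x.
Proof.
move=> sf sg.
have H := @cauchy_product_le _ (fun m => order_norm m f x * (rho ^+ m / m`!%:R))
  (fun m => order_norm m g x * (rho ^+ m / m`!%:R)) N.
apply: le_trans (H _ _) => [|m|m]; try by rewrite mulr_ge0// order_norm_ge0.
apply: ler_sum => m _.
apply: le_trans (ler_wpM2r (w_ge0 m) (order_normM _ sf sg Ux)) _.
rewrite mulr_suml; apply: ler_sum => i _.
have im : (i <= m)%N by rewrite -ltnS.
rewrite le_eqVlt; apply/orP; left; apply/eqP.
have -> : rho ^+ m = rho ^+ i * rho ^+ (m - i) by rewrite -exprD subnKC.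
have fi : i`!%:R != 0 :> R by rewrite pnatr_eq0 -lt0n fact_gt0.
have fmi : (m - i)`!%:R != 0 :> R by rewrite pnatr_eq0 -lt0n fact_gt0.
have b0 : 'C(m, i)%:R != 0 :> R by rewrite pnatr_eq0 -lt0n bin_gt0.
rewrite -(bin_fact im) !natrM.
by field; rewrite ?fi ?fmi ?b0.
Qed.

Lemma jet_norm_sum N I (r : seq I) (P : pred I) (F : I -> E -> C) (c : I -> R) :
  (forall i, P i -> smooth U (F i)) ->
  (forall i, P i -> jet_norm rho N (F i) x <= c i) ->
  jet_norm rho N (fun y => \sum_(i <- r | P i) F i y) x <= \sum_(i <- r | P i) c i.
Proof.
move=> sF Fc; elim: r => [|i r IH].
  rewrite big_nil (@eq_jet_norm _ _ (fun=> 0)); last by move=> y _; rewrite big_nil.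
  by rewrite jet_norm_cst Normc.normc0.
rewrite big_cons; have [Pi|nPi] := boolP (P i); last first.
  rewrite (@eq_jet_norm _ _ (fun y => \sum_(i <- r | P i) F i y)) => [|y _]; first exact: IH.
  by rewrite big_cons (negPf nPi).
rewrite (@eq_jet_norm _ _ (fun y => F i y + \sum_(i <- r | P i) F i y)) => [|y _]; last first.
  by rewrite big_cons Pi.
apply: le_trans (jet_normD _ (sF i Pi) (smooth_sum oU _ sF)) _.
by apply: lerD IH; exact: Fc.
Qed.

Lemma jet_norm_Dj N f j :
  jet_norm rho N (D j f) x <= N.+1%:R / rho * jet_norm rho N.+1 f x.
Proof.
rewrite /jet_norm [in leRHS]big_ord_recl mulrDr.
apply: le_trans (_ : N.+1%:R / rho * \sum_(i < N.+1) order_norm (lift ord0 i) f x *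
   (rho ^+ lift ord0 i / (lift ord0 i)`!%:R) <= _); last first.
  by rewrite lerDr mulr_ge0// ?divr_ge0 ?mulr_ge0 ?order_norm_ge0// ltW.
rewrite mulr_sumr; apply: ler_sum => i _; rewrite lift0.
apply: le_trans (ler_wpM2r (w_ge0 _) (order_norm_Dj _ _ _ _)) _.
rewrite [leRHS]mulrCA; apply: ler_wpM2l; first exact: order_norm_ge0.
rewrite factS natrM exprS.
have fi : i`!%:R != 0 :> R by rewrite pnatr_eq0 -lt0n fact_gt0.
have -> : N.+1%:R / rho * (rho * rho ^+ i / (i.+1%:R * i`!%:R)) =
  N.+1%:R / i.+1%:R * (rho ^+ i / i`!%:R).
  have : i.+1%:R != 0 :> R by rewrite pnatr_eq0.
  move: (i.+1%:R : R) => c c0; have r0 := lt0r_neq0 rho0.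
  by field; rewrite fi c0 r0.
rewrite ler_peMl// ler_pdivlMr ?ltr0n// mul1r ler_nat; exact: ltn_ord.
Qed.

End rho.
End onU.
End norms.

(** * Conjugated operators *)

Lemma sum_le_card (R : numDomainType) (I : finType) (P : pred I) (c : R) : 0 <= c ->
  \sum_(a | P a) c <= #|{: I}|%:R * c.
Proof.
by move=> c0; rewrite big_const -Monoid.iteropE -[leLHS]/(c *+ _) -[leLHS]mulr_natl ler_wpM2r// ler_nat max_card.
Qed.

Section operators.
Context {R : realType} {n : nat}.
Local Notation E := 'rV[R]_n.
Local Notation C := R[i].
Local Notation normc := (@Normc.normc R).
Local Notation D := (@Dj R n).
Implicit Types (u v f g : E -> C) (j : 'I_n) (x : E) (s : seq 'I_n).
Local Opaque smooth Dj C1_at.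

(** Flattens a multi-index into a list of letters, so that [Dalpha a] is a single [foldr] and
    inductions proceed one derivative at a time. *)
Definition word (a : multi n) : seq 'I_n :=
  flatten [seq nseq (a j) j | j <- enum 'I_n].

Lemma size_word a : size (word a) = mdeg a.
Proof.
rewrite size_flatten /shape -map_comp sumnE big_map /mdeg.
by rewrite -[RHS]big_enum/=; apply: eq_bigr => j _; rewrite /= size_nseq.
Qed.

Lemma foldr_word (A : Type) (h : 'I_n -> A -> A) (v : A) a :
  foldr h v (word a) = foldr (fun j => iter (a j) (h j)) v (enum 'I_n).
Proof.
rewrite /word; elim: (enum 'I_n) => //= j s IH.
by rewrite foldr_cat IH; elim: (a j) => //= k ->.
Qed.

Lemma DalphaE a u : Dalpha a u = foldr D u (word a).
Proof. by rewrite foldr_word. Qed.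

Lemma prod_word (S : comPzRingType) (z : 'I_n -> S) a :
  \prod_(j <- word a) z j = \prod_(j < n) z j ^+ a j.
Proof.
rewrite -[RHS]big_enum/= /word; elim: (enum 'I_n) => [|j s IH]; first by rewrite !big_nil.
rewrite /= big_cat IH big_cons; congr (_ * _).
by rewrite big_nseq; elim: (a j) => //= k ->; rewrite exprS.
Qed.

Definition shift_Dj (b : 'I_n -> E -> C) j g : E -> C := fun x => D j g x + b j x * g x.

(* For b = dgaussian this is the conjugate w^-1 P w of P by the gaussian w. *)
Definition shift_op (b : 'I_n -> E -> C) d (p : multi n -> E -> C) g : E -> C := fun x =>
  multi_sum d (fun a => p a x * foldr (shift_Dj b) g (word a) x).

Section bounds.
Variable U : set E.
Hypothesis oU : open U.
Variables (b : 'I_n -> E -> C) (d : nat) (p : multi n -> E -> C).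
Hypothesis sb : forall j, smooth U (b j).
Hypothesis sp : forall a, (mdeg a <= d)%N -> smooth U (p a).

Lemma smooth_shift_Dj j g : smooth U g -> smooth U (shift_Dj b j g).
Proof.
move=> sg; apply: (smoothD oU (smooth_Dj j sg)).
exact: (smoothM oU (sb j) sg).
Qed.

Lemma smooth_shift_Djs s g : smooth U g -> smooth U (foldr (shift_Dj b) g s).
Proof.
move=> sg; elim: s => [|j s IH]; first exact: sg.
exact: (smooth_shift_Dj j IH).
Qed.

Lemma smooth_term a g : (mdeg a <= d)%N -> smooth U g ->
  smooth U (fun x => p a x * foldr (shift_Dj b) g (word a) x).
Proof. by move=> ad sg; exact: (smoothM oU (sp ad) (smooth_shift_Djs _ sg)). Qed.

Lemma smooth_shift_op g : smooth U g -> smooth U (shift_op b d p g).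
Proof.
move=> sg; apply: (@smooth_sum _ _ _ oU _ _ _ (fun a x => p (mval a) x * foldr (shift_Dj b) g (word (mval a)) x)).
by move=> a ad; exact: smooth_term.
Qed.

Lemma smooth_iter_shift_op k g : smooth U g -> smooth U (iter k (shift_op b d p) g).
Proof. by move=> sg; elim: k => [|k IH]; [exact: sg|exact: (smooth_shift_op IH)]. Qed.

Variables (rho : R) (x : E) (Q : nat) (L A : R).
Hypotheses (rho0 : 0 < rho) (Ux : U x).

(** [Q] is a budget of derivatives. Each application of [T] spends d of them, and the one-step
    constant [B] is uniform as long as the budget is not exceeded. *)
Lemma jet_norm_iter (T : (E -> C) -> (E -> C)) (B : R) k N g :
  (forall f, smooth U f -> smooth U (T f)) -> 0 <= B ->
  (forall f M, smooth U f -> (M + d <= Q)%N ->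
    jet_norm rho M (T f) x <= B * jet_norm rho (M + d) f x) ->
  smooth U g -> (N + k * d <= Q)%N ->
  jet_norm rho N (iter k T g) x <= B ^+ k * jet_norm rho (N + k * d) g x.
Proof.
move=> sT B0 HT sg; elim: k N => [|k IH] N kQ.
  by rewrite mul0n addn0 expr0 mul1r.
have siter : smooth U (iter k T g) by elim: (k) => [|l IHl]; [|exact: sT].
rewrite iterS; apply: le_trans (HT _ _ siter _) _; first by lia.
rewrite exprS -mulrA ler_wpM2l//; apply: le_trans (IH _ _) _; first by lia.
by rewrite -addnA -mulSn.
Qed.

Hypothesis hL : forall j, Q%:R / rho + jet_norm rho Q (b j) x <= L.
Hypothesis L1 : 1 <= L.

Let L0 : 0 <= L. Proof. exact: le_trans ler01 L1. Qed.

(** [L] is the price of one shifted derivative: [Q / rho] for differentiating within the budget,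
    plus the jet norm of the factor [b j]. *)
Lemma jet_norm_shift_Dj N j g : smooth U g -> (N < Q)%N ->
  jet_norm rho N (shift_Dj b j g) x <= L * jet_norm rho N.+1 g x.
Proof.
move=> sg NQ; apply: le_trans (jet_normD oU rho0 Ux _ _ _) _.
- exact: smooth_Dj.
- exact: (smoothM oU (sb j) sg).
apply: le_trans (lerD (jet_norm_Dj x rho0 _ _ _) (jet_normM oU rho0 Ux _ (sb j) sg)) _.
apply: le_trans (_ : Q%:R / rho * jet_norm rho N.+1 g x + jet_norm rho Q (b j) x * jet_norm rho N.+1 g x <= _).
  apply: lerD.
    by rewrite ler_wpM2r ?jet_norm_ge0// ler_wpM2r ?invr_ge0 ?(ltW rho0)// ler_nat.
  by apply: ler_pM; rewrite ?jet_norm_ge0// jet_norm_mono//; lia.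
by rewrite -mulrDl ler_wpM2r// jet_norm_ge0.
Qed.

Lemma jet_norm_shift_Djs N s g : smooth U g -> (N + size s <= Q)%N ->
  jet_norm rho N (foldr (shift_Dj b) g s) x <= L ^+ size s * jet_norm rho (N + size s) g x.
Proof.
move=> sg; elim: s N => [|j s IH] N /= NQ; first by rewrite addn0 expr0 mul1r.
apply: le_trans (jet_norm_shift_Dj _ (smooth_shift_Djs s sg) _) _; first by lia.
rewrite exprS -mulrA ler_wpM2l//; apply: le_trans (IH _ _) _; first by lia.
by rewrite addSnnS.
Qed.

Lemma jet_norm_shift_DjsW N s g : smooth U g -> (size s <= d)%N -> (N + d <= Q)%N ->
  jet_norm rho N (foldr (shift_Dj b) g s) x <= L ^+ size s * jet_norm rho (N + d) g x.
Proof.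
move=> sg sd NQ; apply: le_trans (jet_norm_shift_Djs sg _) _; first by lia.
by rewrite ler_wpM2l ?exprn_ge0// jet_norm_mono//; lia.
Qed.

Hypothesis hA : forall a, (mdeg a <= d)%N -> jet_norm rho Q (p a) x <= A.
Local Notation c0 := (#|{: {ffun 'I_n -> 'I_d.+1}}|%:R : R).

Let A0 : 0 <= A.
Proof.
have a0 : (mdeg ([ffun=> 0%N] : multi n) <= d)%N.
  by rewrite /mdeg big1// => i _; rewrite ffunE.
exact: le_trans (jet_norm_ge0 x rho0 Q _) (hA a0).
Qed.

(** The crude bound, without any cancellation: since [L] is at least 1, every word is charged as if
    it had length d. *)
Lemma jet_norm_shift_op g N : smooth U g -> (N + d <= Q)%N ->
  jet_norm rho N (shift_op b d p g) x <= c0 * A * L ^+ d * jet_norm rho (N + d) g x.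
Proof.
move=> sg NQ.
apply: le_trans (@jet_norm_sum _ _ _ oU _ _ rho0 Ux _ _ _ _
  (fun (a : {ffun 'I_n -> 'I_d.+1}) x => p (mval a) x * foldr (shift_Dj b) g (word (mval a)) x)
  (fun=> A * L ^+ d * jet_norm rho (N + d) g x) _ _) _.
- by move=> a ad; exact: smooth_term.
- move=> a ad; apply: le_trans (jet_normM oU rho0 Ux _ (sp ad) (smooth_shift_Djs _ sg)) _.
  rewrite -mulrA; apply: ler_pM; rewrite ?jet_norm_ge0//.
    by apply: le_trans (hA ad); rewrite jet_norm_mono//; lia.
  apply: le_trans (jet_norm_shift_DjsW sg _ NQ) _; rewrite size_word//.
  by rewrite ler_wpM2r ?jet_norm_ge0// ler_weXn2l.
apply: le_trans (sum_le_card _ _) _; last by rewrite !mulrA.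
by rewrite !mulr_ge0 ?exprn_ge0 ?jet_norm_ge0.
Qed.

Section fine.
Variables (z : 'I_n -> C) (q : multi n -> C) (eps beta : R).
Hypotheses (eps0 : 0 <= eps) (beta0 : 0 <= beta).
Hypothesis heps : forall j, Q%:R / rho + jet_norm rho Q (fun y => b j y - z j) x <= eps.
Hypothesis hz : forall j, normc (z j) <= L.
Hypothesis hq : forall a, mdeg a = d -> jet_norm rho Q (fun y => p a y - q a) x <= beta.
Hypothesis hqA : forall a, mdeg a = d -> normc (q a) <= A.
Hypothesis hsymb :
  \sum_(a : {ffun 'I_n -> 'I_d.+1} | mdeg (mval a) == d)
    q (mval a) * \prod_(j < n) z j ^+ mval a j = 0.

Let smoothB f g : smooth U f -> smooth U g -> smooth U (fun y => f y - g y).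
Proof.
move=> sf sg; apply: (eq_smooth oU) (smoothD oU sf (smoothZ oU (-1) sg)) => y _.
by rewrite mulN1r.
Qed.

(** The letters are replaced one at a time by multiplication by [z j]. Each replacement costs [eps]
    where the untouched letters cost [L]. The factor [L] on the left avoids the exponent
    [size s - 1]. *)
Lemma jet_norm_shift_Djs_sub N s g : smooth U g -> (N + size s <= Q)%N ->
  L * jet_norm rho N (fun y => foldr (shift_Dj b) g s y - (\prod_(j <- s) z j) * g y) x <=
  (size s)%:R * eps * L ^+ size s * jet_norm rho (N + size s) g x.
Proof.
move=> sg; elim: s N => [|j s IH] N /= NQ.
  rewrite (eq_jet_norm oU _ Ux _ (g := fun=> 0)); last first.
    by move=> y _; rewrite big_nil mul1r subrr.
  by rewrite (jet_norm_cst oU)// Normc.normc0 mulr0 !mul0r.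
set As := foldr (shift_Dj b) g s; have sAs : smooth U As := smooth_shift_Djs s sg.
rewrite (eq_jet_norm oU _ Ux _ (g := fun y => (D j As y + (b j y - z j) * As y) +
   z j * (As y - (\prod_(j <- s) z j) * g y))); last first.
  by move=> y _; rewrite big_cons /shift_Dj; ring.
have sbz : smooth U (fun y => b j y - z j).
  by apply: smoothB (sb j) _; exact: smooth_cst.
have sr : smooth U (fun y => As y - (\prod_(j <- s) z j) * g y).
  by apply: smoothB sAs _; exact: smoothZ.
have s1 := smooth_Dj j sAs; have s2 := smoothM oU sbz sAs.
apply: le_trans (ler_wpM2l L0 (jet_normD oU rho0 Ux N (smoothD oU s1 s2) (smoothZ oU (z j) sr))) _.
rewrite -natr1 !mulrDl !mul1r mulrDr addrC; apply: lerD.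
  rewrite (jet_normZ oU _ Ux)// mulrCA.
  have NQ' : (N + size s <= Q)%N by lia.
  apply: le_trans (ler_pM (normc_ge0 _) (mulr_ge0 L0 (jet_norm_ge0 x rho0 _ _)) (hz j) (IH N NQ')) _.
  rewrite exprS [leLHS]mulrCA -!mulrA; rewrite !(mulrCA L) !mulrA.
  apply: ler_wpM2l; last by rewrite jet_norm_mono//; lia.
  by rewrite !mulr_ge0 ?exprn_ge0.
apply: le_trans (_ : L * (eps * (L ^+ size s * jet_norm rho (N + (size s).+1) g x)) <= _); last first.
  by rewrite exprS !mulrA (mulrC L eps).
rewrite ler_wpM2l//.
apply: le_trans (jet_normD oU rho0 Ux N s1 s2) _.
apply: le_trans (lerD (jet_norm_Dj x rho0 _ _ _) (jet_normM oU rho0 Ux _ sbz sAs)) _.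
have hAs : jet_norm rho N.+1 As x <= L ^+ size s * jet_norm rho (N + (size s).+1) g x.
  by apply: le_trans (jet_norm_shift_Djs sg _) _; rewrite addSnnS.
apply: le_trans (_ : (Q%:R / rho + jet_norm rho Q (fun y => b j y - z j) x) * jet_norm rho N.+1 As x <= _).
  rewrite mulrDl; apply: lerD.
    rewrite ler_wpM2r ?jet_norm_ge0// ler_wpM2r ?invr_ge0 ?(ltW rho0)// ler_nat; lia.
  by apply: ler_pM; rewrite ?jet_norm_ge0// jet_norm_mono//; lia.
apply: ler_pM; rewrite ?jet_norm_ge0//.
by rewrite addr_ge0 ?jet_norm_ge0// divr_ge0//; exact: ltW.
Qed.

(* The principal part with coefficients frozen at x0 and shift frozen at z
   vanishes by hsymb, so only its variation eps, beta and lower order terms remain. *)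
Lemma jet_norm_shift_op_fine g N : (0 < d)%N -> smooth U g -> (N + d <= Q)%N ->
  L * jet_norm rho N (shift_op b d p g) x <=
  c0 * (A + L * beta + A * d%:R * eps) * L ^+ d * jet_norm rho (N + d) g x.
Proof.
move=> d0 sg NQ.
pose I := {ffun 'I_n -> 'I_d.+1}.
pose As a := foldr (shift_Dj b) g (word a).
(* For |a| = d the term is split into (p_a - q_a) times the shifted derivative and q_a times its
   deviation from z^a g. What is left out, the sum of the q_a z^a g, is zero by [hsymb]. *)
pose F (a : I) : E -> C := if mdeg (mval a) == d then fun y =>
   (p (mval a) y - q (mval a)) * As (mval a) y +
    q (mval a) * (As (mval a) y - (\prod_(j <- word (mval a)) z j) * g y)
  else fun y => p (mval a) y * As (mval a) y.
have FE y : U y -> shift_op b d p g y = \sum_(a : I | (mdeg (mval a) <= d)%N) F a y.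
  move=> Uy.
  have Z : \sum_(a : I | mdeg (mval a) == d) q (mval a) * \prod_(j < n) z j ^+ mval a j * g y = 0.
    by rewrite -mulr_suml hsymb mul0r.
  have Z' : \sum_(a : I | (mdeg (mval a) <= d)%N)
     (if mdeg (mval a) == d then q (mval a) * \prod_(j < n) z j ^+ mval a j * g y else 0) = 0.
    rewrite -[RHS]Z [RHS]big_mkcond [LHS]big_mkcond /=; apply: eq_bigr => a _.
    by have [->|] := eqVneq (mdeg (mval a)) d; rewrite ?leqnn ?if_same.
  transitivity (shift_op b d p g y - \sum_(a : I | (mdeg (mval a) <= d)%N)
     (if mdeg (mval a) == d then q (mval a) * \prod_(j < n) z j ^+ mval a j * g y else 0)).
    by rewrite Z' subr0.
  rewrite /shift_op /multi_sum -sumrB; apply: eq_bigr => a _; rewrite /F; case: ifP => _.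
    by rewrite prod_word /As; ring.
  by rewrite subr0.
have sAs a : smooth U (As a) := smooth_shift_Djs (word a) sg.
have sq a : (mdeg a <= d)%N -> smooth U (fun y => p a y - q a).
  by move=> ad; apply: smoothB (sp ad) _; exact: smooth_cst.
have sr a : smooth U (fun y => As a y - (\prod_(j <- word a) z j) * g y).
  by apply: smoothB (sAs a) _; exact: smoothZ.
have sF a : (mdeg (mval a) <= d)%N -> smooth U (F a).
  move=> ad; rewrite /F; case: ifP => _.
    exact: (smoothD oU (smoothM oU (sq _ ad) (sAs _)) (smoothZ oU _ (sr _))).
  exact: (smoothM oU (sp ad) (sAs _)).
have N0 M f : 0 <= jet_norm rho M f x := jet_norm_ge0 x rho0 M f.
have hN : 0 <= jet_norm rho (N + d) g x := N0 _ _.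
have Ld : 0 <= L ^+ d := exprn_ge0 d L0.
rewrite (eq_jet_norm oU _ Ux _ FE).
have Fb (a : I) : (mdeg (mval a) <= d)%N ->
    L * jet_norm rho N (F a) x <= (A + L * beta + A * d%:R * eps) * L ^+ d * jet_norm rho (N + d) g x.
  move=> ad; rewrite /F; case: ifPn => [/eqP aE|aN].
    have h1 := jet_normM oU rho0 Ux N (sq _ ad) (sAs (mval a)).
    have h2 := jet_normD oU rho0 Ux N (smoothM oU (sq _ ad) (sAs (mval a))) (smoothZ oU (q (mval a)) (sr (mval a))).
    apply: le_trans (ler_wpM2l L0 h2) _; rewrite mulrDr !mulrDl -!addrA.
    apply: ler_wpDl; first by rewrite !mulr_ge0.
    apply: lerD.
      rewrite -!mulrA ler_wpM2l//; apply: le_trans h1 _.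
      apply: ler_pM; [exact: N0|exact: N0| |].
        by apply: (le_trans _ (hq aE)); apply: (jet_norm_mono x rho0); exact: leq_trans (leq_addr _ _) NQ.
      by apply: le_trans (jet_norm_shift_DjsW sg _ NQ) _; rewrite size_word aE.
    rewrite (jet_normZ oU _ Ux N (q (mval a)) (sr (mval a))) mulrCA -!mulrA; apply: ler_pM.
    - exact: normc_ge0.
    - by apply: mulr_ge0; [exact: L0|exact: N0].
    - exact: hqA.
    have := jet_norm_shift_Djs_sub (s := word (mval a)) sg; rewrite size_word aE => /(_ N NQ).
    by rewrite -!mulrA.
  (* Lower order terms involve at most d - 1 letters, hence [L ^+ d.-1], and this absorbs the factor
     [L] on the left. *)
  have ad' : (mdeg (mval a) < d)%N by rewrite ltn_neqAle aN.
  have h1 := jet_normM oU rho0 Ux N (sp ad) (sAs (mval a)).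
  apply: le_trans (ler_wpM2l L0 h1) _.
  apply: le_trans (_ : A * L ^+ d * jet_norm rho (N + d) g x <= _); last first.
    rewrite ler_wpM2r// ler_wpM2r// -addrA lerDl addr_ge0//.
      exact: mulr_ge0.
    by rewrite !mulr_ge0.
  have -> : A * L ^+ d * jet_norm rho (N + d) g x =
     L * (A * (L ^+ d.-1 * jet_norm rho (N + d) g x)).
    by rewrite -{1}(prednK d0) exprS; ring.
  apply: (ler_wpM2l L0); apply: ler_pM; [exact: N0|exact: N0| |].
    by apply: (le_trans _ (hA ad)); apply: (jet_norm_mono x rho0); exact: leq_trans (leq_addr _ _) NQ.
  apply: le_trans (jet_norm_shift_DjsW sg _ NQ) _; rewrite size_word; first exact: ad.
  by apply: ler_wpM2r; [exact: hN|apply: ler_weXn2l; [exact: L1|rewrite -ltnS prednK]].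
have sm := @jet_norm_sum _ _ _ oU _ _ rho0 Ux N _ (index_enum I)
   (fun a => (mdeg (mval a) <= d)%N) F (fun a => jet_norm rho N (F a) x) sF (fun _ _ => lexx _).
apply: le_trans (ler_wpM2l L0 sm) _; rewrite mulr_sumr.
apply: le_trans (ler_sum _ Fb) _.
apply: le_trans (sum_le_card _ _) _; last by rewrite !mulrA.
by rewrite mulr_ge0// ?mulr_ge0// !addr_ge0// !mulr_ge0.
Qed.

End fine.
End bounds.
End operators.

(** * Termwise differentiation *)

Section real_series.
Context {R : realType}.

Lemma MVT_origin (f df : R -> R) (h : R) :
  (forall t : R, `|t| <= `|h| -> is_derive t 1 f (df t)) ->
  exists2 c, `|c| <= `|h| & f h - f 0 = df c * h.
Proof.
move=> H.
have cf (a b : R) : `|a| <= `|h| -> `|b| <= `|h| -> {within `[a, b], continuous f}.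
  move=> ah bh; apply: derivable_within_continuous => t.
  rewrite in_itv/= => /andP[at_ tb]; apply: (@ex_derive _ _ _ _ _ _ (df t)).
  by apply: H; rewrite ler_norml; move: ah bh; rewrite !ler_norml; lra.
have [h0|h0] := leP 0 h.
  have [c|c|] := @MVT_segment _ f df 0 h h0.
  - rewrite in_itv/= => /andP[c0 ch]; apply: H.
    by rewrite !ger0_norm// ltW.
  - by apply: cf; rewrite ?normr0.
  move=> c; rewrite in_itv/= subr0 => /andP[c0 ch] ->.
  by exists c => //; rewrite !ger0_norm.
have [c|c|] := @MVT_segment _ f df h 0 (ltW h0).
- rewrite in_itv/= => /andP[c0 ch]; apply: H.
  by rewrite !ler0_norm ?lerN2 ?ltW.
- by apply: cf; rewrite ?normr0.
move=> c; rewrite in_itv/= => /andP[c0 ch] e; exists c.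
  by rewrite !ler0_norm ?lerN2// ltW.
by rewrite -opprB e sub0r mulrN opprK.
Qed.

(** Two applications of the mean value theorem; the factor 1/2 of Taylor's formula is given up. *)
Lemma taylor2_le (f df ddf : R -> R) (h B : R) :
  (forall t : R, `|t| <= `|h| -> is_derive t 1 f (df t)) ->
  (forall t : R, `|t| <= `|h| -> is_derive t 1 df (ddf t)) ->
  (forall t : R, `|t| <= `|h| -> `|ddf t| <= B) ->
  `|f h - f 0 - h * df 0| <= h ^+ 2 * B.
Proof.
move=> H1 H2 HB; have [c ch ->] := MVT_origin H1.
have [|e ec e1] := @MVT_origin df ddf c.
  by move=> t tc; apply: H2; exact: le_trans tc ch.
rewrite mulrC -mulrBr e1 !normrM -real_normK ?num_real// expr2 -mulrA ler_wpM2l//.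
by rewrite mulrC; apply: ler_pM => //; apply: HB; exact: le_trans ec ch.
Qed.

Lemma cvg_norm_le (u : nat -> R) (l B : R) :
  u @ \oo --> l -> (forall k, `|u k| <= B) -> `|l| <= B.
Proof.
move=> ul uB; apply: (cvgr_to_le (cvg_norm ul)); exact: nearW.
Qed.

Lemma series_le_lim (b : nat -> R) : (forall i, 0 <= b i) -> cvgn (series b) ->
  forall J, \sum_(0 <= i < J) b i <= limn (series b).
Proof.
move=> b0 cb J; apply: (nondecreasing_cvgn_le (u_ := series b)) => //.
by apply: nondecreasing_series => // i _ _.
Qed.

Lemma series_tail_cvg0 (b : nat -> R) : cvgn (series b) ->
  (fun J => limn (series b) - series b J) @ \oo --> (0 : R).
Proof.
move=> cb; rewrite -[X in _ --> X](subrr (limn (series b))).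
by apply: cvgB; [exact: cvg_cst|exact: cb].
Qed.

Lemma series_tail_le (b u : nat -> R) (l : R) J :
  cvgn (series b) -> (forall i, `|u i| <= b i) -> series u @ \oo --> l ->
  `|l - series u J| <= limn (series b) - series b J.
Proof.
move=> cb ub ul.
have b0 i : 0 <= b i := le_trans (normr_ge0 _) (ub i).
apply: (cvgr_to_le (f := fun K => `|series u K - series u J|) (F := \oo)).
  by apply: cvg_norm; apply: cvgB => //; exact: cvg_cst.
near=> K; have JK : (J <= K)%N by near: K; exact: nbhs_infty_ge.
apply: le_trans (_ : series b K - series b J <= _).
  rewrite !sub_series_geq//; apply: le_trans (ler_norm_sum _ _ _) _.
  by apply: ler_sum.
by rewrite lerD2r; exact: series_le_lim.
Unshelve. all: by end_near. Qed.

Lemma abs_series_cvg (b u : nat -> R) : cvgn (series b) ->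
  (forall i, `|u i| <= b i) -> cvgn (series u).
Proof.
move=> cb ub; apply: normed_cvg; apply: (series_le_cvg _ _ ub cb) => i //.
exact: le_trans (normr_ge0 _) (ub i).
Qed.

End real_series.

Section termwise.
Context {R : realType} {n : nat}.
Local Notation E := 'rV[R]_n.

Lemma is_derive_line (F : E -> R) (x v : E) (t : R) :
  derivable F (x + t *: v) v ->
  is_derive t 1 (fun s : R => F (x + s *: v)) ('D_v F (x + t *: v)).
Proof.
move=> dF; have e : (fun h : R => h^-1 *: (((fun s : R => F (x + s *: v)) \o shift t) (h *: (1 : R)) -
    F (x + t *: v))) =
  (fun h : R => h^-1 *: ((F \o shift (x + t *: v)) (h *: v) - F (x + t *: v))).
  apply/funext => h /=; congr (_ *: (F _ - _)).
  by rewrite [h *: (1:R)]mulr1 scalerDl addrCA.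
by split; rewrite /derivable /derive ?e.
Qed.

Variables (U : set E) (f : nat -> E -> R) (F : E -> R).
Hypothesis oU : open U.
Hypothesis fF : forall x, U x -> series (f ^~ x) @ \oo --> F x.

Lemma series_continuous_at x (b : nat -> R) : U x ->
  (forall i y, U y -> `|f i y| <= b i) -> cvgn (series b) ->
  (forall i, {for x, continuous (f i)}) -> {for x, continuous F}.
Proof.
move=> Ux fb cb cf; apply/(@cvgrPdist_lt _ _ _ (nbhs x)) => e e0.
have [J hJ] : exists J, limn (series b) - series b J < e / 4.
  have := series_tail_cvg0 cb => /cvgrPdist_lt/(_ (e / 4)).
  rewrite divr_gt0// => /(_ isT)[J _ /(_ J (leqnn _))]; rewrite sub0r normrN => hJ.
  by exists J; apply: le_lt_trans hJ; exact: ler_norm.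
have tail y : U y -> `|F y - series (f ^~ y) J| < e / 4.
  move=> Uy; apply: le_lt_trans hJ.
  by apply: series_tail_le => //; [move=> i; exact: fb|exact: fF].
have cs : {for x, continuous (fun y => series (f ^~ y) J)}.
  rewrite /series/=.
  elim: (J) => [|K IH].
    rewrite (_ : (fun y => _) = (fun=> 0)); first exact: cst_continuous.
    by apply/funext => y; rewrite big_geq.
  rewrite (_ : (fun y => _) = (fun y => \sum_(0 <= k < K) f k y) + f K); last first.
    by apply/funext => y; rewrite big_nat_recr.
  exact: (continuousD IH (cf K)).
move/(@cvgrPdist_lt _ _ _ (nbhs x)): cs => /(_ (e / 4)); rewrite divr_gt0// => /(_ isT) cs.
near=> y.
have Uy : U y by near: y; exact: open_nbhs_nbhs.
have h1 := tail x Ux; have h2 := tail y Uy.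
have h3 : `|series (f ^~ x) J - series (f ^~ y) J| < e / 4 by near: y.
have -> : F x - F y = (F x - series (f ^~ x) J) - (F y - series (f ^~ y) J) +
   (series (f ^~ x) J - series (f ^~ y) J) by ring.
apply: le_lt_trans (ler_normD _ _) _.
have := ler_normB (F x - series (f ^~ x) J) (F y - series (f ^~ y) J); lra.
Unshelve. all: by end_near. Qed.

(** The summable bound [b2] on second derivatives makes the Taylor remainders, summed over the
    series, at most h^2 times a constant. The difference quotient of [F] therefore differs from the
    sum of the derivatives by O(h). *)
Lemma series_derive x (v : E) (b1 b2 : nat -> R) : U x ->
  (forall i y, U y -> derivable (f i) y v) ->
  (forall i y, U y -> derivable ('D_v (f i)) y v) ->
  (forall i y, U y -> `|'D_v (f i) y| <= b1 i) ->
  (forall i y, U y -> `|'D_v ('D_v (f i)) y| <= b2 i) ->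
  cvgn (series b1) -> cvgn (series b2) ->
  derivable F x v /\ series (fun i => 'D_v (f i) x) @ \oo --> 'D_v F x.
Proof.
move=> Ux df ddf fb1 fb2 cb1 cb2.
have cS := abs_series_cvg cb1 (fun i => fb1 i x Ux).
set S := limn (series (fun i => 'D_v (f i) x)).
have b20 i : 0 <= b2 i := le_trans (normr_ge0 _) (fb2 i x Ux).
have B0 : 0 <= limn (series b2).
  by apply: le_trans (series_le_lim b20 cb2 0); rewrite big_geq.
have line : \forall h \near (0 : R), forall t : R, `|t| <= `|h| -> U (x + t *: v).
  have ct : (fun t : R => x + t *: v) @ 0 --> x.
    rewrite -[X in _ --> X]addr0 -[X in _ --> x + X](scale0r v).
    by apply: cvgD; [exact: cvg_cst|apply: cvgZr_tmp; exact: cvg_id].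
  have : \forall t \near (0 : R), U (x + t *: v).
    by apply: ct; exact: open_nbhs_nbhs.
  move=> /nbhs_normP[e /= e0 He]; apply/nbhs_normP; exists e => //= h.
  rewrite /ball_/= sub0r normrN => he t th; apply: He.
  by rewrite /ball_/= sub0r normrN; exact: le_lt_trans th he.
have est : \forall h \near (0 : R),
    `|F (x + h *: v) - F x - h * S| <= h ^+ 2 * limn (series b2).
  near=> h.
  have Uh : forall t : R, `|t| <= `|h| -> U (x + t *: v) by near: h.
  have Uhh : U (x + h *: v) by exact: Uh.
  apply: (@cvg_norm_le _ (series (fun i => f i (x + h *: v) - f i x - h * 'D_v (f i) x))).
    rewrite (_ : series _ = series (f ^~ (x + h *: v)) - series (f ^~ x) -
       (fun J => h * series (fun i => 'D_v (f i) x) J)); last first.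
      by apply/funext => J; rewrite /series/= !fctE !sumrB mulr_sumr.
    by apply: cvgB; [apply: cvgB; exact: fF|apply: cvgMr; exact: cS].
  move=> J; apply: le_trans (ler_norm_sum _ _ _) _.
  apply: le_trans (_ : h ^+ 2 * series b2 J <= _); last first.
    by rewrite ler_wpM2l ?sqr_ge0//; exact: series_le_lim.
  rewrite mulr_sumr; apply: ler_sum => i _.
  have := @taylor2_le _ (fun s : R => f i (x + s *: v)) (fun s : R => 'D_v (f i) (x + s *: v))
     (fun s : R => 'D_v ('D_v (f i)) (x + s *: v)) h (b2 i).
  rewrite scale0r addr0; apply => t /Uh Ut.
  - by apply: is_derive_line; exact: df.
  - by apply: is_derive_line; exact: ddf.
  - exact: fb2.
have cvq : (fun h : R => h^-1 *: ((F \o shift x) (h *: v) - F x)) @ 0^' --> S.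
  apply/cvgrPdist_le => e e0; rewrite /= near_withinE; near=> h => h0.
  have n0 : 0 < `|h| by rewrite normr_gt0.
  rewrite -(ler_pM2l n0) -normrM /= (addrC _ x).
  have -> : h * (S - h^-1 *: (F (x + h *: v) - F x)) = - (F (x + h *: v) - F x - h * S).
    by rewrite /GRing.scale/= mulrBr mulVKf//; ring.
  rewrite normrN; apply: le_trans (_ : h ^+ 2 * limn (series b2) <= _).
    by near: h.
  rewrite -real_normK ?num_real// expr2 -mulrA ler_wpM2l//.
  apply: le_trans (_ : `|h| * (limn (series b2) + 1) <= _); first by rewrite ler_wpM2l// lerDl.
  rewrite -ler_pdivlMr ?ltr_wpDl//; near: h.
  apply/nbhs_normP; exists (e / (limn (series b2) + 1)) => /=.
    by rewrite divr_gt0// ltr_wpDl.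
  by move=> h; rewrite /ball_/= sub0r normrN => /ltW.
split; first by apply/cvg_ex; exists S.
have -> : 'D_v F x = S by exact: cvg_lim cvq.
exact: cS.
Unshelve. all: by end_near. Qed.

End termwise.

Lemma cvg_sum0 (R : realType) (I : Type) (r : seq I) (u : I -> nat -> R) :
  (forall i, u i @ \oo --> (0 : R)) ->
  (fun J => \sum_(i <- r) u i J) @ \oo --> (0 : R).
Proof.
move=> u0; elim: r => [|i r IH].
  rewrite (_ : (fun J => _) = fun=> 0); first exact: cvg_cst.
  by apply/funext => J; rewrite big_nil.
rewrite (_ : (fun J => _) = u i + (fun J => \sum_(i <- r) u i J)); last first.
  by apply/funext => J; rewrite big_cons.
by rewrite -[X in _ --> X]addr0; exact: (cvgD (u0 i) IH).
Qed.

Section csum.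
Context {R : realType}.
Local Notation C := R[i].
Local Notation reC := (@complex.Re R).
Local Notation imC := (@complex.Im R).
Local Notation normc := (@Normc.normc R).

(** Convergence is expressed through the modulus, so that only the topology of [R] is involved. *)
Definition csum (g : nat -> C) (l : C) :=
  (fun J => normc (l - \sum_(0 <= i < J) g i)) @ \oo --> (0 : R).

Lemma csumP (g : nat -> C) (l : C) : csum g l <->
  series (fun i => reC (g i)) @ \oo --> reC l /\
  series (fun i => imC (g i)) @ \oo --> imC l.
Proof.
have eR J : reC (l - \sum_(0 <= i < J) g i) = reC l - series (fun i => reC (g i)) J.
  by rewrite ReD ReN Re_sum.
have eI J : imC (l - \sum_(0 <= i < J) g i) = imC l - series (fun i => imC (g i)) J.
  by rewrite ImD ImN Im_sum.
split=> [cg|[cr ci]].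
  split; apply/cvgrPdist_le => e e0; move/cvgrPdist_le: cg => /(_ e e0) cg; near=> J.
  - rewrite -eR; apply: le_trans (normRe _) _.
    have : `|0 - normc (l - \sum_(0 <= i < J) g i)| <= e by near: J.
    by rewrite sub0r normrN ger0_norm ?normc_ge0.
  - rewrite -eI; apply: le_trans (normIm _) _.
    have : `|0 - normc (l - \sum_(0 <= i < J) g i)| <= e by near: J.
    by rewrite sub0r normrN ger0_norm ?normc_ge0.
apply/cvgrPdist_le => e e0; near=> J.
rewrite sub0r normrN ger0_norm ?normc_ge0//; apply: le_trans (normc_le_ReIm _) _.
rewrite eR eI (splitr e); apply: lerD; near: J.
- by move/cvgrPdist_le: cr; apply; rewrite divr_gt0.
- by move/cvgrPdist_le: ci; apply; rewrite divr_gt0.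
Unshelve. all: by end_near. Qed.

Lemma csum_exists (g : nat -> C) (b : nat -> R) : (forall i, normc (g i) <= b i) ->
  cvgn (series b) -> exists l, csum g l.
Proof.
move=> gb cb.
have cr := abs_series_cvg cb (fun i => le_trans (normRe (g i)) (gb i)).
have ci := abs_series_cvg cb (fun i => le_trans (normIm (g i)) (gb i)).
by exists (limn (series (fun i => reC (g i))) +i* limn (series (fun i => imC (g i)))); apply/csumP.
Qed.

End csum.

Section termwise_complex.
Context {R : realType} {n : nat}.
Local Notation E := 'rV[R]_n.
Local Notation C := R[i].
Local Notation reC := (@complex.Re R).
Local Notation imC := (@complex.Im R).
Local Notation normc := (@Normc.normc R).
Local Notation D := (@Dj R n).
Implicit Types (u v f : E -> C) (j : 'I_n) (x : E) (g : nat -> E -> C).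
Variable U : set E.
Hypothesis oU : open U.

Lemma continuous_C1 u x : C1_at u x ->
  {for x, continuous (reC \o u)} /\ {for x, continuous (imC \o u)}.
Proof. by case. Qed.
Lemma derivable_C1 u x j : C1_at u x ->
  derivable (reC \o u) x (delta_mx 0 j) /\ derivable (imC \o u) x (delta_mx 0 j).
Proof. by case. Qed.

Local Opaque smooth Dj C1_at derive derivable.

(** As D_j is -i times a partial derivative, it exchanges real and imaginary parts up to sign. The
    majorants [B 1] and [B 2] serve as the bounds on first and second derivatives in
    [series_derive], and [B 0] gives continuity. *)
Lemma termwise_C1 g F (B : nat -> nat -> R) :
  (forall i, smooth U (g i)) ->
  (forall m i x, U x -> order_norm m (g i) x <= B m i) ->
  (forall m, cvgn (series (B m))) ->
  (forall x, U x -> csum (g ^~ x) (F x)) ->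
  forall x, U x -> C1_at F x /\ forall j, csum (fun i => D j (g i) x) (D j F x).
Proof.
move=> sg hB cB gF x Ux.
have gr y : U y -> series (fun i => (reC \o g i) y) @ \oo --> (reC \o F) y.
  by move=> Uy; have /csumP[] := gF y Uy.
have gi y : U y -> series (fun i => (imC \o g i) y) @ \oo --> (imC \o F) y.
  by move=> Uy; have /csumP[] := gF y Uy.
have c1 i y : U y -> C1_at (g i) y := @smooth_C1 _ _ _ _ (sg i) y.
have c2 i j y : U y -> C1_at (D j (g i)) y := @smooth_C1 _ _ _ _ (smooth_Dj j (sg i)) y.
have b0 i y : U y -> normc (g i y) <= B 0 i := hB 0 i y.
have b1 i j y : U y -> normc (D j (g i) y) <= B 1 i.
  by move=> Uy; exact: le_trans (order_norm_foldr 0 (g i) [:: j] y) (hB 1 i y Uy).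
have b2 i j y : U y -> normc (D j (D j (g i)) y) <= B 2 i.
  by move=> Uy; exact: le_trans (order_norm_foldr 0 (g i) [:: j; j] y) (hB 2 i y Uy).
have eR i j : 'D_(delta_mx 0 j) (reC \o g i) = - (imC \o D j (g i)).
  by apply/funext => y; rewrite derive_Re.
have eI i j : 'D_(delta_mx 0 j) (imC \o g i) = reC \o D j (g i).
  by apply/funext => y; rewrite derive_Im.
have hR j := @series_derive _ _ U (fun i => reC \o g i) (reC \o F) oU gr x (delta_mx 0 j) (B 1) (B 2) Ux.
have hI j := @series_derive _ _ U (fun i => imC \o g i) (imC \o F) oU gi x (delta_mx 0 j) (B 1) (B 2) Ux.
have {}hR j : derivable (reC \o F) x (delta_mx 0 j) /\
   series (fun i => 'D_(delta_mx 0 j) (reC \o g i) x) @ \oo --> 'D_(delta_mx 0 j) (reC \o F) x.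
  apply: (hR j) => [i y Uy|i y Uy|i y Uy|i y Uy||]; [| | | |exact: cB|exact: cB].
  - exact: (derivable_C1 j (c1 i y Uy)).1.
  - rewrite eR; apply: derivableN; exact: (derivable_C1 j (c2 i j y Uy)).2.
  - rewrite derive_Re normrN; exact: le_trans (normIm _) (b1 i j y Uy).
  - rewrite eR deriveN; last exact: (derivable_C1 j (c2 i j y Uy)).2.
    rewrite derive_Im normrN; exact: le_trans (normRe _) (b2 i j y Uy).
have {}hI j : derivable (imC \o F) x (delta_mx 0 j) /\
   series (fun i => 'D_(delta_mx 0 j) (imC \o g i) x) @ \oo --> 'D_(delta_mx 0 j) (imC \o F) x.
  apply: (hI j) => [i y Uy|i y Uy|i y Uy|i y Uy||]; [| | | |exact: cB|exact: cB].
  - exact: (derivable_C1 j (c1 i y Uy)).2.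
  - rewrite eI; exact: (derivable_C1 j (c2 i j y Uy)).1.
  - rewrite derive_Im; exact: le_trans (normRe _) (b1 i j y Uy).
  - rewrite eI derive_Re normrN; exact: le_trans (normIm _) (b2 i j y Uy).
split.
  split=> [||j]; last by split; [exact: (hR j).1|exact: (hI j).1].
  - apply: (series_continuous_at oU gr Ux (b := B 0)) => [i y Uy||i].
    + exact: le_trans (normRe _) (b0 i y Uy).
    + exact: cB.
    + exact: (continuous_C1 (c1 i x Ux)).1.
  - apply: (series_continuous_at oU gi Ux (b := B 0)) => [i y Uy||i].
    + exact: le_trans (normIm _) (b0 i y Uy).
    + exact: cB.
    + exact: (continuous_C1 (c1 i x Ux)).2.
move=> j; apply/csumP; split.
  rewrite -derive_Im (_ : (fun i => _) = fun i => 'D_(delta_mx 0 j) (imC \o g i) x); last first.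
    by apply/funext => i; rewrite derive_Im.
  exact: (hI j).2.
rewrite -[imC _]opprK -derive_Re.
rewrite (_ : series _ = - series (fun i => 'D_(delta_mx 0 j) (reC \o g i) x)); last first.
  apply/funext => J; rewrite /series/= fctE -sumrN; apply: eq_bigr => i _.
  by rewrite derive_Re opprK.
by apply: cvgN; exact: (hR j).2.
Qed.

(** Differentiating the series only shifts the majorants from [B m] to [B m.+1], so the hypotheses
    reproduce themselves in the induction. *)
Lemma termwise_smooth g F (B : nat -> nat -> R) :
  (forall i, smooth U (g i)) ->
  (forall m i x, U x -> order_norm m (g i) x <= B m i) ->
  (forall m, cvgn (series (B m))) ->
  (forall x, U x -> csum (g ^~ x) (F x)) ->
  smooth U F /\
  forall s x, U x -> csum (fun i => foldr D (g i) s x) (foldr D F s x).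
Proof.
move=> sg hB cB gF; split.
  apply/smoothP => k; elim: k g F B sg hB cB gF => [|k IH] g F B sg hB cB gF.
    by split; [move=> x Ux; exact: (termwise_C1 sg hB cB gF Ux).1|].
  split; [move=> x Ux; exact: (termwise_C1 sg hB cB gF Ux).1|move=> j].
  apply: (IH (fun i => D j (g i)) _ (fun m => B m.+1)).
  - by move=> i; exact: smooth_Dj.
  - by move=> m i x Ux; apply: le_trans (order_norm_Dj m (g i) j x) (hB m.+1 i x Ux).
  - by move=> m; exact: cB.
  - by move=> x Ux; exact: (termwise_C1 sg hB cB gF Ux).2.
move=> s; elim/last_ind: s g F B sg hB cB gF => [|s j IH] g F B sg hB cB gF; first exact: gF.
move=> x Ux; rewrite foldr_rcons.
rewrite (_ : (fun i => _) = fun i => foldr D (D j (g i)) s x); last first.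
  by apply/funext => i; rewrite foldr_rcons.
apply: (IH (fun i => D j (g i)) _ (fun m => B m.+1) _ _ _ _ x Ux).
- by move=> i; exact: smooth_Dj.
- by move=> m i y Uy; apply: le_trans (order_norm_Dj m (g i) j y) (hB m.+1 i y Uy).
- by move=> m; exact: cB.
- by move=> y Uy; exact: (termwise_C1 sg hB cB gF Uy).2.
Qed.

Section tail.
Variables (g : nat -> E -> C) (F : E -> C).
Hypothesis sg : forall i, smooth U (g i).
Hypothesis sF : smooth U F.
Hypothesis gF : forall s x, U x -> csum (fun i => foldr D (g i) s x) (foldr D F s x).
Variable x : E.
Hypothesis Ux : U x.

(** The remainder, kept as a function because its jet norms at a fixed point tend to zero; this
    carries bounds and differential operators through the infinite sum. *)
Definition tail_fun J : E -> C := fun y => F y - \sum_(0 <= i < J) g i y.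

Lemma smooth_psum J K : smooth U (fun y => \sum_(J <= i < K) g i y).
Proof.
exact: (@smooth_sum _ _ _ oU _ _ _ (fun i y => g i y) (fun i _ => sg i)).
Qed.

Lemma smooth_tail J : smooth U (tail_fun J).
Proof.
apply: (eq_smooth oU) (smoothD oU sF (smoothZ oU (-1) (smooth_psum 0 J))) => y _.
by rewrite mulN1r.
Qed.

Lemma foldr_Dj_psum s J K y : U y ->
  foldr D (fun y => \sum_(J <= i < K) g i y) s y = \sum_(J <= i < K) foldr D (g i) s y.
Proof.
move=> Uy; rewrite -![\sum_(J <= _ < K) _]/(\sum_(i <- index_iota J K) _).
elim: (index_iota J K) => [|i r IH].
  rewrite big_nil (eq_foldr_Dj (v := fun=> 0 * (0 : C)) s oU _ Uy); last first.
    by move=> z _; rewrite big_nil mulr0.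
  by rewrite (foldr_DjZ oU 0 s (smooth_cst oU 0) Uy) mul0r.
rewrite big_cons (eq_foldr_Dj (v := fun y => g i y + \sum_(i <- r) g i y) s oU _ Uy); last first.
  by move=> z _; rewrite big_cons.
rewrite (foldr_DjD oU s (sg i) (@smooth_sum _ _ _ oU _ r xpredT (fun i y => g i y) (fun i _ => sg i)) Uy).
by rewrite IH.
Qed.

Lemma foldr_Dj_tail s J y : U y ->
  foldr D (tail_fun J) s y = foldr D F s y - \sum_(0 <= i < J) foldr D (g i) s y.
Proof.
move=> Uy; rewrite (eq_foldr_Dj (v := fun y => F y + (-1) * \sum_(0 <= i < J) g i y) s oU _ Uy); last first.
  by move=> z _; rewrite mulN1r.
rewrite (foldr_DjD oU s sF (smoothZ oU (-1) (smooth_psum 0 J)) Uy).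
by rewrite (foldr_DjZ oU (-1) s (smooth_psum 0 J) Uy) (foldr_Dj_psum s 0 J Uy) mulN1r.
Qed.

Lemma order_norm_tail_cvg0 m : (fun J => order_norm m (tail_fun J) x) @ \oo --> (0 : R).
Proof.
suff H s : (fun J => order_norm m (foldr D (tail_fun J) s) x) @ \oo --> (0 : R).
  exact: (H [::]).
elim: m s => [|m IH] s /=.
  rewrite (_ : (fun J => _) = (fun J => normc (foldr D F s x - \sum_(0 <= i < J) foldr D (g i) s x))).
    exact: gF.
  by apply/funext => J; rewrite (foldr_Dj_tail s J Ux).
apply: cvg_sum0 => j; exact: (IH (j :: s)).
Qed.

Lemma jet_norm_tail_cvg0 rho N : (fun J => jet_norm rho N (tail_fun J) x) @ \oo --> (0 : R).
Proof.
rewrite /jet_norm; apply: cvg_sum0 => m; rewrite -[X in _ --> X](mul0r (rho ^+ m / m`!%:R)).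
by apply: cvgMl; exact: order_norm_tail_cvg0.
Qed.

(** Split the remainder after J into the block from J to K and the remainder after K, bound the
    block by the majorants, and let K tend to infinity. *)
Lemma jet_norm_tail_le rho N (c : nat -> R) J : 0 < rho ->
  (forall i, jet_norm rho N (g i) x <= c i) -> cvgn (series c) ->
  jet_norm rho N (tail_fun J) x <= limn (series c) - series c J.
Proof.
move=> rho0 gc cc.
have c0 i : 0 <= c i := le_trans (jet_norm_ge0 x rho0 N (g i)) (gc i).
apply: (cvgr_to_ge (F := \oo) (f := fun K => limn (series c) - series c J + jet_norm rho N (tail_fun K) x)).
  by rewrite -[X in _ --> X]addr0; apply: cvgD; [exact: cvg_cst|exact: jet_norm_tail_cvg0].
near=> K; have JK : (J <= K)%N by near: K; exact: nbhs_infty_ge.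
rewrite (eq_jet_norm oU _ Ux _ (g := fun y => \sum_(J <= i < K) g i y + tail_fun K y)); last first.
  by move=> y _; rewrite /tail_fun (@big_cat_nat _ _ _ J 0 K)//=; ring.
apply: le_trans (jet_normD oU rho0 Ux N (smooth_psum J K) (smooth_tail K)) _.
rewrite lerD2r; apply: le_trans (_ : \sum_(J <= i < K) c i <= _).
  exact: (@jet_norm_sum _ _ _ oU _ _ rho0 Ux _ _ _ _ (fun i y => g i y) _ (fun i _ => sg i) (fun i _ => gc i)).
by rewrite -sub_series_geq// lerD2r; exact: series_le_lim.
Unshelve. all: by end_near. Qed.

End tail.
End termwise_complex.

(** * Analytic functions *)

Section row_norm.
Context {R : realType} {n : nat}.
Implicit Types x : 'rV[R]_n.

Lemma norm_coord_le x j : `|x 0 j| <= `|x|.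
Proof.
rewrite -[leRHS]/(mx_norm x) mx_normrE.
exact: (le_bigmax 0 (fun ij : 'I_1 * 'I_n => `|x ij.1 ij.2|) (0, j)).
Qed.

Lemma norm_row_le x (r : R) : 0 <= r -> (forall j, `|x 0 j| <= r) -> `|x| <= r.
Proof.
move=> r0 xr; rewrite -[leLHS]/(mx_norm x) mx_normrE; apply/bigmax_leP; split=> // -[i j] _.
by rewrite ord1.
Qed.

End row_norm.

Section coordinates.
Context {R : realType} {n : nat}.
Local Notation E := 'rV[R]_n.
Local Notation C := R[i].
Local Notation reC := (@complex.Re R).
Local Notation imC := (@complex.Im R).
Local Notation D := (@Dj R n).
Implicit Types (u v f : E -> C) (j k : 'I_n) (x a : E).

Lemma is_derive_coord x a j k :
  is_derive x (delta_mx 0 k : E) (fun y : E => (y - a) 0 j) (j == k)%:R.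
Proof.
have H : (fun h : R => h^-1 *: (((fun y : E => (y - a) 0 j) \o shift x) (h *: (delta_mx 0 k : E)) - (x - a) 0 j)) @ 0^' --> ((j == k)%:R : R).
  apply: cvg_near_cst; rewrite near_withinE; near=> h => h0 /=.
  rewrite !mxE eqxx /= /GRing.scale/=.
  by rewrite (_ : _ - _ = h * (j == k)%:R); [rewrite mulKf|ring].
by split; [apply/cvg_ex; exists (j == k)%:R|exact: cvg_lim H].
Unshelve. all: by end_near. Qed.

Lemma continuous_coord a j : continuous (fun y : E => (y - a) 0 j).
Proof.
move=> x; rewrite (_ : (fun y => _) = (fun y : E => y 0 j) - cst (a 0 j)); last first.
  by apply/funext => y; rewrite !mxE.
by apply: continuousB; [exact: coord_continuous|exact: cst_continuous].
Qed.

Lemma C1_at_real (f : E -> R) x : {for x, continuous f} ->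
  (forall j, derivable f x (delta_mx 0 j)) -> C1_at (fun y => (f y)%:C) x.
Proof.
move=> cf df; split=> [||j].
- by rewrite (_ : _ \o _ = f).
- by rewrite (_ : _ \o _ = cst 0)//; exact: cst_continuous.
by split; [exact: df|exact: (derivable_cst (0 : R))].
Qed.

Lemma Dj_real (f : E -> R) x j (l : R) : is_derive x (delta_mx 0 j) f l ->
  D j (fun y => (f y)%:C) x = - 'i * l%:C.
Proof.
move=> [_ <-]; rewrite DjE (_ : reC \o _ = f)// (_ : imC \o _ = cst 0)//.
by rewrite derive_cst; simpc.
Qed.

Local Opaque smooth Dj C1_at derive derivable.

Lemma C1_at_coord a j x : C1_at (fun y : E => ((y - a) 0 j)%:C) x.
Proof.
apply: (C1_at_real (f := fun y : E => (y - a) 0 j)); first exact: continuous_coord.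
by move=> k; exact: (@ex_derive _ _ _ _ _ _ _ (is_derive_coord x a j k)).
Qed.

Lemma Dj_coord a j k x : D k (fun y : E => ((y - a) 0 j)%:C) x = - 'i * (j == k)%:R.
Proof.
rewrite (Dj_real (f := fun y : E => (y - a) 0 j) (is_derive_coord x a j k)).
by rewrite rmorph_nat.
Qed.

Lemma smooth_coord (U : set E) a j : open U -> smooth U (fun y : E => ((y - a) 0 j)%:C).
Proof.
move=> oU; apply/smoothP => -[|m]; split; [by move=> x _; exact: C1_at_coord|by []| |].
  by move=> x _; exact: C1_at_coord.
move=> k; apply: (Ck_eq oU (u := fun=> - 'i * (j == k)%:R)).
  by move=> x _; rewrite Dj_coord.
by move/smoothP : (smooth_cst oU (- 'i * (j == k)%:R : C)).
Qed.

Lemma order_norm_coord a j x m : order_norm m (fun y : E => ((y - a) 0 j)%:C) x =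
  match m with 0%N => `|(x - a) 0 j| | 1%N => 1 | _ => 0 end.
Proof.
case: m => [|m]; first exact: normc_real.
have e k : D k (fun y : E => ((y - a) 0 j)%:C) = fun=> - 'i * (j == k)%:R.
  by apply/funext => y; rewrite Dj_coord.
rewrite [LHS]/=.
under eq_bigr => k _ do rewrite e (order_norm_cst openT m (- 'i * (j == k)%:R : C) (I : setT x)).
case: m => [|m]; last by rewrite big1.
rewrite (bigD1 j)//= eqxx mulr1 normcN normc_i big1 ?addr0// => k kj.
by rewrite eq_sym (negPf kj) mulr0 Normc.normc0.
Qed.

Section jet_norm_mul.
Variables (U : set E) (rho : R) (x : E).
Hypotheses (oU : open U) (rho0 : 0 < rho) (Ux : U x).

Lemma jet_norm_coord a j N : jet_norm rho N (fun y : E => ((y - a) 0 j)%:C) x <= `|(x - a) 0 j| + rho.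
Proof.
rewrite /jet_norm big_ord_recl order_norm_coord expr0 fact0 divr1 mulr1 lerD2l.
case: N => [|N]; first by rewrite big_ord0 ltW.
rewrite big_ord_recl big1 ?addr0 => [|m _]; last by rewrite !lift0 order_norm_coord mul0r.
by rewrite lift0 order_norm_coord expr1 mul1r divr1.
Qed.

Lemma jet_norm_prod I (r : seq I) (F : I -> E -> C) (c : I -> R) N :
  (forall i, smooth U (F i)) -> (forall i, jet_norm rho N (F i) x <= c i) ->
  jet_norm rho N (fun y => \prod_(i <- r) F i y) x <= \prod_(i <- r) c i.
Proof.
move=> sF Fc; elim: r => [|i r IH].
  rewrite big_nil (eq_jet_norm oU rho Ux N (g := fun=> 1)); last by move=> y _; rewrite big_nil.
  by rewrite (jet_norm_cst oU rho Ux) Normc.normc1.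
rewrite big_cons (eq_jet_norm oU rho Ux N (g := fun y => F i y * \prod_(i <- r) F i y)); last first.
  by move=> y _; rewrite big_cons.
apply: le_trans (jet_normM oU rho0 Ux N (sF i) (smooth_prod oU r (fun i _ => sF i))) _.
by apply: ler_pM (Fc i) IH; exact: jet_norm_ge0.
Qed.

Lemma jet_norm_exp f (c : R) (k : nat) N : smooth U f -> jet_norm rho N f x <= c ->
  jet_norm rho N (fun y => f y ^+ k) x <= c ^+ k.
Proof.
move=> sf fc; elim: k => [|k IH].
  by rewrite expr0 (eq_jet_norm oU rho Ux N (g := fun=> 1)) ?(jet_norm_cst oU rho Ux) ?Normc.normc1.
rewrite exprS (eq_jet_norm oU rho Ux N (g := fun y => f y * f y ^+ k)); last first.
  by move=> y _; rewrite exprS.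
apply: le_trans (jet_normM oU rho0 Ux N sf (smoothX oU k sf)) _.
by apply: ler_pM fc IH; exact: jet_norm_ge0.
Qed.

Lemma mpow_complex (y : E) (b : multi n) :
  (mpow y b)%:C = \prod_(i < n) ((y 0 i)%:C) ^+ b i.
Proof. by rewrite rmorph_prod; apply: eq_bigr => i _; rewrite rmorphXn. Qed.

Lemma smooth_mpow a (b : multi n) : smooth U (fun y => (mpow (y - a) b)%:C).
Proof.
apply: (eq_smooth oU (u := fun y => \prod_(i < n) (((y - a) 0 i)%:C) ^+ b i)).
  by move=> y _; rewrite mpow_complex.
apply: (@smooth_prod _ _ _ oU _ _ _ (fun i y => (((y - a) 0 i)%:C) ^+ b i)) => i _.
exact: (smoothX oU (b i) (smooth_coord a i oU)).
Qed.

Lemma jet_norm_mpow a (b : multi n) N :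
  jet_norm rho N (fun y => (mpow (y - a) b)%:C) x <= (`|x - a| + rho) ^+ mdeg b.
Proof.
rewrite (eq_jet_norm oU rho Ux N (g := fun y => \prod_(i < n) (((y - a) 0 i)%:C) ^+ b i)); last first.
  by move=> y _; rewrite mpow_complex.
rewrite /mdeg expr_sum.
apply: (@jet_norm_prod _ _ (fun i y => (((y - a) 0 i)%:C) ^+ b i)
  (fun i => (`|x - a| + rho) ^+ b i)) => i.
  exact: (smoothX oU (b i) (smooth_coord a i oU)).
apply: jet_norm_exp; first exact: smooth_coord.
by apply: le_trans (jet_norm_coord a i N) _; rewrite lerD2r norm_coord_le.
Qed.

End jet_norm_mul.
End coordinates.

Section homogeneous.
Context (n : nat) (V : nmodType).

Definition hom_sum i (F : multi n -> V) : V :=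
  \sum_(b : {ffun 'I_n -> 'I_i.+1} | mdeg (mval b) == i) F (mval b).

Lemma le_mdeg (a : multi n) i : (a i <= mdeg a)%N.
Proof. by rewrite /mdeg (bigD1 i)//= leq_addr. Qed.

(** A multi-index of degree i has entries at most i, so enlarging the range of the entries from i to
    N adds no index. *)
Lemma hom_sum_widen N i (F : multi n -> V) : (i <= N)%N ->
  \sum_(b : {ffun 'I_n -> 'I_N.+1} | mdeg (mval b) == i) F (mval b) = hom_sum i F.
Proof.
move=> iN.
pose h (b : {ffun 'I_n -> 'I_i.+1}) : {ffun 'I_n -> 'I_N.+1} := [ffun j => inord (b j)].
pose h' (b : {ffun 'I_n -> 'I_N.+1}) : {ffun 'I_n -> 'I_i.+1} := [ffun j => inord (b j)].
have hE b : mval (h b) = mval b.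
  apply/ffunP => j; rewrite !ffunE inordK//; apply: leq_trans (ltn_ord _) _; by rewrite ltnS.
have h'E b : mdeg (mval b) = i -> mval (h' b) = mval b.
  move=> bi; apply/ffunP => j; rewrite !ffunE inordK// ltnS -bi.
  by have := le_mdeg (mval b) j; rewrite ffunE.
have mval_inj k : injective (@mval n k).
  move=> b c /ffunP e; apply/ffunP => j; apply: val_inj; by have := e j; rewrite !ffunE.
rewrite (reindex_onto h h') => [|b /eqP bi]; last first.
  by apply: mval_inj; rewrite hE h'E.
apply: eq_big => [b|b _]; last by rewrite hE.
rewrite hE andb_idr// => /eqP bi; apply/eqP; apply: mval_inj.
by rewrite h'E ?hE.
Qed.

Lemma sum_mdeg_hom N (F : multi n -> V) :
  \sum_(b : {ffun 'I_n -> 'I_N.+1} | (mdeg (mval b) <= N)%N) F (mval b) =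
  \sum_(0 <= i < N.+1) hom_sum i F.
Proof.
rewrite (partition_big (fun b => inord (mdeg (mval b)) : 'I_N.+1) xpredT)//= big_mkord.
apply: eq_bigr => i _; rewrite -(@hom_sum_widen N) -1?ltnS//.
apply: eq_bigl => b; apply/andP/eqP => [[bN /eqP/(congr1 val)/=]|bi]; first by rewrite inordK.
by rewrite bi -ltnS; split=> //; apply/eqP; exact: inord_val.
Qed.

End homogeneous.

Lemma le_exprn (R : realDomainType) k (a b : R) : 0 <= a -> a <= b -> a ^+ k <= b ^+ k.
Proof. by move=> a0 ab; apply: lerXn2r; rewrite ?nnegrE// (le_trans a0). Qed.

Section analytic.
Context {R : realType} {n : nat}.
Local Notation E := 'rV[R]_n.
Local Notation C := R[i].
Local Notation normc := (@Normc.normc R).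
Implicit Types (U : set E) (u v f : E -> C) (j : 'I_n) (x a : E).
Local Opaque smooth Dj C1_at derive derivable.

Lemma open_normball a (r : R) : open [set x : E | `|x - a| < r].
Proof.
rewrite (_ : [set _ | _] = ball a r); first exact: ball_open.
by rewrite -ball_normE; apply/seteqP; split=> x /=; rewrite /ball_/= distrC.
Qed.

Lemma order_norm_le_jet_norm (rho : R) m f x : 0 < rho ->
  order_norm m f x <= m`!%:R / rho ^+ m * jet_norm rho m f x.
Proof.
move=> rho0; have r0 := exprn_gt0 m rho0.
have m0 : 0 < m`!%:R :> R by rewrite ltr0n fact_gt0.
rewrite -ler_pdivrMl ?divr_gt0// invf_div mulrC /jet_norm big_ord_recr/= lerDr.
by apply: sumr_ge0 => i _; rewrite mulr_ge0 ?order_norm_ge0// divr_ge0// exprn_ge0// ltW.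
Qed.

(** The power series is grouped into homogeneous parts [g i]. A monomial of degree i has jet norm at
    most (|x - a| + rho)^i for jets of every order N, so [G i] need only be the sum of the moduli of
    the coefficients of degree i. *)
Lemma analytic_expansion U f a : analytic U f -> U a ->
  exists r, 0 < r /\ exists (g : nat -> E -> C) (G : nat -> R) (q : C),
  [/\ forall i, smooth setT (g i), forall y, g 0 y = q, forall i, 0 <= G i &
      cvgn (series (fun i => G i * r ^+ i))] /\
  (forall i N rho x, 0 < rho -> jet_norm rho N (g i) x <= G i * (`|x - a| + rho) ^+ i) /\
  (forall x, `|x - a| < r -> csum (g ^~ x) (f x)).
Proof.
move=> af Ua; have [r [r0 [c Hc]]] := af a Ua.
have r20 : 0 < r / 2 by rewrite divr_gt0.
exists (r / 2); split => //.
pose g i (y : E) := hom_sum i (fun b : multi n => c b * (mpow (y - a) b)%:C).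
pose G i : R := hom_sum i (fun b : multi n => normc (c b)).
exists g, G, (g 0 a); split; [split|split].
- move=> i; apply: (@smooth_sum _ _ _ openT _ _ _
    (fun (b : {ffun 'I_n -> 'I_i.+1}) y => c (mval b) * (mpow (y - a) (mval b))%:C)) => b _.
  exact: (smoothZ openT _ (smooth_mpow openT a (mval b))).
- move=> y; apply: eq_bigr => b /eqP b0; congr (_ * _%:C).
  rewrite /mpow; apply: eq_bigr => i _.
  by have := le_mdeg (mval b) i; rewrite b0 leqn0 => /eqP ->; rewrite !expr0.
- by move=> i; apply: sumr_ge0 => b _; exact: normc_ge0.
(* At this corner point, whose distance to a in the sup norm is r/2, all monomials of degree i have
   modulus (r/2)^i. Absolute convergence there is the convergence of the series of
   [G i * (r / 2) ^+ i]. *)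
- pose x : E := a + const_mx (r / 2).
  have xa : x - a = const_mx (r / 2) by rewrite addrC addKr.
  have xr : `|x - a| < r.
    apply: (@le_lt_trans _ _ (r / 2)); last by lra.
    by apply: norm_row_le => [|j]; [exact: ltW|rewrite xa mxE ger0_norm// ltW].
  have [ec _] := Hc x xr.
  set S := (\esum_(b in _) _)%E in ec.
  have S0 : (0 <= S)%E.
    by apply: esum_ge0 => b _; rewrite lee_fin mulr_ge0// normc_ge0.
  have bound J : series (fun i => G i * (r / 2) ^+ i) J <= fine S.
    case: J => [|J]; first by rewrite /series/= big_geq// fine_ge0.
    rewrite -lee_fin fineK ?ge0_fin_numE//.
    have -> : series (fun i => G i * (r / 2) ^+ i) J.+1 =
        \sum_(b : {ffun 'I_n -> 'I_J.+1} | (mdeg (mval b) <= J)%N)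
          (normc (c (mval b)) * `|mpow (x - a) (mval b)|).
      rewrite (sum_mdeg_hom J (fun b => normc (c b) * `|mpow (x - a) b|)).
      apply: eq_bigr => i _; rewrite /G /hom_sum mulr_suml; apply: eq_bigr => b /eqP bi.
      congr (_ * _); transitivity ((r / 2) ^+ mdeg (mval b)); first by rewrite bi.
      rewrite xa /mpow /mdeg expr_sum normr_prod; apply: eq_bigr => k _.
      by rewrite mxE normrX ger0_norm// ltW.
    apply: esum_ge.
    pose s := [seq @mval n J b | b <- enum [pred b : {ffun 'I_n -> 'I_J.+1} | (mdeg (mval b) <= J)%N]].
    exists [set` s]; first by split=> //; exact: finite_seq.
    rewrite -fsbig_seq; last first.
      rewrite map_inj_uniq ?enum_uniq// => b b' /ffunP e; apply/ffunP => k; apply: val_inj.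
      by have := e k; rewrite !ffunE.
    rewrite big_map big_enum/= sumEFin lee_fin; exact: lexx.
  apply: nondecreasing_is_cvgn.
    apply: nondecreasing_series => i _ _; rewrite mulr_ge0//; last by rewrite exprn_ge0// ltW.
    by apply: sumr_ge0 => b _; exact: normc_ge0.
  by exists (fine S) => _ [J _ <-].
- move=> i N rho x rho0; rewrite /G /hom_sum mulr_suml.
  apply: (@jet_norm_sum _ _ _ openT _ _ rho0 I _ _ _ _
    (fun (b : {ffun 'I_n -> 'I_i.+1}) y => c (mval b) * (mpow (y - a) (mval b))%:C)
    (fun b => normc (c (mval b)) * (`|x - a| + rho) ^+ i)) => b.
    move=> _; exact: (smoothZ openT _ (smooth_mpow openT a (mval b))).
  move=> /eqP bi; rewrite (jet_normZ openT rho I N _ (smooth_mpow openT a (mval b))).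
  apply: ler_wpM2l; first exact: normc_ge0.
  have := jet_norm_mpow openT rho0 I a (mval b) N; by rewrite bi.
- move=> x xr; have [|_ cf] := Hc x; first by apply: lt_trans xr _; lra.
  rewrite /csum -cvg_shiftS.
  rewrite (_ : [sequence _]_ _ = (fun N => normc (multi_sum N (fun b => c b * (mpow (x - a) b)%:C) - f x))).
    exact: cf.
  apply/funext => N /=; rewrite normcBC; congr (normc (_ - _)).
  by rewrite /multi_sum (sum_mdeg_hom N (fun b => c b * (mpow (x - a) b)%:C)).
Qed.

(** The bounds do not depend on the order [N] of the jet. The second one holds because removing the
    constant term leaves in every other term of the expansion a factor (|x - a| + rho) / r. *)
Lemma analytic_local U f a : analytic U f -> U a ->
  exists r A : R, [/\ 0 < r, 0 <= A, smooth [set x | `|x - a| < r] f &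
   forall x rho N, 0 < rho -> `|x - a| + rho <= r ->
     jet_norm rho N f x <= A /\ jet_norm rho N (fun y => f y - f a) x <= A * (`|x - a| + rho)].
Proof.
move=> af Ua; have [r [r0 [g [G [q [[sg g0 G0 cG] [Ng gf]]]]]]] := analytic_expansion af Ua.
pose L := limn (series (fun i => G i * r ^+ i)).
have cr0 i : 0 <= G i * r ^+ i by rewrite mulr_ge0// exprn_ge0// ltW.
have L0 : 0 <= L by apply: le_trans (series_le_lim cr0 cG 0); rewrite big_geq.
have r20 : 0 < r / 2 by rewrite divr_gt0.
set V := [set x : E | `|x - a| < r / 2].
have oV : open V by exact: open_normball.
have Vr x : V x -> `|x - a| < r by rewrite /V /= => h; lra.
have sgV i : smooth V (g i) by apply: smooth_sub (sg i).
have c0 m : 0 <= m`!%:R / (r / 2) ^+ m by rewrite divr_ge0// exprn_ge0// ltW.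
(* A Cauchy estimate: on the half ball, jets of radius r/2 still satisfy |x - a| + r/2 <= r. *)
have hB m i x : V x -> order_norm m (g i) x <= m`!%:R / (r / 2) ^+ m * (G i * r ^+ i).
  move=> Vx; apply: le_trans (order_norm_le_jet_norm m (g i) x r20) _.
  apply: ler_wpM2l; first exact: c0.
  apply: le_trans (Ng i m _ x r20) _; apply: ler_wpM2l; first exact: G0.
  apply: le_exprn; first by rewrite addr_ge0// ltW.
  by move: Vx; rewrite /V/=; lra.
have cB m : cvgn (series (fun i => m`!%:R / (r / 2) ^+ m * (G i * r ^+ i))).
  by apply: is_cvg_seriesZ; exact: cG.
have [sf fs] := @termwise_smooth _ _ V oV g f _ sgV hB cB (fun x Vx => gf x (Vr x Vx)).
have Lr0 : 0 <= L / r by rewrite divr_ge0// ltW.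
have sub1 x rho N : 0 < rho -> `|x - a| + rho <= r / 2 ->
    jet_norm rho N (fun y => f y - q) x <= L / r * (`|x - a| + rho).
  move=> rho0 xrho.
  have Vx : V x by rewrite /V/=; lra.
  have s0 : 0 <= `|x - a| + rho by rewrite addr_ge0// ltW.
  have gNr i : jet_norm rho N (g i) x <= G i * r ^+ i.
    apply: le_trans (Ng i N _ x rho0) _; apply: ler_wpM2l; first exact: G0.
    by apply: le_exprn => //; lra.
  apply: (cvgr_to_ge (F := \oo) (f := fun K => L / r * (`|x - a| + rho) + jet_norm rho N (tail_fun g f K) x)).
    by rewrite -[X in _ --> X]addr0; apply: cvgD; [exact: cvg_cst|exact: (jet_norm_tail_cvg0 oV sgV sf fs Vx)].
  near=> K; have K1 : (1 <= K)%N by near: K; exact: nbhs_infty_ge.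
  rewrite (eq_jet_norm oV rho Vx N (g := fun y => \sum_(1 <= i < K) g i y + tail_fun g f K y)); last first.
    by move=> y _; rewrite /tail_fun (@big_cat_nat _ _ _ 1 0 K)//= big_nat1 g0; ring.
  apply: le_trans (jet_normD oV rho0 Vx N (smooth_psum oV sgV 1 K) (smooth_tail oV sgV sf K)) _.
  rewrite lerD2r.
  apply: le_trans (@jet_norm_sum _ _ _ oV _ _ rho0 Vx N _ (index_iota 1 K) xpredT (fun i y => g i y)
    (fun i => jet_norm rho N (g i) x) (fun i _ => sgV i) (fun i _ => lexx _)) _.
  apply: le_trans (_ : \sum_(1 <= i < K) ((`|x - a| + rho) / r * (G i * r ^+ i)) <= _).
    rewrite big_nat_cond [leRHS]big_nat_cond; apply: ler_sum => i; rewrite andbT => /andP[i1 _].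
    apply: le_trans (Ng i N _ x rho0) _.
    rewrite mulrCA; apply: ler_wpM2l; first exact: G0.
    rewrite -(prednK i1) !exprS -mulrA; apply: ler_wpM2l => //.
    by rewrite mulKf ?gt_eqF//; apply: le_exprn => //; lra.
  rewrite -mulr_sumr (_ : L / r * _ = (`|x - a| + rho) / r * L); last by rewrite mulrAC (mulrC L) mulrAC.
  apply: ler_wpM2l; first by rewrite divr_ge0// ltW.
  apply: le_trans (series_le_lim cr0 cG K).
  by rewrite [leRHS](@big_cat_nat _ _ _ 1 0 K)//= lerDr sumr_ge0.
(* [L] bounds f itself; one [L / r] comes from f - q near x and the other from replacing q by f
   a. *)
exists (r / 2), (L + (L / r + L / r)).
split=> //; first by rewrite !addr_ge0.
move=> x rho N rho0 xrho.
have Vx : V x by rewrite /V/=; lra.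
have s0 : 0 <= `|x - a| + rho by rewrite addr_ge0// ltW.
have gNr i : jet_norm rho N (g i) x <= G i * r ^+ i.
  apply: le_trans (Ng i N _ x rho0) _; apply: ler_wpM2l; first exact: G0.
  by apply: le_exprn => //; lra.
have main : jet_norm rho N f x <= L.
  have := @jet_norm_tail_le _ _ V oV g f sgV sf fs x Vx rho N _ 0 rho0 gNr cG.
  rewrite /series/= big_geq// subr0; apply: le_trans.
  rewrite le_eqVlt; apply/orP; left; apply/eqP; apply: (eq_jet_norm oV rho Vx) => y _.
  by rewrite /tail_fun big_geq// subr0.
split; first by lra.
have h1 := sub1 x rho N rho0 xrho.
have h2 := sub1 a rho 0 rho0; rewrite jet_norm0 subrr normr0 add0r in h2.
have {}h2 : normc (f a - q) <= L / r * rho by apply: h2; have := normr_ge0 (x - a); lra.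
rewrite (eq_jet_norm oV rho Vx N (g := fun y => (f y - q) + (q - f a))); last first.
  by move=> y _; ring.
have sq (z : C) : smooth V (fun y => f y - z).
  by apply: (eq_smooth oV) (smoothD oV sf (smooth_cst oV (- z))).
apply: le_trans (jet_normD oV rho0 Vx N (sq q) (smooth_cst oV (q - f a))) _.
rewrite (jet_norm_cst oV rho Vx) normcBC.
have h3 : L / r * rho <= L / r * (`|x - a| + rho) by rewrite ler_wpM2l// lerDr.
rewrite !mulrDl; have : 0 <= L * (`|x - a| + rho) by rewrite mulr_ge0.
lra.
Unshelve. all: by end_near. Qed.

End analytic.

Section analytic_global.
Context {R : realType} {n : nat}.
Local Notation E := 'rV[R]_n.
Local Notation C := R[i].
Implicit Types (U K : set E) (f : E -> C).

Lemma analytic_smooth U f : analytic U f -> smooth U f.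
Proof.
move=> af; apply: smooth_local => a Ua.
have [r [A [r0 _ sf _]]] := analytic_local af Ua.
by exists [set x | `|x - a| < r] => //=; rewrite subrr normr0.
Qed.

(** A single parameter [A] is both the bound and the inverse of the radius. The local statements
    then hold for all large [A], which is the form in which compactness makes them uniform.
    [coefficients_local] uses the same device for finitely many functions. *)
Lemma analytic_compact_bound (I : finType) U K (f : I -> E -> C) :
  (forall i, analytic U (f i)) -> compact K -> K `<=` U ->
  exists rho A : R, [/\ 0 < rho, 0 <= A &
    forall i x N rho', K x -> 0 < rho' -> rho' <= rho -> jet_norm rho' N (f i) x <= A].
Proof.
move=> af /compact_near_coveringP cK KU.
pose P (A : R) (x : E) := forall i N rho', 0 < rho' -> rho' <= A^-1 -> jet_norm rho' N (f i) x <= A.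
have : \forall A \near +oo, K `<=` P A.
  apply: cK => x Kx.
  have Ux := KU x Kx.
  suff H i : \forall x \near x & A \near +oo, forall N rho', 0 < rho' -> rho' <= A^-1 -> jet_norm rho' N (f i) x <= A.
    have FF : Filter (filter_prod (nbhs x) (pinfty_nbhs R)) by exact: filter_prod_filter.
    have := @filter_forall _ _
      (fun i (yA : E * R) => forall N rho', 0 < rho' -> rho' <= yA.2^-1 -> jet_norm rho' N (f i) yA.1 <= yA.2)
      (filter_prod (nbhs x) (pinfty_nbhs R)) FF H.
    by apply: filterS => -[y A] /= h i; exact: h.
  have [r [A [r0 A0 _ H]]] := analytic_local (af i) Ux.
  near=> y B => N rho' rho'0 rB /=.
  have B0 : 0 < B by near: B; exact: nbhs_pinfty_gt.
  have AB : A <= B by near: B; exact: (nbhs_pinfty_ge (num_real _)).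
  have rB2 : 2 / r <= B by near: B; exact: (nbhs_pinfty_ge (num_real _)).
  have yx : `|y - x| < r / 2.
    by rewrite distrC; near: y; apply: cvgr_dist_lt => //; rewrite divr_gt0.
  apply: le_trans AB; apply: (H y rho' N rho'0 _).1.
  have : B^-1 <= r / 2 by rewrite -invf_div lef_pV2 ?posrE// divr_gt0.
  by lra.
move=> /(pinfty_ex_gt (num_real 0))[A A0 HA].
exists A^-1, A; split; [by rewrite invr_gt0|exact: ltW|].
by move=> i x N rho' Kx r0 rA; exact: HA.
Unshelve. all: by end_near. Qed.

End analytic_global.

(** * Gaussian wave packets *)

Section directional.
Context {R : realType} {n : nat}.
Local Notation E := 'rV[R]_n.

Lemma is_derive_along (f : E -> R) (x v : E) (l : R) :
  is_derive (0 : R) 1 (fun h : R => f (h *: v + x)) l -> is_derive x v f l.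
Proof.
move=> [H <-]; have e : (fun h : R => h^-1 *: (((fun s : R => f (s *: v + x)) \o shift 0) (h *: (1 : R)) -
    f (0 *: v + x))) =
  (fun h : R => h^-1 *: ((f \o shift x) (h *: v) - f x)).
  apply/funext => h /=; rewrite scale0r add0r; congr (_ *: (f _ - _)).
  by rewrite addr0 [h *: (1:R)]mulr1.
by split; move: H; rewrite /derivable /derive -e.
Qed.

End directional.

Section gaussian.
Context {R : realType} {n : nat}.
Local Notation E := 'rV[R]_n.
Local Notation C := R[i].
Local Notation reC := (@complex.Re R).
Local Notation imC := (@complex.Im R).
Local Notation normc := (@Normc.normc R).
Local Notation D := (@Dj R n).
Implicit Types (u v f g : E -> C) (j : 'I_n) (x : E).
Variables (x0 xi : E) (t : R).

Definition sqnorm x : R := \sum_(i < n) ((x - x0) 0 i) ^+ 2.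
Definition phase x : R := \sum_(i < n) (x - x0) 0 i * xi 0 i.

(* exp (t (i <x - x0, xi> - |x - x0|^2)); dgaussian k is D_k gaussian / gaussian. *)
Definition gaussian x : C :=
  (expR (- (t * sqnorm x)) * cos (t * phase x)) +i*
  (expR (- (t * sqnorm x)) * sin (t * phase x)).

Definition dgaussian (k : 'I_n) x : C :=
  (t * xi 0 k)%:C + ((2 * t)%:C * 'i) * ((x - x0) 0 k)%:C.

Lemma sqnorm_ge0 x : 0 <= sqnorm x.
Proof. by apply: sumr_ge0 => i _; exact: sqr_ge0. Qed.

Lemma normc_gaussian x : normc (gaussian x) = expR (- (t * sqnorm x)).
Proof.
rewrite /= !exprMn -mulrDr cos2Dsin2 mulr1 sqrtr_sqr ger0_norm// expR_ge0.
Qed.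

Lemma continuous_sqnorm : continuous sqnorm.
Proof.
move=> x; rewrite (_ : sqnorm = \sum_(i < n) (fun y : E => (y - x0) 0 i) ^+ 2); last first.
  by apply/funext => y; rewrite fct_sumE /sqnorm; apply: eq_bigr => i _.
elim/big_ind: _ => [|f g cf cg|i _].
- exact: cst_continuous.
- exact: (continuousD cf cg).
- rewrite expr2; apply: continuousM; exact: continuous_coord.
Qed.

Lemma continuous_phase : continuous phase.
Proof.
move=> x; rewrite (_ : phase = \sum_(i < n) ((fun y : E => (y - x0) 0 i) * cst (xi 0 i))); last first.
  by apply/funext => y; rewrite fct_sumE /phase; apply: eq_bigr => i _.
elim/big_ind: _ => [|f g cf cg|i _].
- exact: cst_continuous.
- exact: (continuousD cf cg).
- apply: continuousM; [exact: continuous_coord|exact: cst_continuous].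
Qed.

Lemma line_coord x (k : 'I_n) (h : R) i : (h *: (delta_mx 0 k : E) + x - x0) 0 i =
  (x - x0) 0 i + h * (i == k)%:R.
Proof. by rewrite !mxE eqxx /=; ring. Qed.

Lemma sqnorm_line x (k : 'I_n) (h : R) :
  sqnorm (h *: delta_mx 0 k + x) = sqnorm x + (2 * h * (x - x0) 0 k + h ^+ 2).
Proof.
rewrite /sqnorm (bigD1 k)//= [in RHS](bigD1 k)//= line_coord eqxx mulr1.
rewrite (eq_bigr (fun i => ((x - x0) 0 i) ^+ 2)) => [|i ik]; first by ring.
by rewrite line_coord (negPf ik) mulr0 addr0.
Qed.

Lemma phase_line x (k : 'I_n) (h : R) :
  phase (h *: delta_mx 0 k + x) = phase x + h * xi 0 k.
Proof.
rewrite /phase (bigD1 k)//= [in RHS](bigD1 k)//= line_coord eqxx mulr1.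
rewrite (eq_bigr (fun i => (x - x0) 0 i * xi 0 i)) => [|i ik]; first by ring.
by rewrite line_coord (negPf ik) mulr0 addr0.
Qed.

(** Along a coordinate line [sqnorm] and [phase] are polynomials of degree at most 2 in the
    parameter, so this is a one-variable computation. It is stated for an arbitrary [trig] to serve
    both cosine and sine. *)
Lemma is_derive_gauss (trig : R -> R) (dtrig : R) x (k : 'I_n) :
  is_derive (t * phase x) 1 trig dtrig ->
  is_derive x (delta_mx 0 k : E) (fun y => expR (- (t * sqnorm y)) * trig (t * phase y))
  (expR (- (t * sqnorm x)) *
   (- (2 * t * (x - x0) 0 k) * trig (t * phase x) + t * xi 0 k * dtrig)).
Proof.
move=> dt; apply: is_derive_along.
have quad (a b c : R) : is_derive (0 : R) 1 (fun h : R => a + b * h + c * h ^+ 2) b.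
  rewrite (_ : (fun h => _) = (cst a + b \*: (@id R)) + c \*: ((@id R) ^+ 2)); last first.
    by apply/funext => h.
  by apply: is_derive_eq; rewrite /GRing.scale/= expr1; ring.
pose A (h : R) : R := - (t * sqnorm x) + (- (2 * t * (x - x0) 0 k)) * h + (- t) * h ^+ 2.
pose B (h : R) : R := t * phase x + (t * xi 0 k) * h + 0 * h ^+ 2.
rewrite (_ : (fun h => _) = (expR \o A) * (trig \o B)); last first.
  apply/funext => h /=; rewrite sqnorm_line phase_line /A /B fctE /=.
  by congr (expR _ * trig _); ring.
have A0 : A 0 = - (t * sqnorm x) by rewrite /A; ring.
have B0 : B 0 = t * phase x by rewrite /B; ring.
have dA : is_derive (0 : R) 1 A (- (2 * t * (x - x0) 0 k)) by exact: quad.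
have dB : is_derive (0 : R) 1 B (t * xi 0 k) by exact: quad.
have dE : is_derive (0 : R) 1 (expR \o A) (expR (A 0) * - (2 * t * (x - x0) 0 k)).
  exact: is_derive1_comp.
have dT : is_derive (0 : R) 1 (trig \o B) (dtrig * (t * xi 0 k)).
  by apply: is_derive1_comp; rewrite B0.
apply: is_derive_eq; rewrite /GRing.scale/= A0 B0; ring.
Qed.

Lemma is_derive_gauss_re x (k : 'I_n) : is_derive x (delta_mx 0 k : E) (reC \o gaussian)
  (expR (- (t * sqnorm x)) *
   (- (2 * t * (x - x0) 0 k) * cos (t * phase x) + t * xi 0 k * - sin (t * phase x))).
Proof. exact: is_derive_gauss. Qed.

Lemma is_derive_gauss_im x (k : 'I_n) : is_derive x (delta_mx 0 k : E) (imC \o gaussian)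
  (expR (- (t * sqnorm x)) *
   (- (2 * t * (x - x0) 0 k) * sin (t * phase x) + t * xi 0 k * cos (t * phase x))).
Proof. exact: is_derive_gauss. Qed.

Lemma continuous_gauss (trig : R -> R) : continuous trig ->
  continuous (fun y : E => expR (- (t * sqnorm y)) * trig (t * phase y)).
Proof.
move=> ct x.
have c1 : {for x, continuous (fun y => - (t * sqnorm y))}.
  by apply: continuousN; apply: continuousM; [exact: cst_continuous|exact: continuous_sqnorm].
have c2 : {for x, continuous (fun y => t * phase y)}.
  by apply: continuousM; [exact: cst_continuous|exact: continuous_phase].
have c3 : {for x, continuous (expR \o (fun y => - (t * sqnorm y)))}.
  by apply: continuous_comp; [exact: c1|exact: continuous_expR].
have c4 : {for x, continuous (trig \o (fun y => t * phase y))}.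
  by apply: continuous_comp; [exact: c2|exact: ct].
exact: (continuousM c3 c4).
Qed.

Lemma C1_at_gaussian x : C1_at gaussian x.
Proof.
split=> [||j].
- by apply: continuous_gauss; exact: continuous_cos.
- by apply: continuous_gauss; exact: continuous_sin.
split; [exact: (@ex_derive _ _ _ _ _ _ _ (is_derive_gauss_re x j))|
  exact: (@ex_derive _ _ _ _ _ _ _ (is_derive_gauss_im x j))].
Qed.

Lemma Dj_gaussian k x : D k gaussian x = dgaussian k x * gaussian x.
Proof.
rewrite DjE (@derive_val _ _ _ _ _ _ _ (is_derive_gauss_re x k)).
rewrite (@derive_val _ _ _ _ _ _ _ (is_derive_gauss_im x k)) /dgaussian /gaussian.
move: (expR _) (cos _) (sin _) ((x - x0) 0 k) (xi 0 k) => e c s y z.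
by simpc; congr (_ +i* _); ring.
Qed.

Local Opaque smooth Dj C1_at derive derivable gaussian.

Lemma smooth_dgaussian (U : set E) k : open U -> smooth U (dgaussian k).
Proof.
move=> oU; apply: (smoothD oU (smooth_cst oU _)).
exact: (smoothZ oU _ (smooth_coord x0 k oU)).
Qed.

Lemma smooth_gaussian (U : set E) : open U -> smooth U gaussian.
Proof.
move=> oU; apply/smoothP; elim=> [|m IH]; split; [by move=> x _; exact: C1_at_gaussian|by []| |].
  by move=> x _; exact: C1_at_gaussian.
move=> k; apply: (Ck_eq oU (u := fun y => dgaussian k y * gaussian y)).
  by move=> y _; rewrite Dj_gaussian.
by apply: CkM => //; move/smoothP : (smooth_dgaussian k oU).
Qed.

Section conjugation.
Variable U : set E.
Hypothesis oU : open U.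
Variables (d : nat) (p : multi n -> E -> C).
Hypothesis sp : forall a, (mdeg a <= d)%N -> smooth U (p a).

Let sb k : smooth U (dgaussian k) := smooth_dgaussian k oU.

(** Conjugation by the gaussian turns each D_k into D_k + [dgaussian k], one letter after the
    other. *)
Lemma foldr_Dj_gaussian g s x : smooth U g -> U x ->
  foldr D (fun y => gaussian y * g y) s x = gaussian x * foldr (shift_Dj dgaussian) g s x.
Proof.
move=> sg; elim: s x => // k s IH x Ux /=.
have sA := smooth_shift_Djs oU sb s sg.
rewrite (eq_Dj k oU Ux IH) (DjM k (C1_at_gaussian x) (smooth_C1 sA Ux)) Dj_gaussian /shift_Dj.
by ring.
Qed.

Lemma foldr_shift_Dj0 g s : foldr (shift_Dj (fun=> fun=> 0)) g s = foldr D g s.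
Proof.
elim: s => //= k s ->; apply/funext => x; rewrite /shift_Dj mul0r addr0 //.
Qed.

Lemma eq_shift_op b f g : (forall y, U y -> f y = g y) ->
  (forall k, smooth U (b k)) -> forall y, U y -> shift_op b d p f y = shift_op b d p g y.
Proof.
move=> fg sb' y Uy; rewrite /shift_op /multi_sum; apply: eq_bigr => a _; congr (_ * _).
elim: (word (mval a)) y Uy => [|k s IH] y Uy /=; first exact: fg.
by rewrite /shift_Dj (eq_Dj k oU Uy IH) IH.
Qed.

(** The operator P itself, seen as a shifted operator with zero shift so that the jet norm bounds of
    [shift_op] apply to it as well. *)
Definition diff_op := shift_op (fun=> fun=> 0) d p.

Lemma diff_opE u x : diff_op u x = multi_sum d (fun a => p a x * Dalpha a u x).
Proof. by rewrite /diff_op /shift_op; under eq_fun do rewrite foldr_shift_Dj0 -DalphaE. Qed.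

Lemma diff_op_gaussian g x : smooth U g -> U x ->
  diff_op (fun y => gaussian y * g y) x = gaussian x * shift_op dgaussian d p g x.
Proof.
move=> sg Ux; rewrite /diff_op /shift_op /multi_sum mulr_sumr; apply: eq_bigr => a _.
by rewrite foldr_shift_Dj0 foldr_Dj_gaussian// mulrCA.
Qed.

Lemma iter_diff_op_gaussian k x : U x ->
  iter k diff_op gaussian x = gaussian x * iter k (shift_op dgaussian d p) (fun=> 1) x.
Proof.
elim: k x => [|k IH] x Ux; first by rewrite mulr1.
rewrite !iterS -diff_op_gaussian//; last exact: (smooth_iter_shift_op oU sb sp k (smooth_cst oU 1)).
by apply: (eq_shift_op IH); [move=> j; exact: (smooth_cst oU 0)|exact: Ux].
Qed.

End conjugation.

(** The three-term recurrence of the Hermite polynomials: [dgaussian l] has the constant derivative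
    2t in direction l, so the Leibniz rule stops after one term. For m = 0 the default [m.-1] is
    harmless, its coefficient being zero. *)
Lemma iter_Dj_gaussian l m x : iter m.+1 (D l) gaussian x =
  dgaussian l x * iter m (D l) gaussian x + (2 * t * m%:R)%:C * iter m.-1 (D l) gaussian x.
Proof.
have sm (k : nat) : smooth setT (iter k (D l) gaussian).
  by elim: k => [|k IH]; [exact: (smooth_gaussian openT)|exact: (smooth_Dj l IH)].
have db y : D l (dgaussian l) y = (2 * t)%:C.
  rewrite (DjD l (C1_at_cst _ _) (smooth_C1 (smoothZ openT _ (smooth_coord x0 l openT)) I)).
  rewrite Dj_cst (DjZ _ l (C1_at_coord x0 l y)) Dj_coord eqxx add0r mulr1.
  by simpc; congr (_ +i* _); ring.
elim: m x => [|m IH] x.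
  by rewrite mulr0 mul0r addr0 /= Dj_gaussian.
rewrite iterS (eq_Dj l openT I (fun y _ => IH y)).
have s1 := smoothM openT (smooth_dgaussian l openT) (sm m).
have s2 := smoothZ openT (2 * t * m%:R)%:C (sm m.-1).
rewrite (DjD l (smooth_C1 s1 I) (smooth_C1 s2 I)).
rewrite (DjM l (smooth_C1 (smooth_dgaussian l openT) I) (smooth_C1 (sm m) I)).
rewrite (DjZ _ l (smooth_C1 (sm m.-1) I)) db -!iterS.
case: m {IH s1 s2} => [|m].
  by rewrite mulr0 mul0r addr0 mulr1 addrC.
rewrite -[m.+1.-1.+1]/m.+1 -[m.+2.-1]/m.+1 -[in RHS](natr1 m.+1) mulrDr mulr1 rmorphD/=.
rewrite -addrA addrCA; congr (_ + _).
by rewrite [RHS]mulrDl addrC.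
Qed.

(** At x0 the recurrence has the nonnegative real coefficients t and 2tm, so all values are real and
    the first term alone gives t^m. Since the recurrence has two steps, the induction carries two
    consecutive values. *)
Lemma iter_Dj_gaussian_center l m : 0 <= t -> xi 0 l = 1 ->
  exists2 b : R, t ^+ m <= b & iter m (D l) gaussian x0 = b%:C.
Proof.
move=> t0 xl.
have d0 : dgaussian l x0 = t%:C.
  by rewrite /dgaussian xl mulr1 subrr mxE mulr0 addr0.
have g0 : gaussian x0 = 1.
  Transparent gaussian.
  rewrite /gaussian /sqnorm /phase.
  under eq_bigr do rewrite subrr mxE expr0n.
  under [X in cos (t * X)]eq_bigr do rewrite subrr mxE mul0r.
  under [X in sin (t * X)]eq_bigr do rewrite subrr mxE mul0r.
  by rewrite !big1// !mulr0 oppr0 expR0 cos0 sin0 mulr1 mulr0.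
suff [] : ((exists2 b : R, t ^+ m <= b & iter m (D l) gaussian x0 = b%:C) /\ (exists2 b : R, t ^+ m.+1 <= b & iter m.+1 (D l) gaussian x0 = b%:C))%type by [].
elim: m => [|m [[b1 hb1 e1] [b2 hb2 e2]]].
  split; first by exists 1; rewrite ?g0 // expr0.
  by exists t; rewrite ?expr1//= Dj_gaussian d0 g0 mulr1.
split; first by exists b2.
exists (t * b2 + 2 * t * m.+1%:R * b1).
  apply: le_trans (_ : t * b2 <= _); first by rewrite exprS ler_wpM2l.
  rewrite lerDl !mulr_ge0//; apply: le_trans hb1; exact: exprn_ge0.
by rewrite iter_Dj_gaussian d0 e2 [m.+1.-1]/= e1 -!rmorphM -rmorphD.
Qed.

End gaussian.

Section axis.
Context (n : nat).

Definition axis (l : 'I_n) m : multi n := [ffun j => if j == l then m else 0%N].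

Lemma mdeg_axis l m : mdeg (axis l m) = m.
Proof.
rewrite /mdeg (bigD1 l)//= ffunE eqxx big1 ?addn0// => j jl.
by rewrite ffunE (negPf jl).
Qed.

Lemma word_axis l m : word (axis l m) = nseq m l.
Proof.
have aux (s : seq 'I_n) : uniq s ->
    flatten [seq nseq (axis l m j) j | j <- s] = if l \in s then nseq m l else [::].
  elim: s => //= j s IH /andP[js us]; rewrite IH// ffunE in_cons eq_sym.
  have [->|_] := eqVneq l j; last by [].
  by rewrite (negPf js) cats0.
by rewrite /word aux ?enum_uniq// mem_enum.
Qed.

Lemma foldr_nseq (A : Type) (h : 'I_n -> A -> A) (v : A) l m :
  foldr h v (nseq m l) = iter m (h l) v.
Proof. by elim: m => //= m ->. Qed.

End axis.

Lemma prod_mpow (R : realType) n (t : R) (x : 'rV[R]_n) (a : multi n) :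
  \prod_(j < n) (t * x 0 j) ^+ a j = t ^+ mdeg a * mpow x a.
Proof.
rewrite /mdeg expr_sum /mpow -big_split/=.
by apply: eq_bigr => j _; rewrite exprMn.
Qed.

(** * Pointwise estimates of the iterates of P on one packet *)

Section estimates.
Context {R : realType} {n : nat}.
Local Notation E := 'rV[R]_n.
Local Notation C := R[i].
Local Notation normc := (@Normc.normc R).
Implicit Types (K : set E) (x : E).
Variables (Omega : set E) (d : nat) (p : multi n -> E -> C).
Hypothesis oO : open Omega.
Hypothesis d0 : (0 < d)%N.
Hypothesis ap : forall a, (mdeg a <= d)%N -> analytic Omega (p a).
Variables (x0 xi : E).
Local Opaque smooth Dj C1_at derive derivable gaussian.

Local Notation idx := {a : {ffun 'I_n -> 'I_d.+1} | (mdeg (mval a) <= d)%N}.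
Local Notation c0 := (#|{: {ffun 'I_n -> 'I_d.+1}}|%:R : R).

Let sp a : (mdeg a <= d)%N -> smooth Omega (p a).
Proof. by move=> /ap; exact: analytic_smooth. Qed.

(** The multi-indices of degree at most d are enumerated by the finite type [idx], over which local
    bounds can be made uniform. *)
Lemma mval_onto (a : multi n) : (mdeg a <= d)%N -> exists i : idx, mval (val i) = a.
Proof.
move=> ad; pose b : {ffun 'I_n -> 'I_d.+1} := [ffun j => inord (a j)].
have ba : mval b = a.
  apply/ffunP => j; rewrite !ffunE inordK// ltnS; exact: leq_trans (le_mdeg a j) ad.
have bd : (mdeg (mval b) <= d)%N by rewrite ba.
by exists (exist _ b bd).
Qed.

Lemma card_ge1 : 1 <= c0.
Proof. by rewrite ler1n; apply/card_gt0P; exists [ffun=> ord0]. Qed.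

Lemma coefficients_bound K : compact K -> K `<=` Omega ->
  exists rho A : R, [/\ 0 < rho, 1 <= A & forall a x N rho', (mdeg a <= d)%N ->
    K x -> 0 < rho' -> rho' <= rho -> jet_norm rho' N (p a) x <= A].
Proof.
move=> cK KO.
have [i|rho [A [rho0 A0 H]]] := @analytic_compact_bound _ _ idx Omega K (fun i => p (mval (val i))) _ cK KO.
  by apply: ap; exact: (valP i).
exists rho, (A + 1); split=> //; first by rewrite lerDr.
move=> a x N rho' /mval_onto[i <-] Kx h1 h2; apply: le_trans (H i x N rho' Kx h1 h2) _.
by rewrite lerDl.
Qed.

Lemma coefficients_local : Omega x0 ->
  exists rho A : R, [/\ 0 < rho, rho <= 1, 1 <= A & forall a x N rho', (mdeg a <= d)%N ->
    0 < rho' -> `|x - x0| + rho' <= rho -> jet_norm rho' N (p a) x <= A /\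
    jet_norm rho' N (fun y => p a y - p a x0) x <= A * (`|x - x0| + rho')].
Proof.
move=> Ox0.
pose P (i : idx) (A : R) := forall x N rho', 0 < rho' -> `|x - x0| + rho' <= A^-1 ->
  jet_norm rho' N (p (mval (val i))) x <= A /\
  jet_norm rho' N (fun y => p (mval (val i)) y - p (mval (val i)) x0) x <= A * (`|x - x0| + rho').
have : \forall A \near +oo, forall i, P i A.
  apply: filter_forall => i.
  have [r [A [r0 A0 _ H]]] := analytic_local (ap (valP i)) Ox0.
  near=> B => x N rho' rho'0 h.
  have B0 : 0 < B by near: B; exact: (nbhs_pinfty_gt (num_real _)).
  have AB : A <= B by near: B; exact: (nbhs_pinfty_ge (num_real _)).
  have rB : r^-1 <= B by near: B; exact: (nbhs_pinfty_ge (num_real _)).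
  have Br : B^-1 <= r by rewrite -(invrK r) lef_pV2 ?posrE ?invr_gt0.
  have [h1 h2] := H x rho' N rho'0 (le_trans h Br).
  split; first exact: le_trans h1 AB.
  by apply: le_trans h2 _; rewrite ler_wpM2r// addr_ge0// ltW.
move=> /(pinfty_ex_gt (num_real 1))[A A1 HA].
have A0 : 0 < A := lt_trans ltr01 A1.
exists A^-1, A; split; [by rewrite invr_gt0|by rewrite invf_le1// ltW|exact: ltW|].
by move=> a x N rho' /mval_onto[i <-] h1 h2; exact: HA.
Unshelve. all: by end_near. Qed.

Lemma jet_norm_dgaussian t rho N k x : 0 <= t -> 0 < rho ->
  jet_norm rho N (fun y => dgaussian x0 xi t k y - (t * xi 0 k)%:C) x <= 2 * t * (`|x - x0| + rho).
Proof.
move=> t0 rho0.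
rewrite (eq_jet_norm openT rho I N (g := fun y => ((2 * t)%:C * 'i) * ((y - x0) 0 k)%:C)); last first.
  by move=> y _; rewrite /dgaussian addrC addKr.
rewrite (jet_normZ openT rho I N _ (smooth_coord x0 k openT)).
rewrite Normc.normcM normc_i mulr1 normc_real ger0_norm ?mulr_ge0// ler_wpM2l ?mulr_ge0//.
by apply: le_trans (jet_norm_coord x rho0 x0 k N) _; rewrite lerD2r norm_coord_le.
Qed.

Lemma jet_norm_dgaussian_le t rho N k x : 0 <= t -> 0 < rho ->
  jet_norm rho N (dgaussian x0 xi t k) x <= t * (`|xi| + 2 * (`|x - x0| + rho)).
Proof.
move=> t0 rho0.
have sB : smooth setT (fun y => dgaussian x0 xi t k y - (t * xi 0 k)%:C).
  apply: (eq_smooth openT) (smoothZ openT ((2 * t)%:C * 'i) (smooth_coord x0 k openT)) => y _.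
  by rewrite /dgaussian [RHS]addrC addKr.
rewrite (eq_jet_norm openT rho I N (g := fun y => (t * xi 0 k)%:C + (dgaussian x0 xi t k y - (t * xi 0 k)%:C))); last first.
  by move=> y _; rewrite addrCA subrr addr0.
apply: le_trans (jet_normD openT rho0 I N (smooth_cst openT _) sB) _.
rewrite (jet_norm_cst openT rho I) normc_real normrM (ger0_norm t0) mulrDr; apply: lerD.
  by rewrite ler_wpM2l// norm_coord_le.
by apply: le_trans (jet_norm_dgaussian _ _ _ t0 rho0) _; rewrite mulrA [t * 2]mulrC.
Qed.

(** The modulus is the jet norm of order 0, and the conjugated operator starts from the constant 1,
    whose jet norms are all equal to 1. *)
Lemma iter_diff_op_gaussian_le t rho Q B k x : Omega x -> 0 < rho -> 0 <= B -> (k * d <= Q)%N ->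
  (forall f M, smooth Omega f -> (M + d <= Q)%N ->
    jet_norm rho M (shift_op (dgaussian x0 xi t) d p f) x <= B * jet_norm rho (M + d) f x) ->
  normc (iter k (diff_op d p) (gaussian x0 xi t) x) <= expR (- (t * sqnorm x0 x)) * B ^+ k.
Proof.
move=> Ox rho0 B0 kQ H.
rewrite (iter_diff_op_gaussian x0 xi t oO sp k Ox) Normc.normcM normc_gaussian ler_wpM2l ?expR_ge0//.
have sb j : smooth Omega (dgaussian x0 xi t j) := smooth_dgaussian x0 xi t j oO.
rewrite -(jet_norm0 rho).
have := @jet_norm_iter _ _ Omega d rho x Q rho0 (shift_op (dgaussian x0 xi t) d p) B k 0 (fun=> 1)
  (fun f sf => smooth_shift_op oO sb sp sf) B0 H (smooth_cst oO 1) kQ.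
by rewrite (jet_norm_cst oO rho Ox) Normc.normc1 mulr1.
Qed.

Lemma sqnorm_ge x : `|x - x0| ^+ 2 <= sqnorm x0 x.
Proof.
have s0 := sqnorm_ge0 x0 x.
rewrite -[leRHS]sqr_sqrtr//; apply: le_exprn => //; apply: norm_row_le => [|j]; first exact: sqrtr_ge0.
rewrite -sqrtr_sqr ler_wsqrtr// /sqnorm (bigD1 j)//= lerDl.
by apply: sumr_ge0 => i _; exact: sqr_ge0.
Qed.

Lemma compact_dist_bound K : compact K -> exists2 b : R, 0 <= b & forall x, K x -> `|x - x0| <= b.
Proof.
move=> /compact_bounded[M [_ HM]].
exists (`|M| + 1 + `|x0|); first by rewrite !addr_ge0.
move=> x Kx; apply: le_trans (ler_normB _ _) _; rewrite lerD2r.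
by apply: (HM (`|M| + 1) _ x Kx); rewrite ltr_pwDr// ler_norm.
Qed.

(** With a fixed jet radius and the budget kd, differentiation costs O(k) and the shift O(t), so [L]
    is a constant times k + t. The remaining constant [c0 * A] is at least 1 and may be raised to
    the power d as well. *)
Lemma gaussian_crude K : compact K -> K `<=` Omega ->
  exists2 c : R, 1 <= c & forall t k x, 1 <= t -> K x ->
    normc (iter k (diff_op d p) (gaussian x0 xi t) x) <=
    expR (- (t * sqnorm x0 x)) * ((c * (k%:R + t)) ^+ d) ^+ k.
Proof.
move=> cK KO.
have [rho [A [rho0 A1 HA]]] := coefficients_bound cK KO.
have [b b0 Hb] := compact_dist_bound cK.
have dr0 : 0 <= d%:R / rho by rewrite divr_ge0// ltW.
pose Phi := 1 + d%:R / rho + `|xi| + 2 * (b + rho).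
have Phi1 : 1 <= Phi.
  rewrite /Phi -!addrA lerDl !addr_ge0// mulr_ge0// addr_ge0// ltW//.
have cA1 : 1 <= c0 * A by rewrite -[leLHS]mulr1 ler_pM// card_ge1.
exists (c0 * A * Phi); first by rewrite -[leLHS]mulr1 ler_pM.
move=> t k x t1 Kx.
have t0 : 0 <= t := le_trans ler01 t1.
pose L := Phi * (k%:R + t).
have kt1 : 1 <= k%:R + t by apply: le_trans t1 _; rewrite lerDr.
have L1 : 1 <= L by rewrite -[leLHS]mulr1 ler_pM.
have Ox := KO x Kx.
have sb j : smooth Omega (dgaussian x0 xi t j) := smooth_dgaussian x0 xi t j oO.
have hL j : (k * d)%:R / rho + jet_norm rho (k * d) (dgaussian x0 xi t j) x <= L.
  apply: le_trans (_ : k%:R * (d%:R / rho) + t * (`|xi| + 2 * (b + rho)) <= _).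
    rewrite natrM -mulrA lerD2l; apply: le_trans (jet_norm_dgaussian_le _ _ _ t0 rho0) _.
    by rewrite ler_wpM2l// lerD2l ler_wpM2l// lerD2r Hb.
  have p0 : 0 <= 2 * (b + rho) by rewrite mulr_ge0// addr_ge0// ltW.
  have x0' := normr_ge0 xi.
  rewrite /L (mulrDr Phi); apply: lerD; [rewrite [leRHS]mulrC|rewrite [leRHS]mulrC]; apply: ler_wpM2l => //; rewrite /Phi; lra.
have HB f M : smooth Omega f -> (M + d <= k * d)%N ->
    jet_norm rho M (shift_op (dgaussian x0 xi t) d p f) x <= c0 * A * L ^+ d * jet_norm rho (M + d) f x.
  move=> sf MQ; apply: (jet_norm_shift_op oO sb sp rho0 Ox hL L1) sf MQ.
  by move=> a ad; exact: HA.
apply: le_trans (iter_diff_op_gaussian_le Ox rho0 _ (leqnn _) HB) _.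
  by rewrite !mulr_ge0 ?exprn_ge0//; lra.
rewrite ler_wpM2l ?expR_ge0//; apply: le_exprn.
  by rewrite !mulr_ge0 ?exprn_ge0//; lra.
rewrite -(mulrA (c0 * A)) [leRHS]exprMn; apply: ler_wpM2r; first by rewrite exprn_ge0// (le_trans ler01).
by rewrite -[leLHS]expr1 ler_weXn2l.
Qed.

(* Far from x0 (at distance eta) the gaussian factor exp (-t eta^2) is at most eta^k;
   near x0 the symbol is O(eta) t^d. *)
Lemma gaussian_fine K : Omega x0 -> symbol d p x0 xi = 0 -> compact K -> K `<=` Omega ->
  exists c eta0 : R, [/\ 1 <= c, 0 < eta0, eta0 <= 1 & forall eta t k x,
    0 < eta -> eta <= eta0 -> eta^-1 <= t -> k%:R <= eta ^+ 3 * t -> K x ->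
    normc (iter k (diff_op d p) (gaussian x0 xi t) x) <= (c * eta * t ^+ d) ^+ k].
Proof.
move=> Ox0 symb0 cK KO.
have [c1 c11 H1] := gaussian_crude cK KO.
have [rho [A [rho0 rho1 A1 HA]]] := coefficients_local Ox0.
(* [c2 * t] will be the price of a shifted derivative near x0. In [cn] below, 3 + d gathers 1 from
   the lower order terms, 2 from the variation of the coefficients and d from that of the shift. The
   summand (2 c1)^d added to [cn] is for the region away from x0, where k + t <= 2t. *)
pose c2 := d%:R + `|xi| + 4.
have c21 : 1 <= c2 by rewrite /c2; have := normr_ge0 xi; have : 0 <= d%:R :> R by []; lra.
pose cn := c0 * A * (3 + d%:R) * c2 ^+ d.
have cn1 : 1 <= cn.
  rewrite /cn -[leLHS]mulr1; apply: ler_pM => //; last by rewrite exprn_ege1.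
  rewrite -[leLHS]mulr1; apply: ler_pM => //.
    by rewrite -[leLHS]mulr1 ler_pM// card_ge1.
  have : 0 <= d%:R :> R by []; lra.
exists (cn + (c1 * 2) ^+ d), (rho / 2); split.
- by rewrite ler_wpDr// exprn_ge0//; lra.
- by rewrite divr_gt0.
- by lra.
move=> eta t k x eta0 eta_rho eta_t k_t Kx.
have eta1 : eta <= 1 by lra.
have t1 : 1 <= t by apply: le_trans eta_t; rewrite invf_ge1.
have t0 : 0 < t := lt_le_trans ltr01 t1.
have kt : k%:R <= t.
  apply: le_trans k_t _; rewrite ler_piMl ?(ltW t0)//; apply: exprn_ile1 => //; exact: ltW.
have Ox := KO x Kx.
have [far|near_] := leP eta `|x - x0|.
  apply: le_trans (H1 t k x t1 Kx) _.
  apply: le_trans (_ : eta ^+ k * ((c1 * (2 * t)) ^+ d) ^+ k <= _).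
    apply: ler_pM; rewrite ?expR_ge0 ?exprn_ge0//; try lra.
      by apply: mulr_ge0; [lra|rewrite addr_ge0// ltW].
    (* From k <= eta^3 t the exponent t eta^2 is at least k / eta, and exp (1 / eta) >= 1 / eta then
       gives eta^k. *)
    - apply: le_trans (_ : expR (- (t * eta ^+ 2)) <= _).
        rewrite ler_expR lerN2 ler_wpM2l ?(ltW t0)//; apply: le_trans (sqnorm_ge x).
        by apply: le_exprn => //; exact: ltW.
      apply: le_trans (_ : expR (k%:R * - eta^-1) <= _).
        rewrite ler_expR mulrN lerN2 ler_pdivrMr//.
        have -> : t * eta ^+ 2 * eta = eta ^+ 3 * t by ring.
        exact: k_t.
      rewrite mulrC expRM_natr; apply: le_exprn; first exact: expR_ge0.
      rewrite expRN invf_ple ?posrE ?expR_gt0//.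
      by have := expR_ge1Dx eta^-1; lra.
    - apply: le_exprn; first by rewrite exprn_ge0// mulr_ge0 ?addr_ge0 ?(ltW t0)//; lra.
      apply: le_exprn; first by rewrite mulr_ge0 ?addr_ge0 ?(ltW t0)//; lra.
      by apply: ler_wpM2l; lra.
  rewrite -exprMn; apply: le_exprn.
    by rewrite mulr_ge0 ?exprn_ge0//; [exact: ltW|apply: mulr_ge0; lra].
  rewrite [c1 * _]mulrA exprMn mulrA ler_wpM2r ?exprn_ge0 ?(ltW t0)//.
  rewrite mulrC ler_wpM2r ?(ltW eta0)// lerDr; lra.
have sb j : smooth Omega (dgaussian x0 xi t j) := smooth_dgaussian x0 xi t j oO.
have xr : `|x - x0| + eta <= rho by lra.
have xe : `|x - x0| + eta <= 2 * eta by lra.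
(* The jet radius is eta itself. Differentiating within the budget kd then costs no more than the
   variation of the shift over the ball, namely O(eta t). *)
have Qeta : (k * d)%:R / eta <= d%:R * eta * t.
  rewrite ler_pdivrMr// natrM mulrC -!mulrA ler_wpM2l//.
  apply: le_trans k_t _; rewrite !exprS expr0 mulr1 -mulrA ler_wpM2l ?(ltW eta0)//.
  by rewrite mulrC ler_wpM2l ?(ltW t0)// ler_piMl// ltW.
pose L := c2 * t.
have L1 : 1 <= L by rewrite -[leLHS]mulr1 ler_pM.
have L0 : 0 < L := lt_le_trans ltr01 L1.
have dt : d%:R * eta * t <= d%:R * t.
  by rewrite -mulrA ler_wpM2l// ler_piMl// ltW.
have hL j : (k * d)%:R / eta + jet_norm eta (k * d) (dgaussian x0 xi t j) x <= L.
  have := jet_norm_dgaussian_le (k * d) j x (ltW t0) eta0.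
  have : t * (`|xi| + 2 * (`|x - x0| + eta)) <= t * (`|xi| + 4).
    by rewrite ler_wpM2l ?(ltW t0)// lerD2l; lra.
  have -> : L = d%:R * t + t * (`|xi| + 4) by rewrite /L /c2; ring.
  lra.
pose eps := (d%:R + 4) * eta * t.
have heps j : (k * d)%:R / eta + jet_norm eta (k * d) (fun y => dgaussian x0 xi t j y - (t * xi 0 j)%:C) x <= eps.
  have := jet_norm_dgaussian (k * d) j x (ltW t0) eta0.
  have : 2 * t * (`|x - x0| + eta) <= 2 * t * (2 * eta).
    by rewrite ler_wpM2l// mulr_ge0// ltW.
  rewrite /eps !mulrDl; lra.
have eps0 : 0 <= eps by rewrite /eps !mulr_ge0 ?(ltW t0) ?(ltW eta0)// addr_ge0.
pose beta := A * (2 * eta).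
have beta0 : 0 <= beta by rewrite /beta !mulr_ge0 ?(ltW eta0)//; lra.
have hz j : normc (t * xi 0 j)%:C <= L.
  rewrite normc_real normrM (ger0_norm (ltW t0)) mulrC ler_wpM2r ?(ltW t0)//.
  by apply: le_trans (norm_coord_le xi j) _; rewrite /c2; have : 0 <= d%:R :> R by []; lra.
have hq a : mdeg a = d -> jet_norm eta (k * d) (fun y => p a y - p a x0) x <= beta.
  move=> ad; have [_] := HA a x (k * d)%N eta (eq_leq ad) eta0 xr.
  by move/le_trans; apply; rewrite ler_wpM2l//; lra.
have hqA a : mdeg a = d -> normc (p a x0) <= A.
  move=> ad; have [] := HA a x0 0%N eta (eq_leq ad) eta0.
    by rewrite subrr normr0 add0r; lra.
  by rewrite jet_norm0.
have hsymb : \sum_(a : {ffun 'I_n -> 'I_d.+1} | mdeg (mval a) == d)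
    p (mval a) x0 * \prod_(j < n) (t * xi 0 j)%:C ^+ mval a j = 0.
  transitivity ((t ^+ d)%:C * symbol d p x0 xi); last by rewrite symb0 mulr0.
  rewrite /symbol mulr_sumr; apply: eq_bigr => a /eqP ad.
  rewrite mulrCA; congr (_ * _); rewrite -rmorphM.
  have -> : t ^+ d * mpow xi (mval a) = \prod_(j < n) (t * xi 0 j) ^+ mval a j.
    by rewrite prod_mpow ad.
  by rewrite rmorph_prod; apply: eq_bigr => j _; rewrite rmorphXn.
have hA a : (mdeg a <= d)%N -> jet_norm eta (k * d) (p a) x <= A.
  by move=> ad; exact: (HA a x (k * d)%N eta ad eta0 xr).1.
have HB f M : smooth Omega f -> (M + d <= k * d)%N ->
    jet_norm eta M (shift_op (dgaussian x0 xi t) d p f) x <= cn * eta * t ^+ d * jet_norm eta (M + d) f x.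
  move=> sf MQ.
  have := @jet_norm_shift_op_fine _ _ Omega oO _ d p sb sp eta x (k * d) L A eta0 Ox hL L1 hA
    (fun j => (t * xi 0 j)%:C) (fun a => p a x0) eps beta eps0 beta0 heps hz hq hqA hsymb f M d0 sf MQ.
  rewrite -ler_pdivlMl//; move/le_trans; apply.
  rewrite [leLHS]mulrA; apply: ler_wpM2r; first exact: jet_norm_ge0.
  have -> : L^-1 * (c0 * (A + L * beta + A * d%:R * eps) * L ^+ d) =
     c0 * (A / L + beta + A * d%:R * (eps / L)) * L ^+ d.
    by field; rewrite gt_eqF.
  apply: le_trans (_ : c0 * (A * eta + A * (2 * eta) + A * d%:R * eta) * L ^+ d <= _); last first.
    rewrite /L exprMn /cn le_eqVlt; apply/orP; left; apply/eqP; ring.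
  rewrite ler_wpM2r ?exprn_ge0 ?(ltW L0)// ler_wpM2l ?ler0n//.
  (* Here 1 / eta <= t is used: lower order terms are smaller by 1 / L, hence also O(eta) relative
     to t^d. *)
  have h1 : L^-1 <= eta.
    rewrite invf_ple ?posrE//; apply: le_trans eta_t _; rewrite /L ler_peMl// ltW//.
  have h2 : eps / L <= eta.
    rewrite ler_pdivrMr// /eps /L mulrA ler_wpM2r ?(ltW t0)// mulrC ler_wpM2l ?(ltW eta0)//.
    by rewrite /c2; have := normr_ge0 xi; lra.
  have A0 : 0 <= A := le_trans ler01 A1.
  apply: lerD; first by apply: lerD => //; rewrite ler_wpM2l.
  by rewrite ler_wpM2l// mulr_ge0.
have cnt0 : 0 <= cn * eta * t ^+ d.
  apply: mulr_ge0; last by rewrite exprn_ge0// ltW.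
  by apply: mulr_ge0; [exact: le_trans ler01 cn1|exact: ltW].
apply: le_trans (iter_diff_op_gaussian_le Ox eta0 _ (leqnn _) HB) _.
  exact: cnt0.
apply: le_trans (_ : (cn * eta * t ^+ d) ^+ k <= _).
  rewrite ler_piMl//; first exact: exprn_ge0.
  by rewrite -expR0 ler_expR oppr_le0 mulr_ge0 ?(ltW t0)// sqnorm_ge0.
apply: le_exprn.
  exact: cnt0.
apply: ler_wpM2r; first by rewrite exprn_ge0// ltW.
apply: ler_wpM2r; first exact: ltW.
by rewrite lerDl exprn_ge0// mulr_ge0// (le_trans ler01).
Qed.

End estimates.

(** * Weight sequences *)

Section weights.
Context {R : realType}.
Variable M : nat -> R.
Hypothesis wM : weight_sequence M.

(* This is mu_(k+1) in the usual indexing M_k = mu_1 ... mu_k. *)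
Definition mu k : R := M k.+1 / M k.

Lemma M_gt0 k : 0 < M k. Proof. by case: wM. Qed.
Lemma mu_gt0 k : 0 < mu k. Proof. by rewrite divr_gt0// M_gt0. Qed.
Lemma M_S k : M k.+1 = M k * mu k.
Proof. by rewrite /mu mulrC divfK// gt_eqF// M_gt0. Qed.
Lemma mu_nondecreasing : {homo mu : i j / (i <= j)%N >-> i <= j}.
Proof. by apply: homo_leq => //; [exact: le_trans|case: wM]. Qed.

(** By log-convexity [M k / mu m ^+ k] is smallest at k = m: passing from k to k + 1 multiplies it
    by [mu k / mu m], which is at most 1 before m and at least 1 from m on. *)
Lemma M_mu_le m k : M m * mu m ^+ k <= M k * mu m ^+ m.
Proof.
have [mk|/ltnW km] := leqP m k.
  rewrite -(subnKC mk); elim: (k - m)%N => [|i IH]; first by rewrite addn0.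
  rewrite addnS exprSr mulrA M_S [leRHS]mulrAC; apply: ler_pM => //.
  - by rewrite mulr_ge0 ?exprn_ge0// ltW ?M_gt0 ?mu_gt0.
  - by rewrite ltW ?mu_gt0.
  - by apply: mu_nondecreasing; rewrite leq_addr.
have aux i : (k + i <= m)%N -> M (k + i)%N <= M k * mu m ^+ i.
  elim: i => [|i IH] im; first by rewrite addn0 expr0 mulr1.
  rewrite addnS exprSr mulrA M_S; apply: ler_pM; rewrite ?(ltW (M_gt0 _)) ?(ltW (mu_gt0 _))//.
    by apply: IH; lia.
  by apply: mu_nondecreasing; lia.
have -> : mu m ^+ m = mu m ^+ (m - k) * mu m ^+ k by rewrite -exprD subnK.
rewrite mulrA; apply: ler_wpM2r; first by rewrite exprn_ge0// ltW ?mu_gt0.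
by have := aux (m - k)%N; rewrite subnKC//; apply.
Qed.

Lemma pow_le_fact_exp (x : R) m : 0 <= x -> x ^+ m <= m`!%:R * expR x.
Proof.
move=> x0; case: m => [|m].
  by rewrite expr0 fact0 mul1r -expR0 ler_expR.
have f0 : 0 < (m.+1)`!%:R :> R by rewrite ltr0n fact_gt0.
have := expR_ge1Dxn m x0.
by move=> h; rewrite mulrC -ler_pdivrMr//; lra.
Qed.

Hypothesis nqM : strongly_nonquasianalytic M.

Lemma nonquasianalytic : cvgn (series (fun k => (mu k)^-1)).
Proof.
have [A /(_ 0%N) H] := nqM.
apply: nondecreasing_is_cvgn.
  by apply: nondecreasing_series => i _ _; rewrite invr_ge0 ltW ?mu_gt0.
exists (A * 1%:R * (M 0 / M 1)) => _ [J _ <-].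
rewrite -lee_fin; apply: le_trans H.
apply: le_trans (_ : (\sum_(1 <= k < J.+1) (M k.-1 / M k)%:E <= _)%E); last first.
  by apply: nneseries_lim_ge => k _; rewrite lee_fin divr_ge0// ltW ?M_gt0.
rewrite big_add1/= sumEFin lee_fin /series/=; apply: ler_sum => k _.
by rewrite /mu invf_div.
Qed.

(** As [mu] is nondecreasing, (k + 1 - N) / mu_k is at most the tail from N of the convergent series
    of the 1 / mu_i. For k >= 2N + 1 one has k + 1 <= 3 (k + 1 - N), whence the threshold 1 /
    (3W). *)
Lemma mu_superlinear (W : R) : exists N, forall k, (N <= k)%N -> W * k.+1%:R <= mu k.
Proof.
have [W0|W0] := leP W 0.
  by exists 0%N => k _; apply: le_trans (ltW (mu_gt0 k)); rewrite mulr_le0_ge0.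
have cs := nonquasianalytic; have s0 i : 0 <= (mu i)^-1 by rewrite invr_ge0 ltW ?mu_gt0.
have e0 : 0 < (3 * W)^-1 by rewrite invr_gt0 mulr_gt0.
have := series_tail_cvg0 cs => /cvgrPdist_lt/(_ _ e0)[N _ /(_ N (leqnn _))].
rewrite sub0r normrN => hN; have {hN} := le_lt_trans (ler_norm _) hN.
set l := limn _ => hN.
exists (2 * N + 1)%N => k Nk.
have h1 : (k.+1 - N)%:R * (mu k)^-1 <= (3 * W)^-1.
  apply: le_trans (ltW hN); apply: le_trans (_ : \sum_(N <= i < k.+1) (mu i)^-1 <= _); last first.
    have Nk' : (N <= k.+1)%N by lia.
    rewrite -(sub_series_geq _ Nk') lerD2r; exact: (series_le_lim s0 cs).
  rewrite mulr_natl -sumr_const_nat.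
  rewrite big_nat_cond [leRHS]big_nat_cond; apply: ler_sum => i; rewrite andbT => /andP[_ ik].
  by rewrite lef_pV2 ?posrE ?mu_gt0//; exact: mu_nondecreasing.
have h2 : W * (3 * (k.+1 - N)%:R) <= mu k.
  move: h1; rewrite ler_pdivrMr ?mu_gt0// -ler_pdivrMl ?invr_gt0 ?mulr_gt0// invrK.
  by apply: le_trans; rewrite mulrA [W * 3]mulrC.
apply: le_trans h2; rewrite ler_wpM2l ?(ltW W0)// -natrM ler_nat; lia.
Qed.

(** Multiplying the bounds mu_k >= V (k + 1) gives M_q >= c V^q q!. In V = 2 e W, the factor e turns
    q! into q^q and the factor 2 absorbs the constant c for large q. *)
Lemma M_superfactorial (W : R) : 0 < W -> exists Q, forall q, (Q <= q)%N -> (W * q%:R) ^+ q <= M q.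
Proof.
move=> W0.
pose V := 2 * expR 1 * W.
have V0 : 0 < V by rewrite !mulr_gt0 ?expR_gt0.
have [N HN] := mu_superlinear V.
pose c := M N / (V ^+ N * N`!%:R).
have f0 k : 0 < k`!%:R :> R by rewrite ltr0n fact_gt0.
have c0 : 0 < c by rewrite divr_gt0 ?M_gt0// mulr_gt0 ?exprn_gt0.
have h1 q : (N <= q)%N -> c * (V ^+ q * q`!%:R) <= M q.
  move=> /subnKC <-; elim: (q - N)%N => [|i IH].
    by rewrite addn0 divfK// gt_eqF// mulr_gt0 ?exprn_gt0.
  rewrite addnS exprSr factS natrM M_S.
  have -> : c * (V ^+ (N + i) * V * ((N + i).+1%:R * (N + i)`!%:R)) =
    c * (V ^+ (N + i) * (N + i)`!%:R) * (V * (N + i).+1%:R) by ring.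
  apply: ler_pM => //.
  - by rewrite mulr_ge0 ?(ltW c0)// mulr_ge0 ?exprn_ge0 ?(ltW V0).
  - by rewrite mulr_ge0// ltW.
  - by apply: HN; rewrite leq_addr.
have [K HK] : exists K, forall q, (K <= q)%N -> c^-1 <= 2 ^+ q.
  have c'0 : 0 <= c^-1 by rewrite invr_ge0 ltW.
  exists (Num.bound c^-1) => q Kq.
  apply: le_trans (ltW (archi_boundP c'0)) _.
  rewrite -natrX ler_nat; apply: leq_trans Kq _; exact/ltnW/ltn_expl.
exists (maxn N K) => q; rewrite geq_max => /andP[Nq Kq].
apply: le_trans (h1 q Nq).
have h2 : q%:R ^+ q <= q`!%:R * expR 1 ^+ q :> R.
  by rewrite -expRM_natl mulr1; apply: pow_le_fact_exp.
rewrite exprMn; apply: le_trans (_ : W ^+ q * (q`!%:R * expR 1 ^+ q) <= _).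
  by rewrite ler_wpM2l// exprn_ge0// ltW.
have -> : c * (V ^+ q * q`!%:R) = (c * 2 ^+ q) * (W ^+ q * (q`!%:R * expR 1 ^+ q)).
  by rewrite /V !exprMn; ring.
rewrite ler_peMl//; last by rewrite -ler_pdivrMl// mulr1 HK.
by rewrite !mulr_ge0 ?exprn_ge0 ?expR_ge0// ltW.
Qed.

Lemma M_dominates d (c t h : R) : (0 < d)%N -> 0 < c -> 0 <= t -> 0 < h ->
  exists2 A : R, 0 <= A & forall k, ((c * (k%:R + t)) ^+ d) ^+ k <= A * h ^+ k * M (d * k).
Proof.
move=> d0 c0 t0 h0.
(* Capped at 1 so that e^(dk) <= e^k <= h^k: the weight has index dk but h only the exponent k. *)
pose e := Num.min h 1.
have e0 : 0 < e by rewrite lt_min h0 ltr01.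
have [|Q HQ] := @M_superfactorial (c * (1 + t) / e).
  by rewrite divr_gt0// mulr_gt0// ltr_wpDr.
have F0 k : 0 <= ((c * (k%:R + t)) ^+ d) ^+ k / (h ^+ k * M (d * k)).
  by rewrite divr_ge0 ?exprn_ge0 ?mulr_ge0 ?exprn_ge0 ?addr_ge0// ltW// M_gt0.
(* The finitely many k below the threshold are covered by the sum of their own ratios; beyond it the
   constant 1 is enough. *)
pose S := \sum_(k < Q.+1) ((c * (k%:R + t)) ^+ d) ^+ k / (h ^+ k * M (d * k)).
have S0 : 0 <= S by apply: sumr_ge0.
exists (1 + S); first by rewrite addr_ge0.
move=> k; rewrite -mulrA -ler_pdivrMr ?mulr_gt0 ?exprn_gt0 ?M_gt0//.
have [kQ|Qk] := leqP k Q.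
  rewrite -[leLHS]add0r; apply: lerD => //.
  have kQ' : (k < Q.+1)%N by [].
  rewrite /S (bigD1 (Ordinal kQ'))//= lerDl; apply: sumr_ge0 => i _; exact: F0.
rewrite -[leLHS]addr0; apply: lerD => //.
rewrite ler_pdivrMr ?mulr_gt0 ?exprn_gt0 ?M_gt0// mul1r.
have Qdk : (Q <= d * k)%N by apply: leq_trans (ltnW Qk) _; rewrite leq_pmull.
apply: le_trans (_ : h ^+ k * (c * (1 + t) / e * (d * k)%:R) ^+ (d * k) <= _); last first.
  by apply: ler_wpM2l; [rewrite exprn_ge0// ltW|exact: HQ].
rewrite -exprM; have -> : (c * (1 + t) / e * (d * k)%:R) ^+ (d * k) =
   (e^-1) ^+ (d * k) * (c * (1 + t) * (d * k)%:R) ^+ (d * k).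
  by rewrite -exprMn; congr (_ ^+ _); ring.
rewrite mulrA -[leLHS]mul1r; apply: ler_pM => //.
- by rewrite exprn_ge0// mulr_ge0 ?addr_ge0// ltW.
- apply: le_trans (_ : e ^+ k * e^-1 ^+ (d * k) <= _).
    rewrite -(subnKC (_ : k <= d * k)%N) ?leq_pmull// exprD mulrA -exprMn mulfV ?gt_eqF//.
    by rewrite expr1n mul1r exprn_ege1// invf_ge1// ge_min lexx orbT.
  rewrite ler_wpM2r ?exprn_ge0 ?invr_ge0 ?(ltW e0)//; apply: le_exprn; first exact: ltW.
  by rewrite /e ge_min lexx.
apply: le_exprn; first by rewrite mulr_ge0 ?addr_ge0// ltW.
rewrite -mulrA ler_wpM2l ?(ltW c0)// mulrDl mul1r; apply: lerD.
  by rewrite ler_nat leq_pmull.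
rewrite ler_peMr// ler1n muln_gt0 d0/=; exact: leq_ltn_trans Qk.
Qed.

End weights.

(** * The witness *)

Section linear.
Context {R : realType} {n : nat}.
Local Notation E := 'rV[R]_n.
Local Notation C := R[i].
Local Notation normc := (@Normc.normc R).
Local Notation D := (@Dj R n).
Variables (U : set E) (d : nat) (p : multi n -> E -> C).
Hypothesis oU : open U.
Hypothesis sp : forall a, (mdeg a <= d)%N -> smooth U (p a).
Local Opaque smooth Dj C1_at derive derivable.

Let s0 (j : 'I_n) : smooth U ((fun=> fun=> 0) j : E -> C) := smooth_cst oU 0.

Lemma smooth_iter_diff_op k (f : E -> C) : smooth U f -> smooth U (iter k (diff_op d p) f).
Proof. exact: (smooth_iter_shift_op oU s0 sp k). Qed.

Lemma eq_iter_diff_op k (f g : E -> C) : (forall y, U y -> f y = g y) ->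
  forall y, U y -> iter k (diff_op d p) f y = iter k (diff_op d p) g y.
Proof.
move=> fg; elim: k => [|k IH] y Uy; first exact: fg.
exact: (eq_shift_op oU d p IH s0).
Qed.

Lemma iter_diff_op_lin k (c : C) (f g : E -> C) x : smooth U f -> smooth U g -> U x ->
  iter k (diff_op d p) (fun y => f y + c * g y) x =
  iter k (diff_op d p) f x + c * iter k (diff_op d p) g x.
Proof.
move=> sf sg; elim: k x => // k IH x Ux; rewrite !iterS.
transitivity (diff_op d p (fun y => iter k (diff_op d p) f y + c * iter k (diff_op d p) g y) x).
  exact: (eq_shift_op oU d p IH s0).
have sF := smooth_iter_diff_op k sf; have sG := smooth_iter_diff_op k sg.
rewrite /diff_op /shift_op /multi_sum mulr_sumr -big_split/=; apply: eq_bigr => a _.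
rewrite !foldr_shift_Dj0 (foldr_DjD oU _ sF (smoothZ oU c sG) Ux).
by rewrite (foldr_DjZ oU c _ sG Ux); ring.
Qed.

Lemma iter_diff_opZ k (c : C) (f : E -> C) x : smooth U f -> U x ->
  iter k (diff_op d p) (fun y => c * f y) x = c * iter k (diff_op d p) f x.
Proof.
move=> sf; elim: k x => // k IH x Ux; rewrite !iterS.
transitivity (diff_op d p (fun y => c * iter k (diff_op d p) f y) x).
  exact: (eq_shift_op oU d p IH s0).
have sF := smooth_iter_diff_op k sf.
rewrite /diff_op /shift_op /multi_sum mulr_sumr; apply: eq_bigr => a _.
by rewrite !foldr_shift_Dj0 (foldr_DjZ oU c _ sF Ux); ring.
Qed.

(** P^k of the remainder at x is at most [B ^+ k] times a jet norm of the remainder of order kd,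
    which tends to zero. The constants may depend on x and k. *)
Lemma diff_op_csum k (g : nat -> E -> C) (u : E -> C) x :
  (forall i, smooth U (g i)) -> smooth U u ->
  (forall s y, U y -> csum (fun i => foldr D (g i) s y) (foldr D u s y)) ->
  (exists rho A : R, 0 < rho /\ forall a N, (mdeg a <= d)%N -> jet_norm rho N (p a) x <= A) ->
  U x -> csum (fun i => iter k (diff_op d p) (g i) x) (iter k (diff_op d p) u x).
Proof.
move=> sg su gu [rho [A [rho0 HA]]] Ux.
have st J := smooth_tail oU sg su J.
have tE J : iter k (diff_op d p) (tail_fun g u J) x =
    iter k (diff_op d p) u x - \sum_(0 <= i < J) iter k (diff_op d p) (g i) x.
  elim: J => [|J IH].
    rewrite (@eq_iter_diff_op k _ u) ?big_geq ?subr0// => y _.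
    by rewrite /tail_fun big_geq// subr0.
  rewrite (@eq_iter_diff_op k _ (fun y => tail_fun g u J y + (-1) * g J y))//; last first.
    by move=> y _; rewrite /tail_fun big_nat_recr//=; ring.
  by rewrite (iter_diff_op_lin k _ (st J) (sg J) Ux) IH big_nat_recr//=; ring.
pose L := (k * d)%:R / rho + 1.
have L1 : 1 <= L by rewrite /L lerDr divr_ge0// ltW.
have hL (j : 'I_n) : (k * d)%:R / rho + jet_norm rho (k * d) (fun=> 0 : C) x <= L.
  by rewrite (jet_norm_cst oU rho Ux) Normc.normc0 /L lerD2l ler01.
pose B := #|{: {ffun 'I_n -> 'I_d.+1}}|%:R * A * L ^+ d.
have A0 : 0 <= A.
  have a0 : (mdeg ([ffun=> 0%N] : multi n) <= d)%N.
    by rewrite /mdeg big1// => i _; rewrite ffunE.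
  exact: le_trans (jet_norm_ge0 x rho0 0 _) (HA _ 0%N a0).
have B0 : 0 <= B by rewrite !mulr_ge0 ?exprn_ge0// (le_trans ler01).
have HB f M : smooth U f -> (M + d <= k * d)%N ->
    jet_norm rho M (diff_op d p f) x <= B * jet_norm rho (M + d) f x.
  move=> sf MQ; apply: (jet_norm_shift_op oU s0 sp rho0 Ux hL L1) sf MQ.
  by move=> a ad; exact: HA.
have est J : normc (iter k (diff_op d p) u x - \sum_(0 <= i < J) iter k (diff_op d p) (g i) x) <=
    B ^+ k * jet_norm rho (k * d) (tail_fun g u J) x.
  rewrite -tE -(jet_norm0 rho).
  exact: (@jet_norm_iter _ _ U d rho x (k * d) rho0 (diff_op d p) B k 0 _
    (fun f => smooth_shift_op oU s0 sp (g := f)) B0 HB (st J) (leqnn _)).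
apply: (@squeeze_cvgr _ _ _ _ (fun=> 0) (fun J => B ^+ k * jet_norm rho (k * d) (tail_fun g u J) x)).
- by apply: nearW => J; rewrite normc_ge0 est.
- exact: cvg_cst.
- rewrite -[X in _ --> X](mulr0 (B ^+ k)); apply: cvgMr.
  exact: (jet_norm_tail_cvg0 oU sg su gu Ux).
Qed.

End linear.

Section csum_facts.
Context {R : realType}.
Local Notation C := R[i].
Local Notation normc := (@Normc.normc R).

Lemma csum_le (g : nat -> C) (l : C) (B : R) : csum g l ->
  (forall J, \sum_(0 <= i < J) normc (g i) <= B) -> normc l <= B.
Proof.
move=> gl gB.
apply: (cvgr_to_ge (F := \oo) (f := fun J => B + normc (l - \sum_(0 <= i < J) g i))).
  by rewrite -[X in _ --> X]addr0; apply: cvgD; [exact: cvg_cst|exact: gl].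
apply: nearW => J.
rewrite -[X in normc X <= _](subrK (\sum_(0 <= i < J) g i)) addrC.
apply: le_trans (normcD _ _) _; rewrite lerD2r.
by apply: le_trans (normc_sum _ _ _) _.
Qed.

Lemma csum_real_ge (b : nat -> R) (l : C) i : csum (fun k => (b k)%:C) l ->
  (forall k, 0 <= b k) -> b i <= normc l.
Proof.
move=> /csumP[/= cr _] b0; apply: le_trans (normRe l); apply: le_trans (ler_norm _).
have cb : cvgn (series b) by apply/cvg_ex; exists (complex.Re l).
have -> : complex.Re l = limn (series b) by apply/esym/cvg_lim.
apply: le_trans (series_le_lim b0 cb i.+1); rewrite big_nat_recr//= lerDr.
exact: sumr_ge0.
Qed.

End csum_facts.

Section construction.
Context {R : realType} {n : nat}.
Local Notation E := 'rV[R]_n.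
Local Notation C := R[i].
Local Notation normc := (@Normc.normc R).
Local Notation D := (@Dj R n).
Implicit Types (K : set E) (x : E).
Variables (Omega : set E) (d : nat) (p : multi n -> E -> C) (M : nat -> R).
Hypothesis oO : open Omega.
Hypothesis d0 : (0 < d)%N.
Hypothesis ap : forall a, (mdeg a <= d)%N -> analytic Omega (p a).
Hypothesis wM : weight_sequence M.
Hypothesis nqM : strongly_nonquasianalytic M.
Variables (x0 xi : E) (l : 'I_n).
Hypothesis Ox0 : Omega x0.
Hypothesis symb0 : symbol d p x0 xi = 0.
Hypothesis xil : xi 0 l = 1.
Local Opaque smooth Dj C1_at derive derivable gaussian mu.

Let sp a : (mdeg a <= d)%N -> smooth Omega (p a).
Proof. by move=> /ap; exact: analytic_smooth. Qed.

Local Notation nJ j := (j.+1%:R : R).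
(** The eta used for packet j. The exponent d + 1 exceeds by one the power (j+1)^d that the
    frequency brings in at each application of P. [ratio] is its cube: k <= [ratio j] times the
    frequency is the range of the fine estimate. *)
Definition radius j : R := (nJ j)^-1 ^+ d.+1.
Definition ratio j : R := radius j ^+ 3.
(** Beyond the fine range k + t <= (1 + 1 / [ratio j]) dk. The additional factor j + 1 is kept in
    order to leave (c / (j+1))^(dk) in the crude estimate. *)
Definition growth j : R := nJ j * (1 + (ratio j)^-1).

Lemma radius_gt0 j : 0 < radius j.
Proof. by rewrite exprn_gt0// invr_gt0. Qed.
Lemma ratio_gt0 j : 0 < ratio j.
Proof. by rewrite exprn_gt0// radius_gt0. Qed.

Lemma index_exists : exists m : nat -> nat, forall j,
  [/\ (j < m j)%N, (radius j)^-1 <= nJ j * mu M (m j), 1 <= nJ j * mu M (m j) &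
    forall q : nat, ratio j * (nJ j * mu M (m j)) <= q%:R -> (growth j * q%:R) ^+ q <= M q].
Proof.
suff /choice[m Hm] : forall j, exists m, [/\ (j < m)%N, (radius j)^-1 <= nJ j * mu M m, 1 <= nJ j * mu M m &
    forall q : nat, ratio j * (nJ j * mu M m) <= q%:R -> (growth j * q%:R) ^+ q <= M q].
  by exists m.
move=> j.
have w0 : 0 < growth j by rewrite mulr_gt0// ltr_wpDr// invr_ge0 ltW// ratio_gt0.
have [Q HQ] := M_superfactorial wM nqM w0.
(* One summand per requirement on mu_m; the last one forces every q in the final clause to be at
   least the threshold [Q]. *)
pose B := (radius j)^-1 + 1 + Q%:R / ratio j.
have [_ _ _ _ /cvgryPge/(_ B)[N _ HN]] := wM.
exists (maxn N j.+1); set m := maxn N j.+1.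
have mB : B <= mu M m by apply: HN; rewrite /= leq_maxl.
have e0 : 0 <= (radius j)^-1 by rewrite invr_ge0 ltW// radius_gt0.
have Q0 : 0 <= Q%:R / ratio j by rewrite divr_ge0// ltW// ratio_gt0.
have mJ : mu M m <= nJ j * mu M m.
  by rewrite ler_peMl ?(ltW (mu_gt0 wM _))// ler1n.
rewrite /B in mB.
split; [by rewrite leq_max leqnn orbT| | |]; try lra.
move=> q qQ; apply: HQ; rewrite -(ler_nat R); apply: le_trans qQ.
rewrite mulrC -ler_pdivrMr ?ratio_gt0//; lra.
Qed.

Lemma series_exp_cvg : cvgn (series (fun j => expR (- nJ j) : R)).
Proof.
have -> : (fun j => expR (- nJ j) : R) = geometric (expR (-1)) (expR (-1)).
  by apply/funext => j; rewrite /geometric/= -exprS -expRM_natl mulrN1.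
by apply: is_cvg_geometric_series; rewrite ger0_norm ?expR_ge0// -expR0 ltr_expR oppr_lt0.
Qed.

Lemma order_norm_words m (f : E -> C) x (B : R) : 0 <= B ->
  (forall s, size s = m -> normc (foldr D f s x) <= B) -> order_norm m f x <= n%:R ^+ m * B.
Proof.
move=> B0; elim: m f => [|m IH] f H /=.
  by rewrite expr0 mul1r; exact: (H [::]).
apply: le_trans (_ : \sum_(j < n) (n%:R ^+ m * B) <= _); last first.
  by rewrite sumr_const card_ord -[leLHS]mulr_natl exprS mulrA.
apply: ler_sum => j _; apply: IH => s sm.
by have := H (rcons s j); rewrite size_rcons foldr_rcons sm; apply.
Qed.

(** The conjugation with jet radius 1 and a budget of m derivatives, the gaussian factor being at
    most 1. No operator occurs here; the bound is for the smoothness of the sum. *)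
Lemma order_norm_gaussian m (t b : R) x : 1 <= t -> 0 <= b -> `|x - x0| <= b ->
  order_norm m (gaussian x0 xi t) x <=
  n%:R ^+ m * (((m%:R + 1 + `|xi| + 2 * (b + 1)) * t) ^+ m).
Proof.
move=> t1 b0 xb; have t0 : 0 < t := lt_le_trans ltr01 t1.
set L := _ * t.
have P1 : 1 <= m%:R + 1 + `|xi| + 2 * (b + 1).
  have := normr_ge0 xi; have : 0 <= m%:R :> R by []; lra.
have L1 : 1 <= L by rewrite -[leLHS]mulr1 ler_pM.
have sb j : smooth setT (dgaussian x0 xi t j) := smooth_dgaussian x0 xi t j openT.
have hL j : m%:R / 1 + jet_norm 1 m (dgaussian x0 xi t j) x <= L.
  rewrite divr1; have := jet_norm_dgaussian_le x0 xi m j x (ltW t0) ltr01.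
  have : t * (`|xi| + 2 * (`|x - x0| + 1)) <= t * (`|xi| + 2 * (b + 1)).
    by rewrite ler_wpM2l ?(ltW t0)//; lra.
  have : m%:R <= t * (m%:R + 1).
    by apply: le_trans (_ : 1 * (m%:R + 1) <= _); [rewrite mul1r lerDl|rewrite ler_wpM2r// addr_ge0].
  have -> : L = t * (m%:R + 1) + t * (`|xi| + 2 * (b + 1)) by rewrite /L; ring.
  lra.
apply: order_norm_words => [|s sm]; first by rewrite exprn_ge0//; lra.
have e : foldr D (gaussian x0 xi t) s x = gaussian x0 xi t x * foldr (shift_Dj (dgaussian x0 xi t)) (fun=> 1) s x.
  rewrite -(foldr_Dj_gaussian x0 xi t openT s (smooth_cst openT 1) I).
  by apply: (eq_foldr_Dj s openT _ I) => y _; rewrite mulr1.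
rewrite e Normc.normcM normc_gaussian -[leRHS]mul1r; apply: ler_pM.
- exact: expR_ge0.
- exact: normc_ge0.
- by rewrite -expR0 ler_expR oppr_le0 mulr_ge0 ?(ltW t0)// sqnorm_ge0.
rewrite -(jet_norm0 1) -sm; apply: le_trans (@jet_norm_shift_Djs _ _ setT openT _ sb 1 x m L ltr01 I hL L1 0 s (fun=> 1) (smooth_cst openT 1) _) _.
  by rewrite sm.
by rewrite (jet_norm_cst openT 1 I) Normc.normc1 mulr1.
Qed.

Section witness.
Variable m : nat -> nat.
Hypothesis Hm : forall j,
  [/\ (j < m j)%N, (radius j)^-1 <= nJ j * mu M (m j), 1 <= nJ j * mu M (m j) &
    forall q : nat, ratio j * (nJ j * mu M (m j)) <= q%:R -> (growth j * q%:R) ^+ q <= M q].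

(* The factor M_m / mu_m^m is the largest that keeps ampl * freq^k below a multiple
   of M_k for every k; equality at k = m is what makes the sum fail to be Roumieu. *)
Definition freq j : R := nJ j * mu M (m j).
Definition ampl j : R := expR (- (2 * nJ j)) * (M (m j) / mu M (m j) ^+ m j).
Definition packet j : E -> C := fun x => (ampl j)%:C * gaussian x0 xi (freq j) x.

Lemma freq_ge1 j : 1 <= freq j. Proof. by case: (Hm j). Qed.
Lemma freq_gt0 j : 0 < freq j. Proof. exact: lt_le_trans ltr01 (freq_ge1 j). Qed.
Lemma ampl_gt0 j : 0 < ampl j.
Proof.
apply: mulr_gt0; first exact: expR_gt0.
by apply: divr_gt0; [exact: M_gt0|apply: exprn_gt0; exact: mu_gt0].
Qed.

Lemma ampl_freq j k : ampl j * freq j ^+ k =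
  expR (- (2 * nJ j)) * nJ j ^+ k * (M (m j) * mu M (m j) ^+ k / mu M (m j) ^+ m j).
Proof.
have e : freq j ^+ k = nJ j ^+ k * mu M (m j) ^+ k by exact: exprMn.
rewrite /ampl e; move: (mu M (m j) ^+ k) ((mu M (m j) ^+ m j)^-1) (nJ j ^+ k) => a b f.
ring.
Qed.

Lemma ampl_freq_le j k : ampl j * freq j ^+ k <= expR (- (2 * nJ j)) * nJ j ^+ k * M k.
Proof.
rewrite ampl_freq; apply: ler_wpM2l; first by rewrite mulr_ge0 ?expR_ge0 ?exprn_ge0.
by rewrite ler_pdivrMr ?exprn_gt0 ?mu_gt0// M_mu_le.
Qed.

Lemma ampl_freq_m j : ampl j * freq j ^+ m j = expR (- (2 * nJ j)) * nJ j ^+ m j * M (m j).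
Proof. by rewrite ampl_freq mulfK// gt_eqF// exprn_gt0// mu_gt0. Qed.

Lemma ampl_le j : ampl j <= expR (- (2 * nJ j)).
Proof.
by have := ampl_freq_le j 0; rewrite !expr0 !mulr1; have [_ -> _ _ _] := wM; rewrite mulr1.
Qed.

(** Half of the exponential absorbs the power of j + 1, and the other half remains summable. This is
    why [ampl] contains the factor 2. *)
Lemma expR2_pow j k : expR (- (2 * nJ j)) * nJ j ^+ k <= k`!%:R * expR (- nJ j).
Proof.
have -> : - (2 * nJ j) = - nJ j - nJ j by ring.
rewrite expRD -mulrA mulrC ler_wpM2r ?expR_ge0//.
rewrite expRN mulrC ler_pdivrMr ?expR_gt0//; exact: pow_le_fact_exp.
Qed.

Lemma smooth_packet (U : set E) j : open U -> smooth U (packet j).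
Proof. by move=> oU; exact: (smoothZ oU _ (smooth_gaussian x0 xi (freq j) oU)). Qed.

Lemma packet_order_norm (b : R) k j x : 0 <= b -> `|x - x0| <= b ->
  order_norm k (packet j) x <= n%:R ^+ k * (k%:R + 1 + `|xi| + 2 * (b + 1)) ^+ k * M k * k`!%:R * expR (- nJ j).
Proof.
move=> b0 xb; rewrite (order_normZ openT k _ (smooth_gaussian x0 xi (freq j) openT) I).
rewrite normc_real ger0_norm ?(ltW (ampl_gt0 j))//.
apply: le_trans (ler_wpM2l (ltW (ampl_gt0 j)) (order_norm_gaussian k (freq_ge1 j) b0 xb)) _.
set F := _ + _ + _ + _; have F0 : 0 <= F.
  by rewrite /F !addr_ge0// mulr_ge0// addr_ge0.
have -> : ampl j * (n%:R ^+ k * (F * freq j) ^+ k) = n%:R ^+ k * F ^+ k * (ampl j * freq j ^+ k).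
  by rewrite exprMn; ring.
rewrite -[leRHS]mulrA -[leRHS]mulrA; apply: ler_wpM2l; first by rewrite mulr_ge0 ?exprn_ge0.
apply: le_trans (ampl_freq_le j k) _; rewrite mulrC; apply: ler_wpM2l; first exact: (ltW (M_gt0 wM k)).
exact: expR2_pow.
Qed.

(** The majorants are uniform only on balls around x0. The sum is therefore chosen pointwise, and
    termwise differentiation is applied on each ball separately. *)
Lemma witness_smooth : exists u : E -> C, smooth setT u /\
  forall s x, csum (fun i => foldr D (packet i) s x) (foldr D u s x).
Proof.
pose B b k j : R := n%:R ^+ k * (k%:R + 1 + `|xi| + 2 * (b + 1)) ^+ k * M k * k`!%:R * expR (- nJ j).
have cB b k : cvgn (series (B b k)) by apply: is_cvg_seriesZ; exact: series_exp_cvg.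
have /choice[u Hu] : forall x, exists z, csum (fun i => packet i x) z.
  move=> x; apply: (csum_exists (b := B `|x - x0| 0%N)) => // i.
  exact: (packet_order_norm 0 i (normr_ge0 _) (lexx _)).
have main b : 0 <= b -> smooth [set x | `|x - x0| < b] u /\
    forall s x, `|x - x0| < b -> csum (fun i => foldr D (packet i) s x) (foldr D u s x).
  move=> b0; have oV := @open_normball R n x0 b.
  have h1 i : smooth [set x | `|x - x0| < b] (packet i).
    exact: (smooth_packet i oV).
  have h2 k i x : [set x | `|x - x0| < b] x -> order_norm k (packet i) x <= B b k i.
    by move=> /ltW xb; exact: packet_order_norm.
  exact: (termwise_smooth oV h1 h2 (cB b) (fun x _ => Hu x)).
exists u; split.
  apply: smooth_local => x _; exists [set y | `|y - x0| < `|x - x0| + 1] => /=.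
    by rewrite ltrDl.
  by have [] := main (`|x - x0| + 1) (addr_ge0 (normr_ge0 _) ler01).
move=> s x; have [_] := main (`|x - x0| + 1) (addr_ge0 (normr_ge0 _) ler01).
by apply; rewrite ltrDl.
Qed.

Lemma normc_iter_packet k j x : Omega x ->
  normc (iter k (diff_op d p) (packet j) x) = ampl j * normc (iter k (diff_op d p) (gaussian x0 xi (freq j)) x).
Proof.
move=> Ox; rewrite (iter_diff_opZ oO sp k _ (smooth_gaussian x0 xi (freq j) oO) Ox).
by rewrite Normc.normcM normc_real ger0_norm ?(ltW (ampl_gt0 j)).
Qed.

(** For a fixed packet the frequency is a constant, so the crude bound suffices with a constant
    depending on j. This handles the finitely many packets that [packet_fine] leaves out. *)
Lemma packet_crude K (h : R) j : compact K -> K `<=` Omega -> 0 < h ->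
  exists2 A : R, 0 <= A & forall k x, K x ->
    normc (iter k (diff_op d p) (packet j) x) <= A * h ^+ k * M (d * k).
Proof.
move=> cK KO h0.
have [c1 c11 H1] := gaussian_crude oO d0 ap x0 xi cK KO.
have c10 : 0 < c1 := lt_le_trans ltr01 c11.
have [A A0 HA] := M_dominates wM nqM d0 c10 (ltW (freq_gt0 j)) h0.
exists (ampl j * A); first by rewrite mulr_ge0// ltW// ampl_gt0.
move=> k x Kx; rewrite (normc_iter_packet k j (KO x Kx)).
have -> : ampl j * A * h ^+ k * M (d * k) = ampl j * (A * h ^+ k * M (d * k)).
  by move: (ampl j) => a; ring.
apply: ler_wpM2l; first exact/ltW/ampl_gt0.
apply: le_trans (H1 _ k x (freq_ge1 j) Kx) _; apply: le_trans (HA k).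
rewrite ler_piMl//.
  by rewrite !exprn_ge0// mulr_ge0 ?(ltW c10)// addr_ge0// ltW// freq_gt0.
by rewrite -expR0 ler_expR oppr_le0 mulr_ge0 ?(ltW (freq_gt0 _))// sqnorm_ge0.
Qed.

Lemma radius_pow j : radius j * nJ j ^+ d = (nJ j)^-1.
Proof. by rewrite /radius exprS -mulrA -exprMn mulVf ?expr1n ?mulr1// pnatr_eq0. Qed.

Lemma radius_le j : radius j <= (nJ j)^-1.
Proof.
rewrite /radius -[leRHS]expr1; apply: ler_wiXn2l => //.
by rewrite invf_le1 ?ler1n.
Qed.

(** In the fine range [ampl_freq_le] at index dk brings (j+1)^(dk), and the power of [radius] turns
    it into (cf / (j+1))^k. In the other range the last clause of [Hm] applies at q = dk. *)
Lemma packet_fine K (h : R) : compact K -> K `<=` Omega -> 0 < h ->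
  exists j0, forall j, (j0 <= j)%N -> forall k x, K x ->
    normc (iter k (diff_op d p) (packet j) x) <= expR (- nJ j) * h ^+ k * M (d * k).
Proof.
move=> cK KO h0.
have [c1 c11 H1] := gaussian_crude oO d0 ap x0 xi cK KO.
have [cf [eta0 [cf1 eta00 eta01 Hf]]] := gaussian_fine oO d0 ap Ox0 symb0 cK KO.
have c10 : 0 < c1 := lt_le_trans ltr01 c11.
have cf0 : 0 < cf := lt_le_trans ltr01 cf1.
(* Once j + 1 >= Z: cf / (j+1) <= h, c1 / (j+1) <= min h 1, and [radius j <= eta0]. *)
pose Z := cf / h + c1 / h + c1 + eta0^-1.
have z1 : 0 <= cf / h by rewrite divr_ge0 ?ltW.
have z2 : 0 <= c1 / h by rewrite divr_ge0 ?ltW.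
have z3 : 0 <= eta0^-1 by rewrite invr_ge0 ltW.
have Z0 : 0 <= Z by rewrite /Z; lra.
exists (Num.bound Z) => j jZ k x Kx.
have J0 : 0 < nJ j by rewrite ltr0n.
have ZJ : Z <= nJ j.
  apply: le_trans (ltW (archi_boundP Z0)) _; rewrite ler_nat; exact: leqW.
have e2e : expR (- (2 * nJ j)) <= expR (- nJ j) by rewrite ler_expR; lra.
rewrite (normc_iter_packet k j (KO x Kx)).
have MdK : 0 < M (d * k) := M_gt0 wM _.
have [small|large] := leP k%:R (ratio j * freq j).
  have eJ : radius j <= eta0.
    apply: le_trans (radius_le j) _; rewrite invf_ple ?posrE//.
    by apply: le_trans ZJ; rewrite /Z; lra.
  have ef : (radius j)^-1 <= freq j by case: (Hm j).
  have ce0 : 0 <= cf * radius j := mulr_ge0 (ltW cf0) (ltW (radius_gt0 j)).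
  have := Hf (radius j) (freq j) k x (radius_gt0 j) eJ ef small Kx.
  move=> /(ler_wpM2l (ltW (ampl_gt0 j)))/le_trans; apply.
  have -> : ampl j * (cf * radius j * freq j ^+ d) ^+ k = (cf * radius j) ^+ k * (ampl j * freq j ^+ (d * k)).
    by rewrite [(cf * radius j * _) ^+ k]exprMn -exprM; ring.
  apply: le_trans (ler_wpM2l _ (ampl_freq_le j (d * k))) _.
    exact/exprn_ge0/ce0.
  have -> : (cf * radius j) ^+ k * (expR (- (2 * nJ j)) * nJ j ^+ (d * k) * M (d * k)) =
      expR (- (2 * nJ j)) * (cf / nJ j) ^+ k * M (d * k).
    rewrite -radius_pow exprM (mulrA cf) [in RHS]exprMn; move: ((cf * radius j) ^+ k) => a.
    by ring.
  apply: ler_wpM2r; first exact: ltW.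
  apply: ler_pM; rewrite ?expR_ge0 ?exprn_ge0 ?divr_ge0 ?(ltW cf0)//.
  apply: le_exprn; first by rewrite divr_ge0 ?ltW.
  rewrite ler_pdivrMr// mulrC -ler_pdivrMr//; apply: le_trans ZJ; rewrite /Z; lra.
have k0 : (0 < k)%N.
  rewrite lt0n; apply/negP => /eqP k0; move: large; rewrite k0 ltNge mulr_ge0//.
    exact/ltW/ratio_gt0.
  exact/ltW/freq_gt0.
rewrite -mulrA; apply: ler_pM.
- exact/ltW/ampl_gt0.
- exact: normc_ge0.
- exact: le_trans (ampl_le j) e2e.
apply: le_trans (H1 _ k x (freq_ge1 j) Kx) _.
apply: le_trans (_ : ((c1 * (k%:R + freq j)) ^+ d) ^+ k <= _).
  rewrite ler_piMl//.
    by rewrite !exprn_ge0// mulr_ge0 ?(ltW c10)// addr_ge0// ltW// freq_gt0.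
  by rewrite -expR0 ler_expR oppr_le0 mulr_ge0 ?(ltW (freq_gt0 _))// sqnorm_ge0.
have [_ _ _ HM] := Hm j.
have dk : ratio j * (nJ j * mu M (m j)) <= (d * k)%:R.
  by apply: le_trans (ltW large) _; rewrite ler_nat leq_pmull.
apply: le_trans (_ : h ^+ k * (growth j * (d * k)%:R) ^+ (d * k) <= _); last first.
  by apply: ler_wpM2l; [rewrite exprn_ge0// ltW|exact: HM].
have om0 : 0 <= growth j by rewrite /growth mulr_ge0// addr_ge0// invr_ge0 ltW// ratio_gt0.
pose e := Num.min h 1.
have e0 : 0 < e by rewrite lt_min h0 ltr01.
have cJ : c1 / nJ j <= e.
  rewrite /e le_min; apply/andP; split; rewrite ler_pdivrMr//.
    by rewrite mulrC -ler_pdivrMr//; apply: le_trans ZJ; rewrite /Z; lra.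
  by rewrite mul1r; apply: le_trans ZJ; rewrite /Z; lra.
rewrite -exprM.
(* The frequency is below k / [ratio j], so k + t is at most (1 + 1 / [ratio j]) dk, which is
   [growth j] times dk divided by j + 1. *)
apply: le_trans (_ : (c1 / nJ j * (growth j * (d * k)%:R)) ^+ (d * k) <= _).
  apply: le_exprn; first by rewrite mulr_ge0 ?(ltW c10)// addr_ge0// ltW// freq_gt0.
  rewrite -mulrA ler_wpM2l ?(ltW c10)// /growth -mulrA mulKf ?gt_eqF//.
  rewrite mulrDl mul1r; apply: lerD; first by rewrite ler_nat leq_pmull.
  rewrite mulrC ler_pdivlMr ?ratio_gt0// mulrC; exact: dk.
rewrite exprMn; apply: ler_wpM2r; first by rewrite exprn_ge0// mulr_ge0.
apply: le_trans (_ : e ^+ (d * k) <= _).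
  by apply: le_exprn => //; rewrite divr_ge0 ?ltW.
apply: le_trans (_ : e ^+ k <= _).
  by apply: ler_wiXn2l; rewrite ?(ltW e0) ?leq_pmull// /e ge_min lexx orbT.
by apply: le_exprn; rewrite ?(ltW e0)// /e ge_min lexx.
Qed.

Lemma packet_sum_bound K (h : R) : compact K -> K `<=` Omega -> 0 < h ->
  exists2 A : R, 0 < A & forall k x J, K x ->
    \sum_(0 <= i < J) normc (iter k (diff_op d p) (packet i) x) <= A * h ^+ k * M (d * k).
Proof.
move=> cK KO h0.
have [j0 Hj0] := packet_fine cK KO h0.
have /choice[A HA] : forall j, exists A : R, 0 <= A /\ forall k x, K x ->
    normc (iter k (diff_op d p) (packet j) x) <= A * h ^+ k * M (d * k).
  by move=> j; have [A A0 HA] := packet_crude j cK KO h0; exists A.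
have A0 j : 0 <= A j by case: (HA j).
(* The exponential factor lets the early packets share the summable majorant exp (-(i+1)) of the
   later ones. *)
pose S := (\sum_(i < j0) A i) * expR (nJ j0) + 1.
have S0 : 0 < S by rewrite ltr_wpDl// mulr_ge0 ?expR_ge0// sumr_ge0.
have e0 (j : nat) : 0 <= expR (- nJ j) by exact: expR_ge0.
pose L := limn (series (fun j => expR (- nJ j) : R)).
have L0 : 0 <= L by apply: le_trans (series_le_lim e0 series_exp_cvg 0); rewrite big_geq.
exists (S * L + 1); first by rewrite ltr_wpDl// mulr_ge0// ltW.
move=> k x J Kx.
have hM : 0 <= h ^+ k * M (d * k) by rewrite mulr_ge0 ?exprn_ge0 ?(ltW h0)// ltW// M_gt0.
apply: le_trans (_ : \sum_(0 <= i < J) (S * (h ^+ k * M (d * k)) * expR (- nJ i)) <= _).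
  apply: ler_sum => i _; rewrite [leRHS]mulrAC.
  have [ij|ji] := ltnP i j0.
    have [_ /(_ k x Kx)] := HA i; rewrite -mulrA; move/le_trans; apply; apply: ler_wpM2r => //.
    apply: le_trans (_ : \sum_(i < j0) A i <= _).
      by rewrite (bigD1 (Ordinal ij))//= lerDl sumr_ge0.
    rewrite /S mulrDl mul1r -mulrA -expRD; apply: le_trans (_ : (\sum_(i < j0) A i) * 1 <= _); first by rewrite mulr1.
    rewrite -[leLHS]addr0; apply: lerD => //; rewrite ler_wpM2l ?sumr_ge0//.
    by rewrite -[leLHS]expR0 ler_expR subr_ge0 ler_nat ltnS ltnW.
  have := Hj0 i ji k x Kx; rewrite -mulrA; move/le_trans; apply; apply: ler_wpM2r => //.
  by rewrite ler_peMl// /S lerDr mulr_ge0 ?expR_ge0// sumr_ge0.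
rewrite -mulr_sumr; apply: le_trans (ler_wpM2l _ (series_le_lim e0 series_exp_cvg J)) _.
  by rewrite mulr_ge0// ltW.
have -> : (S * L + 1) * h ^+ k * M (d * k) = S * (h ^+ k * M (d * k)) * L + h ^+ k * M (d * k) by ring.
by rewrite lerDl.
Qed.

Lemma packet_center j k : exists2 b : R, 0 <= b &
  foldr D (packet j) (nseq k l) x0 = b%:C /\ ampl j * freq j ^+ k <= b.
Proof.
have [b hb e] := @iter_Dj_gaussian_center R n x0 xi (freq j) l k (ltW (freq_gt0 j)) xil.
have f0 : 0 <= freq j ^+ k by rewrite exprn_ge0// ltW// freq_gt0.
exists (ampl j * b).
  apply: mulr_ge0; [exact/ltW/ampl_gt0|exact: le_trans f0 hb].
split; last by apply: ler_wpM2l => //; exact/ltW/ampl_gt0.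
rewrite (foldr_DjZ openT _ _ (smooth_gaussian x0 xi (freq j) openT) I) foldr_nseq e.
by move: (ampl j) => a; rewrite rmorphM.
Qed.

(** At k = m_j the packet j contributes exp (-2 (j+1)) (j+1)^m M_m. Since m_j >= j + 1, this is at
    least ((j+1) / e^2)^m M_m, and [Z] is chosen to make the base at least (A + 1) h. Using A + 1
    gives (A + 1)^m >= A + 1 > A. *)
Lemma witness_large (u : E -> C) (A h : R) :
  (forall s x, csum (fun i => foldr D (packet i) s x) (foldr D u s x)) ->
  0 < A -> 0 < h -> exists k, A * h ^+ k * M k < normc (Dalpha (axis l k) u x0).
Proof.
move=> us A0 h0.
pose Z := (A + 1) * h * expR 2.
have Z0 : 0 <= Z by rewrite !mulr_ge0 ?expR_ge0 ?(ltW h0)//; lra.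
pose j := Num.bound Z.
have ZJ : Z <= nJ j by apply: le_trans (ltW (archi_boundP Z0)) _; rewrite ler_nat.
have [jm _ _ _] := Hm j.
exists (m j); rewrite DalphaE word_axis.
have /choice[b Hb] : forall i, exists b : R, [/\ 0 <= b,
    foldr D (packet i) (nseq (m j) l) x0 = b%:C & ampl i * freq i ^+ m j <= b].
  by move=> i; have [b b0 [e h1]] := packet_center i (m j); exists b.
have := us (nseq (m j) l) x0.
rewrite (_ : (fun i => _) = fun i => (b i)%:C); last first.
  by apply/funext => i; have [] := Hb i.
have b0 i : 0 <= b i by have [] := Hb i.
move=> cs; have {cs} : b j <= normc (foldr D u (nseq (m j) l) x0) by exact: (csum_real_ge _ cs b0).
apply: lt_le_trans; have [_ _] := Hb j; apply: lt_le_trans; rewrite ampl_freq_m.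
rewrite ltr_pM2r ?M_gt0//.
have e2 : expR (- (2 * (m j)%:R)) <= expR (- (2 * nJ j)) :> R.
  by rewrite ler_expR lerN2 ler_pM2l// ler_nat.
apply: lt_le_trans (ler_wpM2r _ e2); last by rewrite exprn_ge0.
rewrite -mulNr expRM_natr -exprMn.
apply: (@lt_le_trans _ _ (((A + 1) * h) ^+ m j)).
  rewrite exprMn ltr_pM2r ?exprn_gt0//.
  apply: (@lt_le_trans _ _ (A + 1)); first by rewrite ltrDl.
  rewrite -[leLHS]expr1; apply: ler_weXn2l; first by rewrite lerDr ltW.
  exact: leq_ltn_trans jm.
apply: le_exprn; first by rewrite mulr_ge0 ?(ltW h0)//; lra.
by rewrite expRN [leRHS]mulrC ler_pdivlMr ?expR_gt0.
Qed.

End witness.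

Lemma witness_exists : exists u : E -> C,
  [/\ smooth setT u,
   (forall K, compact K -> K `<=` Omega -> forall h, 0 < h -> exists2 A : R, 0 < A &
      forall k x, K x -> normc (iter k (diff_op d p) u x) <= A * h ^+ k * M (d * k)%N) &
   forall A h : R, 0 < A -> 0 < h -> exists k,
      A * h ^+ k * M k < normc (Dalpha (axis l k) u x0)].
Proof.
have [m Hm] := index_exists.
have [u [su us]] := witness_smooth Hm.
exists u; split => //; last by move=> A h A0 h0; exact: witness_large Hm _ _ _ us A0 h0.
move=> K cK KO h h0; have [A A0 HA] := packet_sum_bound Hm cK KO h0.
exists A => // k x Kx; have Ox := KO x Kx.
have [|rho [B [rho0 _ HB]]] := coefficients_bound ap (@compact_set1 _ x).
  by move=> y ->.
apply: csum_le (fun J => HA k x J Kx).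
apply: (diff_op_csum oO sp k (fun i => smooth_packet m i oO) _ _ _ Ox).
- exact: smooth_sub su.
- by move=> s y _; exact: us.
- by exists rho, B; split=> // a N ad; exact: HB.
Qed.

End construction.

(** * Integration by parts *)

Section measurability.
Context {R : realType} {n : nat}.
Local Notation E := 'rV[R]_n.
Implicit Types (U K A : set E) (f : E -> R).

Lemma measurable_box (A : 'I_n -> set (measurableTypeR R)) :
  (forall i, measurable (A i)) -> measurable [set v : E | forall i, A i (v 0 i)].
Proof.
move=> mA.
rewrite (_ : [set _ | _] = \bigcap_(i in setT) (row_coord i @^-1` A i)).
  apply: fin_bigcap_measurable => [|i _]; first exact: finite_finset.
  by rewrite -[X in measurable X]setTI; exact: measurable_row_coord.
by apply/seteqP; split=> v /= Bv i => [_|]; exact: Bv.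
Qed.

(** The sigma-algebra is generated by the coordinates, so an open set is written as the countable
    union of the boxes with rational centre and half-width 1 / (k+1) that it contains. *)
Lemma open_measurable_row U : open U -> measurable U.
Proof.
move=> oU.
pose box (q : 'rV[rat]_n) (k : nat) : set E :=
  [set v | forall i, `](ratr (q 0 i) - k.+1%:R^-1), (ratr (q 0 i) + k.+1%:R^-1)[%classic (v 0 i)].
pose F (qk : 'rV[rat]_n * nat) := if `[< box qk.1 qk.2 `<=` U >] then box qk.1 qk.2 else set0.
have -> : U = \bigcup_qk F qk.
  apply/seteqP; split=> [x Ux|x [[q k] _]]; last first.
    by rewrite /F; case: asboolP => //= qU /qU.
  have [r /= r0 rU] := (nbhs_ballP x U).1 (open_nbhs_nbhs (conj oU Ux)).
  have [k hk] : exists k : nat, 2 / r < k.+1%:R.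
    have [k _ hk] := @nbhs_infty_gtr R (2 / r); exists k.
    by have := hk k.+1 (leqnSn k).
  have kr : 2 * k.+1%:R^-1 < r.
    by move: hk; rewrite ltr_pdivrMr// mulrC -ltr_pdivrMr.
  have k0 : 0 < k.+1%:R^-1 :> R by rewrite invr_gt0.
  have /choice[q hq] i : exists q : rat, ratr q \in `](x 0 i - k.+1%:R^-1), (x 0 i + k.+1%:R^-1)[.
    by apply: rat_in_itvoo; move: k0; set e := k.+1%:R^-1; lra.
  exists (\row_i q i, k) => //; rewrite /F asboolT/=; last first.
    move=> v bv; apply: rU; rewrite -ball_normE /ball_/=.
    apply: le_lt_trans kr; apply: norm_row_le; first by rewrite mulr_ge0// ltW.
    move=> i; have := hq i; have := bv i; rewrite /= !mxE !in_itv/=.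
    by move: k0; set e := k.+1%:R^-1 => e0 h1 h2; rewrite ler_norml; lra.
  by move=> i; have := hq i; rewrite mxE /= !in_itv/=; set e := k.+1%:R^-1; lra.
apply: countable_bigcupT_measurable => [|qk]; first exact: countableP.
rewrite /F; case: ifP => _; last exact: measurable0.
apply: (measurable_box (A := fun i =>
  `](ratr (qk.1 0 i) - qk.2.+1%:R^-1), (ratr (qk.1 0 i) + qk.2.+1%:R^-1)[%classic)) => i.
exact: measurable_itv.
Qed.

Lemma measurable_continuous_on U f : open U ->
  (forall x, U x -> {for x, continuous f}) -> measurable_fun U f.
Proof.
move=> oU cf; apply: (measurability _ (RGenOpens.measurableE R)).
move=> _ [_ [a [b ->] <-]]; apply: open_measurable_row.
rewrite openE => x [Ux /= fx]; apply: filterI; first exact: (open_nbhs_nbhs (conj oU Ux)).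
by apply: cf => //; exact: (open_nbhs_nbhs (conj (interval_open _ _) fx)).
Qed.

Lemma compact_measurable_row K : compact K -> measurable K.
Proof.
move=> cK; rewrite -[K]setCK; apply: measurableC; apply: open_measurable_row.
by rewrite openC; exact: (compact_closed (@norm_hausdorff _ _) cK).
Qed.

Lemma lebesgue_row_cube_lty (B : R) : 
  (lebesgue_row n [set v : 'rV[R]_n | forall i, `[(- B)%R, B]%classic (v 0%R i)] < +oo)%E.
Proof.
rewrite (lebesgue_row_box (A := fun=> `[(- B), B]%classic)) => [|i]; last exact: measurable_itv.
rewrite ltey_eq; apply/orP; left.
apply: (@big_ind _ (fun x => x \is a fin_num)) => // [x y fx fy|i _].
  exact: fin_numM.
by rewrite lebesgue_measure_itv /=; case: ifP.
Qed.

Lemma compact_cube K : compact K -> exists B : R, forall x, K x -> `|x| <= B.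
Proof.
move=> /compact_bounded[B [_ hB]]; exists (B + 1) => x Kx.
by apply: (hB (B + 1)) => //; rewrite ltrDl.
Qed.

Lemma compact_lty K : compact K -> (lebesgue_row n K < +oo)%E.
Proof.
move=> cK; have [B hB] := compact_cube cK.
apply: le_lt_trans (lebesgue_row_cube_lty B).
apply: le_measure; rewrite ?inE.
- exact: compact_measurable_row.
- by apply: (measurable_box (A := fun=> `[(- B), B]%classic)) => i; exact: measurable_itv.
move=> x Kx i; rewrite /= in_itv /= -ler_norml.
exact: le_trans (norm_coord_le _ _) (hB _ Kx).
Qed.

End measurability.

Lemma row_cons_line0 (R : realType) (n : nat) (x y : R) (v : 'rV[R]_n) :
  row_cons (x + y, v) = row_cons (x, v) + y *: delta_mx 0 ord0.
Proof.
apply/rowP => i; rewrite !mxE eqxx /=; case: unliftP => [j|] ->.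
  by rewrite mulr0 addr0.
by rewrite mulr1.
Qed.

Lemma row_cons_lineS (R : realType) (n : nat) (x t : R) (v : 'rV[R]_n) (j : 'I_n) :
  row_cons (x, v + t *: delta_mx 0 j) = row_cons (x, v) + t *: delta_mx 0 (lift ord0 j).
Proof.
apply/rowP => i; rewrite !mxE eqxx /=; case: unliftP => [k|] -> /=.
  by rewrite !mxE eqxx (inj_eq (@lift_inj _ _)).
by rewrite mulr0 addr0.
Qed.

Section partial_integral.
Context {R : realType}.

Lemma integrable_cube n (g : 'rV[R]_n -> R) (B b : R) :
  measurable_fun setT g -> (forall x, `|g x| <= b) ->
  (forall (x : 'rV[R]_n) i, B < `|x 0 i| -> g x = 0) ->
  (lebesgue_row n).-integrable setT (EFin \o g).
Proof.
move=> mg gb g0.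
pose Q := [set v : 'rV[R]_n | forall i, `[(- B)%R, B]%classic (v 0%R i)].
have mQ : measurable Q.
  by apply: (measurable_box (A := fun=> `[(- B), B]%classic)) => i; exact: measurable_itv.
have -> : EFin \o g = (EFin \o g) \_ Q.
  apply/funext => x; rewrite patchE; case: ifPn => // /negP; rewrite inE.
  case: (pselect (exists i, B < `|x 0 i|)) => [[i Bi] _|nB nQ].
    by rewrite /= (g0 x i Bi).
  exfalso; apply: nQ => i; rewrite /= in_itv/= -ler_norml leNgt.
  by apply/negP => h; apply: nB; exists i.
apply: ((@integrable_mkcond _ _ _ _ Q (EFin \o g) mQ).1 _).
apply: measurable_bounded_integrable.
- exact: mQ.
- exact: lebesgue_row_cube_lty.
- exact: measurable_funTS.
- by exists b; split; [exact: num_real|] => M bM x _ /=; rewrite (le_trans (gb x))// ltW.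
Qed.

Lemma integral_derivative0 (F g : R -> R) (B : R) :
  (forall t : R, is_derive t 1 F (g t)) -> continuous g ->
  (forall t, B < `|t| -> F t = 0 /\ g t = 0) ->
  (\int[lebesgue_measure]_x (g x)%:E = 0)%E.
Proof.
move=> dF cg F0.
have cF : continuous F by move=> t; apply/differentiable_continuous/derivable1_diffP.
pose a := `|B| + 1.
have aB : B < `|a| by rewrite /a ger0_norm ?addr_ge0// ltr_pwDr// ler_norm.
have a0 : - a < a by rewrite /a; have := normr_ge0 B; lra.
have := @continuous_FTC2 R g F (- a) a a0.
rewrite (F0 _ aB).1 (F0 (- a) _).1 ?normrN// sube0.
rewrite -[0%:E]/(0%E) => <-; first 3 last.
- by move=> t _; rewrite derive1E; have := dF t => -[].
- rewrite [RHS]integral_mkcond; apply: eq_integral => t _; rewrite patchE.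
case: ifPn => // /negP; rewrite inE /= in_itv/= -ler_norml => /negP; rewrite -ltNge => at_.
rewrite (F0 t _).2//; apply: le_lt_trans at_.
by rewrite /a; have := ler_norm B; lra.
- exact: continuous_subspaceT.
split=> [t _||]; first by have := dF t.
  by apply: cvg_at_right_filter; exact: cF.
by apply: cvg_at_left_filter; exact: cF.
Qed.

(** Induction on the dimension along the recursive construction of [lebesgue_row]. If j is the first
    coordinate, Fubini integrates it first and the fundamental theorem applies; otherwise the
    integral over each slice vanishes by induction. The hypotheses are stated along lines so that
    they pass to slices. *)
Lemma integral_partial0 n (j : 'I_n) (F g : 'rV[R]_n -> R) (B b : R) :
  measurable_fun setT g -> (forall x, `|g x| <= b) ->
  (forall (x : 'rV[R]_n) i, B < `|x 0 i| -> F x = 0 /\ g x = 0) ->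
  (forall x (t : R), is_derive t 1 (fun s : R => F (x + s *: delta_mx 0 j)) (g (x + t *: delta_mx 0 j))) ->
  (forall x, continuous (fun s : R => g (x + s *: delta_mx 0 j))) ->
  (\int[lebesgue_row n]_x (g x)%:E = 0)%E.
Proof.
elim: n j F g => [[]//|n IH] j F g mg gb F0 dF cg.
have ig := integrable_cube mg gb (fun x i h => (F0 x i h).2).
have mEg := measurable_int _ ig.
pose G : measurableTypeR R * 'rV[R]_n -> \bar R := EFin \o (g \o @row_cons R n).
have mG : measurable_fun setT (g \o @row_cons R n).
  by apply: measurableT_comp => //; exact: measurable_row_cons.
have igc : (lebesgue_measure \x lebesgue_row n)%E.-integrable setT G.
  apply/integrableP; split; first exact/measurable_EFinP.
  move/integrableP : ig => [_]; rewrite /=.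
  rewrite (ge0_integral_pushforward (@measurable_row_cons R n)) //=.
  by apply/measurable_EFinP; apply: measurableT_comp.
have -> : (\int[lebesgue_row n.+1]_x (g x)%:E =
    \int[(lebesgue_measure \x lebesgue_row n)%E]_p G p)%E.
  by rewrite /= (integral_pushforward (@measurable_row_cons R n) mEg).
case: (unliftP ord0 j) => [k jk|j0].
  rewrite -(integral12_prod_meas1 igc); apply: integral0_eq => x _.
  rewrite /fubini_F; apply: (IH k (fun v => F (row_cons (x, v))) (fun v => g (row_cons (x, v)))) => //.
  - apply: measurableT_comp => //; apply: measurableT_comp; first exact: measurable_row_cons.
    exact: measurable_pair1.
  - by move=> v i h; apply: (F0 _ (lift ord0 i)); rewrite mxE liftK.
  - move=> v t; rewrite row_cons_lineS -jk.
    rewrite (_ : (fun s => _) = (fun s : R => F (row_cons (x, v) + s *: delta_mx 0 j)))//.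
    by apply/funext => s; rewrite row_cons_lineS jk.
  - move=> v; rewrite (_ : (fun s => _) = (fun s : R => g (row_cons (x, v) + s *: delta_mx 0 j)))//.
    by apply/funext => s; rewrite row_cons_lineS jk.
rewrite -(integral21_prod_meas1 igc); apply: integral0_eq => v _.
rewrite /fubini_G.
apply: (@integral_derivative0 (fun t => F (row_cons (t, v))) (fun t => g (row_cons (t, v))) B).
- move=> t; have := dF (row_cons (0, v)) t.
  rewrite j0 -row_cons_line0 add0r.
  rewrite (_ : (fun s => _) = (fun t => F (row_cons (t, v))))//.
  by apply/funext => s; rewrite -row_cons_line0 add0r.
- have := cg (row_cons (0, v)).
  rewrite (_ : (fun s => _) = (fun t => g (row_cons (t, v))))//.
  by apply/funext => s; rewrite j0 -row_cons_line0 add0r.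
- by move=> t Bt; apply: (F0 _ ord0); rewrite mxE unlift_none.
Qed.

End partial_integral.

(** * Symmetry of mixed derivatives *)

Section symmetry.
Context {R : realType} {n : nat}.
Local Notation E := 'rV[R]_n.
Local Notation reC := (@complex.Re R).
Local Notation imC := (@complex.Im R).
Local Notation D := (@Dj R n).
Local Notation e_ i := (delta_mx 0 i : E).

(** The mean value theorem is applied in direction i to the increment of f in direction j, then in
    direction j to the derivative so obtained. *)
Lemma double_difference (f fi fij : E -> R) (x : E) (i j : 'I_n) (h : R) : 0 <= h ->
  (forall y, `|y - x| <= 2 * h -> derivable f y (e_ i) /\ 'D_(e_ i) f y = fi y) ->
  (forall y, `|y - x| <= 2 * h -> derivable fi y (e_ j) /\ 'D_(e_ j) fi y = fij y) ->
  exists2 y, `|y - x| <= 2 * h &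
    f (x + h *: e_ i + h *: e_ j) - f (x + h *: e_ i) - f (x + h *: e_ j) + f x
      = fij y * h * h.
Proof.
move=> h0 Hf Hfi.
have nd (k : 'I_n) (t : R) : `|t| <= `|h| -> `|t *: e_ k| <= h.
  move=> th; apply: norm_row_le => // l; rewrite !mxE eqxx /= normrM.
  rewrite -[leRHS]mulr1 ler_pM//; first by rewrite -(ger0_norm h0).
  by case: eqP => _; rewrite ?normr1 ?normr0.
have near2 (s t : R) : `|s| <= `|h| -> `|t| <= `|h| -> `|x + s *: e_ i + t *: e_ j - x| <= 2 * h.
  move=> sh th; have -> : x + s *: e_ i + t *: e_ j - x = s *: e_ i + t *: e_ j.
    by rewrite addrC -addrA addKr.
  rewrite mulr2n mulrDl mul1r.
  by apply: le_trans (ler_normD _ _) _; rewrite lerD// nd.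
have h_h : `|h| <= `|h| := lexx _.
have z_h : `|0 : R| <= `|h| by rewrite normr0.
pose g (s : R) := f (x + h *: e_ j + s *: e_ i) - f (x + s *: e_ i).
pose dg (s : R) := fi (x + h *: e_ j + s *: e_ i) - fi (x + s *: e_ i).
have [s sh|c ch e1] := @MVT_origin R g dg h.
  have n1 : `|x + h *: e_ j + s *: e_ i - x| <= 2 * h by rewrite (addrAC x (h *: e_ j)); exact: near2.
  have n2 : `|x + s *: e_ i - x| <= 2 * h by have := near2 s 0 sh z_h; rewrite scale0r addr0.
  rewrite /dg; have [d1 <-] := Hf _ n1; have [d2 <-] := Hf _ n2.
  exact: (is_deriveB (is_derive_line d1) (is_derive_line d2)).
have [t th|c' ch' e2] := @MVT_origin R (fun t : R => fi (x + c *: e_ i + t *: e_ j))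
    (fun t : R => fij (x + c *: e_ i + t *: e_ j)) h.
  rewrite /=; have [d1 <-] := Hfi _ (near2 c t ch th).
  exact: is_derive_line.
exists (x + c *: e_ i + c' *: e_ j); first exact: near2.
move: e1; rewrite /g /dg !scale0r !addr0 in e2 *.
rewrite (addrAC x (h *: e_ j) (c *: e_ i)) e2 (addrAC x (h *: e_ j) (h *: e_ i)) => <-.
by ring.
Qed.

(** The second difference is symmetric in i and j, so the two mixed derivatives agree at two points
    that may differ but are both close to x; continuity at x concludes. *)
Lemma mixed_derivatives (U : set E) (f fi fj fij fji : E -> R) (i j : 'I_n) (x : E) :
  open U -> U x ->
  (forall y, U y -> derivable f y (e_ i) /\ 'D_(e_ i) f y = fi y) ->
  (forall y, U y -> derivable f y (e_ j) /\ 'D_(e_ j) f y = fj y) ->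
  (forall y, U y -> derivable fi y (e_ j) /\ 'D_(e_ j) fi y = fij y) ->
  (forall y, U y -> derivable fj y (e_ i) /\ 'D_(e_ i) fj y = fji y) ->
  {for x, continuous fij} -> {for x, continuous fji} -> fij x = fji x.
Proof.
move=> oU Ux Hi Hj Hij Hji cij cji; apply/eqP; rewrite -subr_eq0 -normr_le0.
apply/ler_addgt0Pr => e e0; rewrite add0r.
have e20 : 0 < e / 2 by rewrite divr_gt0.
have c1 : \forall y \near nbhs x, `|fij x - fij y| < e / 2.
  by move: e20; apply: (proj1 (@cvgrPdist_lt _ _ _ (nbhs x) _ fij (fij x))); exact: cij.
have c2 : \forall y \near nbhs x, `|fji x - fji y| < e / 2.
  by move: e20; apply: (proj1 (@cvgrPdist_lt _ _ _ (nbhs x) _ fji (fji x))); exact: cji.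
have c3 := open_nbhs_nbhs (conj oU Ux).
have [r /= r0 rP] := (nbhs_ballP x _).1 (filterI c3 (filterI c1 c2)).
pose h := r / 3.
have h0 : 0 < h by rewrite divr_gt0.
have hr y : `|y - x| <= 2 * h -> [/\ U y, `|fij x - fij y| < e / 2 & `|fji x - fji y| < e / 2].
  move=> yx; have [|H1 [H2 H3]] := rP y; last by [].
  rewrite -ball_normE /ball_/= distrC; apply: le_lt_trans yx _.
  by rewrite /h; move: r0; lra.
have [y1 n1 e1] := @double_difference f fi fij x i j h (ltW h0)
  (fun y yx => let: And3 Uy _ _ := hr y yx in Hi y Uy)
  (fun y yx => let: And3 Uy _ _ := hr y yx in Hij y Uy).
have [y2 n2 e2] := @double_difference f fj fji x j i h (ltW h0)
  (fun y yx => let: And3 Uy _ _ := hr y yx in Hj y Uy)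
  (fun y yx => let: And3 Uy _ _ := hr y yx in Hji y Uy).
have e3 : fij y1 = fji y2.
  have h_n0 : h != 0 by rewrite gt_eqF.
  apply: (mulIf h_n0); apply: (mulIf h_n0); rewrite -e1 -e2.
  by rewrite (addrAC x (h *: e_ j)); ring.
have [_ a1 _] := hr _ n1; have [_ _ a2] := hr _ n2.
rewrite (_ : fij x - fji x = (fij x - fij y1) - (fji x - fji y2)); last by rewrite e3; ring.
apply: le_trans (ler_normB _ _) _.
by apply: ltW; rewrite [ltRHS](splitr e) ltrD.
Qed.

Local Opaque smooth C1_at Dj derive derivable.

Lemma DjC (U : set E) u (i j : 'I_n) x : open U -> smooth U u -> U x ->
  D i (D j u) x = D j (D i u) x.
Proof.
move=> oU su Ux.
have si k := smooth_Dj k su; have sij k l := smooth_Dj k (si l).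
have der k v y : smooth U v -> U y ->
    (derivable (reC \o v) y (e_ k) /\ 'D_(e_ k) (reC \o v) y = - (imC \o D k v) y) /\
    (derivable (imC \o v) y (e_ k) /\ 'D_(e_ k) (imC \o v) y = (reC \o D k v) y).
  move=> sv Uy; have [d1 d2] := derivable_C1 k (smooth_C1 sv Uy).
  by split; split; [exact: d1|exact: derive_Re|exact: d2|exact: derive_Im].
have derN k v y : smooth U v -> U y ->
    derivable (- (imC \o v)) y (e_ k) /\ 'D_(e_ k) (- (imC \o v)) y = - (reC \o D k v) y.
  move=> sv Uy; have [_ [d1 d2]] := der k v y sv Uy.
  by split; [exact: derivableN|rewrite deriveN// d2].
have cc k l := continuous_C1 (smooth_C1 (sij k l) Ux).
have eRe : - (reC \o D i (D j u)) x = - (reC \o D j (D i u)) x.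
  apply: (@mixed_derivatives U (reC \o u) (- (imC \o D j u)) (- (imC \o D i u))
    (- (reC \o D i (D j u))) (- (reC \o D j (D i u))) j i x oU Ux).
  - by move=> y Uy; have [] := der j u y su Uy.
  - by move=> y Uy; have [] := der i u y su Uy.
  - by move=> y Uy; exact: derN (si j) Uy.
  - by move=> y Uy; exact: derN (si i) Uy.
  - by apply: continuousN; have [] := cc i j.
  - by apply: continuousN; have [] := cc j i.
have eIm : - (imC \o D i (D j u)) x = - (imC \o D j (D i u)) x.
  apply: (@mixed_derivatives U (imC \o u) (reC \o D j u) (reC \o D i u)
    (- (imC \o D i (D j u))) (- (imC \o D j (D i u))) j i x oU Ux).
  - by move=> y Uy; have [_] := der j u y su Uy.
  - by move=> y Uy; have [_] := der i u y su Uy.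
  - by move=> y Uy; have [] := der i (D j u) y (si j) Uy.
  - by move=> y Uy; have [] := der j (D i u) y (si i) Uy.
  - by apply: continuousN; have [] := cc i j.
  - by apply: continuousN; have [] := cc j i.
move: (D i (D j u)) (D j (D i u)) eRe eIm => v w.
by rewrite /= => /oppr_inj eRe /oppr_inj eIm; apply/eqP; rewrite eq_complex eRe eIm !eqxx.
Qed.

(* Repeated integration by parts reverses the word of derivatives. *)
Lemma foldr_Dj_rev (U : set E) u s x : open U -> smooth U u -> U x ->
  foldr D u (rev s) x = foldr D u s x.
Proof.
move=> oU su.
have shift j t y : U y -> foldr D (D j u) t y = D j (foldr D u t) y.
  elim: t y => // k t IH y Uy /=.
  by rewrite (eq_Dj k oU Uy IH) (DjC k j oU (smooth_foldr t su) Uy).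
elim: s x => // j s IH x Ux.
rewrite rev_cons foldr_rcons shift//=.
exact: (eq_Dj j oU Ux IH).
Qed.

End symmetry.

Section test_functions.
Context {R : realType} {n : nat}.
Local Notation E := 'rV[R]_n.
Local Notation C := R[i].
Local Notation reC := (@complex.Re R).
Local Notation imC := (@complex.Im R).
Local Notation normc := (@Normc.normc R).
Local Notation D := (@Dj R n).
Variable Omega : set E.
Hypothesis oO : open Omega.
Implicit Types (u v f g phi psi : E -> C) (K : set E).

Local Opaque smooth C1_at Dj derive derivable.

(** [Omega] and the complement of [K] are open and cover the space. This makes the product of a test
    function and a function smooth only on [Omega] smooth everywhere. *)
Lemma smooth_off u v K : compact K -> K `<=` Omega -> smooth Omega u ->
  (forall x, ~ K x -> u x = 0) -> smooth setT u.
Proof.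
move=> cK KO su u0; have cl := compact_closed (@norm_hausdorff _ _) cK.
have oK : open (~` K) by rewrite openC.
apply: smooth_local => x _; have [Ox|nOx] := pselect (Omega x); first by exists Omega.
exists (~` K); first by move=> /KO.
by apply: (eq_smooth oK (u := fun=> 0)); [move=> y /u0|exact: (smooth_cst oK)].
Qed.

Lemma Dj_off j u K x : compact K -> (forall x, ~ K x -> u x = 0) -> ~ K x -> D j u x = 0.
Proof.
move=> cK u0 Kx; have oK : open (~` K).
  by rewrite openC; exact: (compact_closed (@norm_hausdorff _ _) cK).
by rewrite (eq_Dj (v := fun=> 0) j oK Kx) ?Dj_cst.
Qed.

Lemma test_fun_Dj j phi : test_fun Omega phi -> test_fun Omega (D j phi).
Proof.
move=> [sp [K [cK KO p0]]]; split; first exact: (smooth_Dj j sp).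
by exists K; split => // x; exact: Dj_off cK p0.
Qed.

Lemma test_fun_foldr s phi : test_fun Omega phi -> test_fun Omega (foldr D phi s).
Proof. by move=> tp; elim: s => // j s IH; exact: (test_fun_Dj j IH). Qed.

Lemma test_funM v phi : smooth Omega v -> test_fun Omega phi ->
  test_fun Omega (fun x => v x * phi x).
Proof.
move=> sv [sp [K [cK KO p0]]].
have q0 x : ~ K x -> v x * phi x = 0 by move=> /p0 ->; rewrite mulr0.
split; last by exists K.
apply: (smooth_off v cK KO _ q0).
exact: (smoothM oO sv (smooth_sub (@subsetT _ Omega) sp)).
Qed.

Lemma test_fun0 : test_fun Omega (fun=> 0).
Proof.
split; first exact: (smooth_cst openT).
by exists set0; split => //; exact: compact0.
Qed.

Lemma test_funD phi psi : test_fun Omega phi -> test_fun Omega psi ->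
  test_fun Omega (fun x => phi x + psi x).
Proof.
move=> [sp [K [cK KO p0]]] [sq [L [cL LO q0]]]; split; first exact: (smoothD openT sp sq).
exists (K `|` L); split; [exact: compactU|by rewrite subUset|].
by move=> x /not_orP[/p0 -> /q0 ->]; rewrite addr0.
Qed.

Lemma test_funZ (c : C) phi : test_fun Omega phi -> test_fun Omega (fun x => c * phi x).
Proof.
move=> [sp [K [cK KO p0]]]; split; first exact: (smoothZ openT c sp).
by exists K; split => // x /p0 ->; rewrite mulr0.
Qed.

Lemma test_fun_sum (T : Type) (r : seq T) (P : pred T) (F : T -> E -> C) :
  (forall i, P i -> test_fun Omega (F i)) ->
  test_fun Omega (fun x => \sum_(i <- r | P i) F i x).
Proof.
move=> tF; elim: r => [|i r IH].
  by under eq_fun do rewrite big_nil; exact: test_fun0.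
under eq_fun do rewrite big_cons.
by case: (boolP (P i)) => [Pi|_]; [exact: (test_funD (tF i Pi) IH)|exact: IH].
Qed.

Lemma continuous_compact_bound K (f : E -> R) : compact K ->
  (forall x, K x -> {for x, continuous f}) ->
  exists2 b : R, 0 <= b & forall x, K x -> `|f x| <= b.
Proof.
move=> cK cf.
have cfK : compact (f @` K).
  apply: continuous_compact => //; apply: continuous_in_subspaceT => x.
  by rewrite inE; exact: cf.
have [b [_ hb]] := compact_bounded cfK.
exists (`|b| + 1) => [|x Kx]; first by rewrite addr_ge0.
apply: (hb (`|b| + 1)); last by exists x.
by rewrite ltr_pwDr// ler_norm.
Qed.

Lemma smooth_compact_bound K u : compact K -> K `<=` Omega -> smooth Omega u ->
  exists2 b : R, 0 <= b & forall x, K x -> normc (u x) <= b.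
Proof.
move=> cK KO su.
have cu x : K x -> _ := fun Kx => continuous_C1 (smooth_C1 su (KO x Kx)).
have [b1 b10 h1] := continuous_compact_bound cK (fun x Kx => (cu x Kx).1).
have [b2 b20 h2] := continuous_compact_bound cK (fun x Kx => (cu x Kx).2).
exists (b1 + b2) => [|x Kx]; first exact: addr_ge0.
by apply: le_trans (normc_le_ReIm _) _; rewrite lerD ?h1 ?h2.
Qed.

Lemma measurable_smooth u A : smooth Omega u -> A `<=` Omega ->
  measurable_fun A (reC \o u) /\ measurable_fun A (imC \o u).
Proof.
move=> su AO; have cu x (Ox : Omega x) := continuous_C1 (smooth_C1 su Ox).
have mO := open_measurable_row oO.
split; apply: (measurable_funS mO AO).
  exact: (measurable_continuous_on oO (fun x Ox => (cu x Ox).1)).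
exact: (measurable_continuous_on oO (fun x Ox => (cu x Ox).2)).
Qed.
End test_functions.

Section integrals.
Context {R : realType} {n : nat}.
Local Notation E := 'rV[R]_n.
Local Notation C := R[i].
Local Notation reC := (@complex.Re R).
Local Notation imC := (@complex.Im R).
Local Notation normc := (@Normc.normc R).
Local Notation D := (@Dj R n).
Variable Omega : set E.
Hypothesis oO : open Omega.
Implicit Types (u v f g phi psi : E -> C) (K : set E).

Local Opaque smooth C1_at Dj derive derivable.

(** Integration over the whole space, so that the coordinate lines along which one integrates never
    leave the domain. For integrands supported in [Omega] it agrees with the integral over [Omega],
    see [regular_dist_cint]. *)
Definition cint f : C :=
  Rintegral (lebesgue_row n) setT (reC \o f) +i* Rintegral (lebesgue_row n) setT (imC \o f).

Lemma test_fun_cube phi : test_fun Omega phi -> exists B b : R,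
  (forall (x : E) i, B < `|x 0 i| -> phi x = 0 /\ forall j, D j phi x = 0) /\
  (forall x, normc (phi x) <= b /\ forall j, normc (D j phi x) <= b).
Proof.
move=> [sp [K [cK KO p0]]]; have [B HB] := compact_cube cK.
have Bn (x : E) i : B < `|x 0 i| -> ~ K x.
  by move=> Bx /HB; rewrite leNgt (lt_le_trans Bx)// norm_coord_le.
have [b b0 hb] := smooth_compact_bound cK (@subsetT _ K) sp.
have /choice[c hc] j : exists c : R, 0 <= c /\ forall x, K x -> normc (D j phi x) <= c.
  have [c c0 hc] := smooth_compact_bound cK (@subsetT _ K) (smooth_Dj j sp).
  by exists c.
have cs : 0 <= \sum_j c j by apply: sumr_ge0 => j _; have [] := hc j.
exists B, (b + \sum_j c j); split => [x i /Bn nK|x].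
  by split => [|j]; [exact: p0|exact: Dj_off cK p0 nK].
have [Kx|nKx] := pselect (K x).
  split => [|j]; first by rewrite (le_trans (hb _ Kx))// lerDl.
  rewrite (le_trans ((hc j).2 _ Kx))// (bigD1 j)//= addrCA lerDl addr_ge0//.
  by apply: sumr_ge0 => k _; have [] := hc k.
rewrite p0// Normc.normc0; split => [|j]; first exact: addr_ge0.
by rewrite (Dj_off j cK p0 nKx) Normc.normc0 addr_ge0.
Qed.

Lemma test_fun_integrable phi : test_fun Omega phi ->
  (lebesgue_row n).-integrable setT (EFin \o (reC \o phi)) /\
  (lebesgue_row n).-integrable setT (EFin \o (imC \o phi)).
Proof.
move=> tp; have [B [b [h0 hb]]] := test_fun_cube tp.
have [m1 m2] := measurable_smooth openT tp.1 (@subsetT _ setT).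
split; apply: (integrable_cube (B := B) (b := b)) => //.
- by move=> x; apply: le_trans (normRe _) _; have [] := hb x.
- by move=> x i /h0[/= -> _].
- by move=> x; apply: le_trans (normIm _) _; have [] := hb x.
- by move=> x i /h0[/= -> _].
Qed.

Lemma cintD phi psi : test_fun Omega phi -> test_fun Omega psi ->
  cint (fun x => phi x + psi x) = cint phi + cint psi.
Proof.
move=> /test_fun_integrable[i1 i2] /test_fun_integrable[i3 i4]; rewrite /cint.
have -> : reC \o (fun x => phi x + psi x) = (fun x => (reC \o phi) x + (reC \o psi) x).
  by apply/funext => x /=; rewrite ReD.
have -> : imC \o (fun x => phi x + psi x) = (fun x => (imC \o phi) x + (imC \o psi) x).
  by apply/funext => x /=; rewrite ImD.
by rewrite !RintegralD.
Qed.

Lemma cintZ (c : C) phi : test_fun Omega phi -> cint (fun x => c * phi x) = c * cint phi.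
Proof.
move=> /test_fun_integrable[i1 i2]; case: c => a b; rewrite /cint.
have iZ (r : R) (f : E -> R) : (lebesgue_row n).-integrable setT (EFin \o f) ->
    (lebesgue_row n).-integrable setT (EFin \o (fun x => r * f x)).
  by move=> fi; exact: (@integrableZl _ _ _ (lebesgue_row n) setT measurableT r _ fi).
have -> : reC \o (fun x => (a +i* b) * phi x) =
    (fun x => a * (reC \o phi) x - b * (imC \o phi) x).
  by apply/funext => x /=; case: (phi x).
have -> : imC \o (fun x => (a +i* b) * phi x) =
    (fun x => a * (imC \o phi) x + b * (reC \o phi) x).
  by apply/funext => x /=; case: (phi x).
rewrite RintegralB ?RintegralD ?RintegralZl//; try exact: iZ.
Qed.

Lemma cint_sum (T : Type) (r : seq T) (P : pred T) (F : T -> E -> C) :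
  (forall i, P i -> test_fun Omega (F i)) ->
  cint (fun x => \sum_(i <- r | P i) F i x) = \sum_(i <- r | P i) cint (F i).
Proof.
move=> tF; elim: r => [|i r IH].
  under eq_fun do rewrite big_nil.
  have := cintZ 0 (test_fun0 Omega); rewrite mul0r big_nil.
  by rewrite mul0r.
under eq_fun do rewrite big_cons.
rewrite big_cons; case: (boolP (P i)) => [Pi|_]; last exact: IH.
by rewrite (cintD (tF i Pi) (test_fun_sum r tF)) IH.
Qed.

(** The real part of D_j phi is the partial derivative of the imaginary part of phi, and its
    imaginary part is that of minus the real part; both have integral zero. *)
Lemma cint_Dj j phi : test_fun Omega phi -> cint (D j phi) = 0.
Proof.
move=> tp; have [B [b [h0 hb]]] := test_fun_cube tp.
have tD := test_fun_Dj j tp.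
have [m1 m2] := measurable_smooth openT tD.1 (@subsetT _ setT).
have c1 x := continuous_C1 (smooth_C1 tD.1 (I : setT x)).
have der x := derivable_C1 j (smooth_C1 tp.1 (I : setT x)).
have cl (x : E) : continuous (fun s : R => x + s *: (delta_mx 0 j : E)).
  by move=> s; apply: cvgD; [exact: cvg_cst|apply: cvgZr_tmp; exact: cvg_id].
have cc (g : E -> R) : (forall x : E, {for x, continuous g}) ->
    forall x : E, continuous (fun s : R => g (x + s *: (delta_mx 0 j : E))).
  move=> cg x s.
  exact: (@continuous_comp R E R (fun s : R => x + s *: (delta_mx 0 j : E)) g s (cl x s) (cg _)).
have e1 : Rintegral (lebesgue_row n) setT (reC \o D j phi) = 0.
  rewrite /Rintegral; set J := integral _ _ _; suff -> : J = 0%E by [].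
  apply: (@integral_partial0 R n j (imC \o phi) (reC \o D j phi) B b) => //.
  - by move=> x; apply: le_trans (normRe _) _; have [] := hb x.
  - by move=> x i /h0[e e']; rewrite /= e e'.
  - by move=> x t; rewrite -[(reC \o D j phi) _]derive_Im; apply: is_derive_line; have [] := der (x + t *: delta_mx 0 j).
  - by apply: cc => x; exact: (c1 x).1.
have e2 : Rintegral (lebesgue_row n) setT (imC \o D j phi) = 0.
  rewrite /Rintegral; set J := integral _ _ _; suff -> : J = 0%E by [].
  apply: (@integral_partial0 R n j (- (reC \o phi)) (imC \o D j phi) B b) => //.
  - by move=> x; apply: le_trans (normIm _) _; have [] := hb x.
  - by move=> x i /h0[e e']; rewrite fctE /= e e' oppr0.
  - move=> x t; have e : 'D_(delta_mx 0 j) (- (reC \o phi)) (x + t *: delta_mx 0 j) = (imC \o D j phi) (x + t *: delta_mx 0 j).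
      by rewrite deriveN ?derive_Re ?opprK//; have [] := der (x + t *: delta_mx 0 j).
    have [dr _] := der (x + t *: delta_mx 0 j).
    exact: (@is_derive_eq _ _ _ _ _ _ _ _ (is_derive_line (derivableN dr)) e).
  - by apply: cc => x; exact: (c1 x).2.
by rewrite /cint e1 e2.
Qed.

Lemma cint_by_parts j v phi : smooth Omega v -> test_fun Omega phi ->
  cint (fun x => v x * D j phi x) = - cint (fun x => D j v x * phi x).
Proof.
move=> sv tp; have tvp := test_funM oO sv tp.
have t1 := test_funM oO sv (test_fun_Dj j tp).
have t2 := test_funM oO (smooth_Dj j sv) tp.
apply/eqP; rewrite -addr_eq0 addrC -cintD//.
rewrite (_ : (fun x => _) = D j (fun x => v x * phi x)) ?cint_Dj//.
apply/funext => x; have [sp [K [cK KO p0]]] := tp.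
have [Ox|nOx] := pselect (Omega x).
  by rewrite (DjM j (smooth_C1 sv Ox) (smooth_C1 sp (I : setT x))).
have nKx : ~ K x by move=> /KO.
rewrite (p0 _ nKx) (Dj_off j cK p0 nKx) !mulr0 addr0 (Dj_off j cK _ nKx)//.
by move=> y /p0 ->; rewrite mulr0.
Qed.

Lemma cint_foldr s v phi : smooth Omega v -> test_fun Omega phi ->
  cint (fun x => v x * foldr D phi s x) =
  (-1) ^+ size s * cint (fun x => foldr D v s x * phi x).
Proof.
move=> sv tp.
have -> : cint (fun x => v x * foldr D phi s x) =
    (-1) ^+ size s * cint (fun x => foldr D v (rev s) x * phi x).
  elim: s v sv => [|j s IH] v sv; first by rewrite mul1r.
  rewrite (cint_by_parts j sv (test_fun_foldr s tp)) (IH _ (smooth_Dj j sv)).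
  by rewrite rev_cons foldr_rcons exprS mulN1r mulNr.
congr (_ * cint _); apply/funext => x; have [Ox|nOx] := pselect (Omega x).
  by rewrite (foldr_Dj_rev s oO sv Ox).
have [_ [K [cK KO p0]]] := tp.
by rewrite p0 ?mulr0// => /KO.
Qed.

Lemma regular_dist_cint v phi : test_fun Omega phi ->
  regular_dist Omega v phi = cint (fun x => v x * phi x).
Proof.
move=> [_ [K [cK KO p0]]]; rewrite /regular_dist /cint.
have out x : ~ Omega x -> v x * phi x = 0.
  by move=> nOx; rewrite p0 ?mulr0// => /KO.
by congr (_ +i* _); rewrite Rintegral_mkcond; congr Rintegral; apply/funext => x;
  rewrite patchE; case: ifPn => // /negP; rewrite inE /= => /out ->.
Qed.

End integrals.

(** * Regular distributions *)

Section transpose.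
Context {R : realType} {n : nat}.
Local Notation E := 'rV[R]_n.
Local Notation C := R[i].
Local Notation D := (@Dj R n).
Variable Omega : set E.
Hypothesis oO : open Omega.
Variables (d : nat) (p : multi n -> E -> C).
Hypothesis sp : forall a, (mdeg a <= d)%N -> smooth Omega (p a).
Implicit Types (u v f g phi psi : E -> C) (K : set E).

Local Opaque smooth C1_at Dj derive derivable.

Lemma transpose_opE phi : transpose_op d p phi = fun x =>
  \sum_(a : {ffun 'I_n -> 'I_d.+1} | (mdeg (mval a) <= d)%N)
    (-1) ^+ mdeg (mval a) * foldr D (fun y => p (mval a) y * phi y) (word (mval a)) x.
Proof.
apply/funext => x; rewrite /transpose_op /multi_sum; apply: eq_bigr => a _.
by rewrite DalphaE.
Qed.

Let test_term phi (a : multi n) : test_fun Omega phi -> (mdeg a <= d)%N ->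
  test_fun Omega (foldr D (fun y => p a y * phi y) (word a)).
Proof. by move=> tp ad; exact: (test_fun_foldr _ (test_funM oO (sp ad) tp)). Qed.

Lemma test_fun_transpose phi : test_fun Omega phi -> test_fun Omega (transpose_op d p phi).
Proof.
move=> tp; rewrite transpose_opE; apply: test_fun_sum => a ad.
exact: (test_funZ _ (test_term tp ad)).
Qed.

(** The sign in the transpose cancels the sign produced by |a| integrations by parts. *)
Lemma regular_dist_transpose v phi : smooth Omega v -> test_fun Omega phi ->
  regular_dist Omega v (transpose_op d p phi) = regular_dist Omega (diff_op d p v) phi.
Proof.
move=> sv tp; rewrite !regular_dist_cint//; last exact: test_fun_transpose.
rewrite transpose_opE.
have -> : (fun x => v x * \sum_(a : {ffun 'I_n -> 'I_d.+1} | (mdeg (mval a) <= d)%N)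
    (-1) ^+ mdeg (mval a) * foldr D (fun y => p (mval a) y * phi y) (word (mval a)) x) =
  (fun x => \sum_(a : {ffun 'I_n -> 'I_d.+1} | (mdeg (mval a) <= d)%N)
    (-1) ^+ mdeg (mval a) * (v x * foldr D (fun y => p (mval a) y * phi y) (word (mval a)) x)).
  by apply/funext => x; rewrite mulr_sumr; apply: eq_bigr => a _; rewrite mulrCA.
have -> : (fun x => diff_op d p v x * phi x) =
  (fun x => \sum_(a : {ffun 'I_n -> 'I_d.+1} | (mdeg (mval a) <= d)%N)
    (foldr D v (word (mval a)) x * (p (mval a) x * phi x))).
  apply/funext => x; rewrite diff_opE /multi_sum mulr_suml; apply: eq_bigr => a _.
  by rewrite DalphaE mulrAC mulrC.
have t1 (a : multi n) : (mdeg a <= d)%N ->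
    test_fun Omega (fun x => v x * foldr D (fun y => p a y * phi y) (word a) x).
  by move=> ad; exact: (test_funM oO sv (test_term tp ad)).
have t2 (a : multi n) : (mdeg a <= d)%N ->
    test_fun Omega (fun x => foldr D v (word a) x * (p a x * phi x)).
  by move=> ad; exact: (test_funM oO (smooth_foldr _ sv) (test_funM oO (sp ad) tp)).
rewrite (cint_sum _ (fun a ad => test_funZ _ (t1 _ ad))) (cint_sum _ (fun a ad => t2 _ ad)).
apply: eq_bigr => a ad.
rewrite (cintZ _ (t1 _ ad)) (cint_foldr oO _ sv (test_funM oO (sp ad) tp)) size_word.
by rewrite mulrA -expr2 sqrr_sign mul1r.
Qed.

Lemma iter_apply_op u k phi : smooth Omega u -> test_fun Omega phi ->
  iter k (apply_op d p) (regular_dist Omega u) phi =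
  regular_dist Omega (iter k (diff_op d p) u) phi.
Proof.
move=> su; elim: k phi => // k IH phi tp.
rewrite !iterS {1}/apply_op IH; last exact: test_fun_transpose.
exact: (regular_dist_transpose (smooth_iter_diff_op oO sp k su) tp).
Qed.

End transpose.

Section regular.
Context {R : realType} {n : nat}.
Local Notation E := 'rV[R]_n.
Local Notation C := R[i].
Local Notation reC := (@complex.Re R).
Local Notation imC := (@complex.Im R).
Local Notation normc := (@Normc.normc R).
Variable Omega : set E.
Hypothesis oO : open Omega.
Implicit Types (u v f g phi psi : E -> C) (K : set E).

Local Opaque smooth C1_at Dj derive derivable.

Lemma Rintegral_supp_bound K (f : E -> R) (b : R) : compact K -> K `<=` Omega ->
  measurable_fun K f -> (forall x, K x -> `|f x| <= b) -> (forall x, ~ K x -> f x = 0) ->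
  `|Rintegral (lebesgue_row n) Omega f| <= b * fine (lebesgue_row n K).
Proof.
move=> cK KO mf fb f0; have mK := compact_measurable_row cK; have Kf := compact_lty cK.
have bd (g : E -> R) : (forall x, K x -> `|g x| <= b) -> [bounded g x | x in K].
  move=> gb; exists b; split; first exact: num_real.
  by move=> M bM x Kx /=; rewrite (le_trans (gb x Kx))// ltW.
have fi := measurable_bounded_integrable mK Kf mf (bd f fb).
have fni : (lebesgue_row n).-integrable K (EFin \o (fun x => `|f x|)).
  apply: measurable_bounded_integrable => //.
    by apply: measurableT_comp.
  by apply: bd => x Kx; rewrite normr_id fb.
have ci : (lebesgue_row n).-integrable K (EFin \o (fun=> b)).
  apply: measurable_bounded_integrable => //.
  by exists `|b|; split; [exact: num_real|move=> M bM x Kx /=; exact: ltW].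
have -> : Rintegral (lebesgue_row n) Omega f = Rintegral (lebesgue_row n) K f.
  rewrite Rintegral_mkcond [RHS]Rintegral_mkcond; congr Rintegral; apply/funext => x.
  rewrite !patchE; have [Kx|nKx] := pselect (K x).
    by rewrite !mem_set//; exact: KO.
  by rewrite (memNset nKx) f0//; case: ifP.
apply: le_trans (le_normr_Rintegral mK fi) _.
by rewrite -(Rintegral_cst (lebesgue_row n) mK); exact: le_Rintegral.
Qed.

Lemma is_distribution_regular u : smooth Omega u -> is_distribution Omega (regular_dist Omega u).
Proof.
move=> su; split=> [c phi psi tp tq|K cK KO].
  rewrite !regular_dist_cint//; last exact: (test_funD (test_funZ c tp) tq).
  have -> : (fun x => u x * (c * phi x + psi x)) =
      (fun x => c * (u x * phi x) + u x * psi x).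
    by apply/funext => x; ring.
  have t1 := test_funM oO su tp; have t2 := test_funM oO su tq.
  by rewrite (cintD (test_funZ c t1) t2) (cintZ c t1).
have [b b0 hb] := smooth_compact_bound cK KO su.
(* The distribution has order 0; [b] is counted twice, for the real and the imaginary part. *)
exists ((b + b) * fine (lebesgue_row n K)), 0%N => phi sphi p0 B hB.
have pB x : normc (phi x) <= B.
  pose z : multi n := [ffun=> 0%N].
  have m0 : mdeg z = 0%N by apply: big1 => i _; rewrite ffunE.
  have w0 : word z = [::] by apply: size0nil; rewrite size_word.
  by have := hB z x; rewrite m0 DalphaE w0; exact.
have su' := smoothM oO su (smooth_sub (@subsetT _ Omega) sphi).
have [m1 m2] := measurable_smooth oO su' KO.
have ub x : K x -> normc (u x * phi x) <= b * B.
  by move=> Kx; rewrite Normc.normcM ler_pM ?normc_ge0// hb.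
have u0 x : ~ K x -> u x * phi x = 0 by move=> /p0 ->; rewrite mulr0.
apply: le_trans (normc_le_ReIm _) _; rewrite mulrAC mulrDl mulrDl lerD//=.
  apply: (Rintegral_supp_bound cK KO m1) => x Kx; last by rewrite /= u0.
  exact: le_trans (normRe _) (ub _ Kx).
apply: (Rintegral_supp_bound cK KO m2) => x Kx; last by rewrite /= u0.
exact: le_trans (normIm _) (ub _ Kx).
Qed.

Lemma L2norm_le K f (b : R) : compact K -> 0 <= b ->
  measurable_fun K (reC \o f) -> measurable_fun K (imC \o f) ->
  (forall x, K x -> normc (f x) <= b) ->
  (L2norm K f <= (b * (fine (lebesgue_row n K)) `^ 2^-1)%:E)%E.
Proof.
move=> cK b0 m1 m2 fb; have mK := compact_measurable_row cK.
have muE : lebesgue_row n K = (fine (lebesgue_row n K))%:E.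
  by rewrite fineK// ge0_fin_numE// compact_lty.
rewrite /L2norm unlock /=.
pose g x : \bar R := ((reC (f x)) ^+ 2 + (imC (f x)) ^+ 2)%:E.
have -> : (\int[lebesgue_row n]_x `|((fun y => (normc (f y))%:E) \_ K) x| `^ 2 =
    \int[lebesgue_row n]_(x in K) g x)%E.
  rewrite [RHS]integral_mkcond; apply: eq_integral => x _; rewrite !patchE.
  case: ifP => _; last by rewrite /= normr0 powR0.
  rewrite /= ger0_norm ?normc_ge0// powR_mulrn ?normc_ge0// /g; congr EFin.
  by case: (f x) => r s /=; rewrite sqr_sqrtr// addr_ge0// sqr_ge0.
have g0 x : (0 <= g x)%E by rewrite lee_fin addr_ge0// sqr_ge0.
apply: le_trans (_ : ((b ^+ 2)%:E * lebesgue_row n K) `^ 2^-1 <= _)%E.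
  apply: gt0_ler_poweR; first by rewrite invr_ge0.
  - by rewrite in_itv /= leey andbT; apply: integral_ge0 => x _.
  - by rewrite in_itv /= leey andbT mule_ge0// lee_fin exprn_ge0.
  rewrite -(integral_cst _ mK); apply: ge0_le_integral => //.
  - by apply/measurable_EFinP; apply: measurable_funD; exact: measurable_funX.
  - move=> x Kx; rewrite lee_fin; have nb := normc_ge0 (f x).
    apply: le_trans (_ : normc (f x) ^+ 2 <= _).
      by case: (f x) => r s /=; rewrite sqr_sqrtr// addr_ge0// sqr_ge0.
    exact: (lerXn2r 2 nb b0 (fb x Kx)).
rewrite muE -EFinM poweR_EFin lee_fin powRM ?exprn_ge0 ?fine_ge0//.
by rewrite -powR_mulrn// -powRrM mulfV// powRr1.
Qed.

Lemma L2loc_smooth u : smooth Omega u -> L2loc Omega u.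
Proof.
move=> su K cK KO; have [m1 m2] := measurable_smooth oO su KO.
have [b b0 hb] := smooth_compact_bound cK KO su.
by split => //; apply: le_lt_trans (L2norm_le cK b0 m1 m2 hb) (ltry _).
Qed.

End regular.

(** * From a zero of the principal symbol to the function u *)

Lemma symbolZ (R : realType) (n d : nat) (p : multi n -> 'rV[R]_n -> R[i])
    (x xi : 'rV[R]_n) (c : R) :
  symbol d p x (c *: xi) = (c ^+ d)%:C * symbol d p x xi.
Proof.
rewrite /symbol mulr_sumr; apply: eq_bigr => a /eqP ad.
have -> : mpow (c *: xi) (mval a) = c ^+ d * mpow xi (mval a).
  transitivity (c ^+ mdeg (mval a) * mpow xi (mval a)); last by rewrite ad.
  by rewrite -prod_mpow; apply: eq_bigr => i _; rewrite mxE.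
by rewrite rmorphM mulrCA.
Qed.

Unset Implicit Arguments.

Theorem theorem2p3 (R : realType) (n : nat) (Omega : set 'rV[R]_n)
    (d : nat) (p : multi n -> 'rV[R]_n -> R[i]) (M : nat -> R) :
  open Omega -> (0 < d)%N ->
  (forall a, (mdeg a <= d)%N -> analytic Omega (p a)) ->
  (exists a x, [/\ mdeg a = d, Omega x & p a x != 0]) ->
  ~ elliptic Omega d p ->
  weight_sequence M -> strongly_nonquasianalytic M ->
  exists u : 'rV[R]_n -> R[i],
    [/\ smooth Omega u,
        beurling_vectors M Omega d p (regular_dist Omega u) &
        ~ roumieu M Omega u].
Proof.
move=> oO d0 ap _ /existsNP[x0 /not_implyP[Ox0 /existsNP[xi /not_implyP[xi0]]]] + wM nqM.
move=> /negP; rewrite negbK => /eqP sym0.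
have [l xil] : exists l, xi 0 l != 0.
  apply: contrapT => /forallNP h; move/eqP: xi0; apply; apply/rowP => j.
  by have /negP := h j; rewrite negbK mxE => /eqP.
(* By homogeneity the zero may be rescaled so that its l-th coordinate is 1, the normalisation under
   which the pure derivatives of the packets at x0 are bounded below. *)
have sym1 : symbol d p x0 ((xi 0 l)^-1 *: xi) = 0 by rewrite symbolZ sym0 mulr0.
have xi1 : ((xi 0 l)^-1 *: xi) 0 l = 1 by rewrite mxE mulVf.
have [u [su Pu big]] := witness_exists oO d0 ap wM nqM Ox0 sym1 xi1.
have suO := smooth_sub (@subsetT _ Omega) su.
have sp a : (mdeg a <= d)%N -> smooth Omega (p a).
  by move=> ad; exact: (analytic_smooth (ap a ad)).
have sPu k := smooth_iter_diff_op oO sp k suO.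
exists u; split; first exact: suO.
  apply: (conj (is_distribution_regular oO suO)).
  exists (fun k => iter k (diff_op d p) u); split.
    move=> k; split; first exact (L2loc_smooth oO (sPu k)).
    by move=> phi tp; exact: (iter_apply_op oO sp k suO tp).
  move=> K h cK KO h0; have [A A0 hA] := Pu K cK KO h h0.
  have [M0 _ _ _] := wM.
  pose c := fine (lebesgue_row n K) `^ 2^-1.
  have c0 : 0 <= c := powR_ge0 _ _.
  (* [c] is the square root of the measure of [K], which may vanish; adding 1 keeps the constant
     positive. *)
  exists (A * (c + 1)) => [|k]; first by rewrite mulr_gt0// ltr_wpDl.
  have [m1 m2] := measurable_smooth oO (sPu k) KO.
  have b0 : 0 <= A * h ^+ k * M (d * k)%N by rewrite !mulr_ge0 ?exprn_ge0// ltW.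
  apply: le_trans (L2norm_le cK b0 m1 m2 (hA k)) _.
  rewrite lee_fin -/c mulrC (_ : A * (c + 1) * _ * _ = (c + 1) * (A * h ^+ k * M (d * k)%N)); last by ring.
  by rewrite ler_wpM2r// lerDl.
move=> [_ hR]; have [|A [h [A0 h0 hD]]] := hR [set x0] (@compact_set1 _ x0).
  by move=> _ ->.
have [k] := big A h A0 h0.
by have := hD (axis l k) x0 erefl; rewrite mdeg_axis leNgt => /negP.
Qed.
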